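(* Let $\omega_0$ be smooth initial data for the two-dimensional incompressible Euler equation in vorticity form in the half plane, $$\partial_t\omega+u\cdot\nabla\omega=0\ \text{ in }\ \mathbb{R}^2_+\times\mathbb{R}_+,\qquad u=\nabla^\perp\Delta_D^{-1}\omega\ \ (D=\mathbb{R}^2_+),\qquad \omega(x,0)=\omega_0(x).$$ Then the solution $\omega$ to this problem satisfies $$1+\log\Big(3+\frac{\|\nabla\omega(t)\|_{L^\infty(\mathbb{R}^2_+)}}{\|\omega_0\|_{L^\infty(\mathbb{R}^2_+)}}\Big)\le\Big(1+\log\Big(3+\frac{\|\nabla\omega_0\|_{L^\infty(\mathbb{R}^2_+)}}{\|\omega_0\|_{L^\infty(\mathbb{R}^2_+)}}\Big)\Big)\,e^{C(\|\omega_0\|_{L^\infty(\mathbb{R}^2_+)}+\|\omega_0\|_{L^q(\mathbb{R}^2_+)})t},$$ where the constant $C$ depends on $q\in[1,2)$.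
   Context: $\mathbb{R}^2_+=\{(x_1,x_2)\in\mathbb{R}^2: x_2>0\}$ and $\mathbb{R}_+=(0,\infty)$. Here $\nabla^\perp=(\partial_2,-\partial_1)$ and $\Delta_D^{-1}$ is the inverse of the Laplacian on $D=\mathbb{R}^2_+$ with homogeneous Dirichlet boundary condition, so that the velocity is given explicitly by $$u(x,t)=\frac1{2\pi}\int_{\mathbb{R}^2_+}\Big(\frac{(x-y)^\perp}{|x-y|^2}-\frac{(x-\bar y)^\perp}{|x-\bar y|^2}\Big)\omega(y,t)\,dy,$$ with $z^\perp=(z_2,-z_1)$ and $\bar z=(z_1,-z_2)$ for $z=(z_1,z_2)$. The notation $\omega(t)$ means $\omega(\cdot,t)$. *)

(* Defs.v *)
From mathcomp Require Import all_boot all_order all_algebra.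
From mathcomp Require Import all_classical all_reals all_analysis.
Set Implicit Arguments.
Unset Strict Implicit.
Unset Printing Implicit Defensive.
Import Order.TTheory GRing.Theory Num.Theory.
Import numFieldNormedType.Exports.
Local Open Scope classical_set_scope.
Local Open Scope ring_scope.

(* C^k on an open set A: iterated directional derivatives of order at most k
   exist and are continuous at every point of A. *)
Fixpoint class_C (R : realType) (V : normedModType R) (k : nat) (A : set V)
    (f : V -> R) {struct k} : Prop :=
  (forall x, A x -> {for x, continuous f}) /\
  match k with
  | 0 => True
  | k'.+1 => forall v : V,
      (forall x, A x -> derivable f x v) /\ class_C k' A ('D_v f)
  end.

Definition smooth_on (R : realType) (V : normedModType R) (A : set V)
  (f : V -> R) : Prop := forall k, class_C k A f.

Section HalfPlane.
Context {R : realType}.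
Implicit Types (x y z : R * R) (f : R * R -> R) (p : \bar R).

Definition half_plane : set (R * R) := [set x | 0 < x.2].

Definition leb2 :
    {measure set (measurableTypeR R * measurableTypeR R) -> \bar R} :=
  (@lebesgue_measure R \x @lebesgue_measure R)%E.

Definition normLp p f : \bar R :=
  Lnorm leb2 p (EFin \o (f \_ half_plane)).

Definition partial1 f : R * R -> R := 'D_((1, 0) : R * R) f.
Definition partial2 f : R * R -> R := 'D_((0, 1) : R * R) f.

(* The norm of the library on R * R is the maximum norm, hence the explicit
   Euclidean lengths below. *)
Definition grad_length f x : R :=
  Num.sqrt (partial1 f x ^+ 2 + partial2 f x ^+ 2).

Definition sqr_length z : R := z.1 ^+ 2 + z.2 ^+ 2.
Definition perp z : R * R := (z.2, - z.1).
Definition reflect_bdry z : R * R := (z.1, - z.2).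

(* Up to the factor 1 / (2 pi), the kernel of nabla^perp (Delta_D)^-1, i.e.
   nabla^perp_x of log |x - y| - log |x - bar y|. *)
Definition BS_kernel x y : R * R :=
  (sqr_length (x - y))^-1 *: perp (x - y)
  - (sqr_length (x - reflect_bdry y))^-1 *: perp (x - reflect_bdry y).

Definition velocity f x : R * R :=
  ((2 * pi)^-1 * \int[leb2]_(y in half_plane) ((BS_kernel x y).1 * f y),
   (2 * pi)^-1 * \int[leb2]_(y in half_plane) ((BS_kernel x y).2 * f y)).

(* Classical solutions w (time first) in L^oo_loc([0, oo); L^oo `&` L^q).
   For q < 2 the bounds make the integrals in [velocity] absolutely
   convergent; at t = 0 they contain w0 \in L^oo `&` L^q. *)
Record euler_solution (q : R) (w0 : R * R -> R) (w : R -> R * R -> R) : Prop :=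
  EulerSolution {
  euler_C1 : class_C 1 [set tx : R * (R * R) | 0 < tx.1 /\ half_plane tx.2]
    (fun tx => w tx.1 tx.2);
  euler_cont : {within [set tx : R * (R * R) | 0 <= tx.1 /\ half_plane tx.2],
    continuous (fun tx => w tx.1 tx.2)};
  euler_bounded : forall T : R, exists M : R, forall t : R, 0 <= t <= T ->
    (normLp +oo (w t) <= M%:E)%E /\ (normLp q%:E (w t) <= M%:E)%E;
  euler_init : forall x, half_plane x -> w 0 x = w0 x;
  euler_eq : forall (t : R) x, 0 < t -> half_plane x ->
    derive1 (fun s : R => w s x) t
      + ((velocity (w t) x).1 * partial1 (w t) x
         + (velocity (w t) x).2 * partial2 (w t) x) = 0
}.

End HalfPlane.

(* Main.v *)
(** No flow map is used.  If [w] is bounded by [m], of L^q norm at most [N], and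
    [|w x - w y| <= l * d x y], then the velocity satisfies
    [|u x - u y| <= C * (m + N) * (1 + ln (3 + l / m)) * d x y]: the modulus is used
    at distance at most [m / (3 m + l)] from [x], the intermediate dyadic shells give
    the logarithm, and the far field is bounded by Young's inequality.  To use the
    modulus up to the boundary one subtracts from [w] the constant [w x] on a
    horizontal strip, whose velocity is an explicit shear.

    Conversely, if [u] is [b]-Lipschitz with respect to [d], a bound
    [l] on the modulus of [w] at time [s] becomes [l * exp (b * (t - s))] at time [t]:
    this is the maximum principle for [w t x - w t y - l * exp (b * (t - s)) * d x y],
    penalized by the barrier [1 + |x|^2 - ln x.2], which grows at most exponentially
    along the flow because [u.2] is of order [x.2 * (1 + |ln x.2|)].  The distance is
    [d x y = sqrt (|x - y|^2 + e^2)], with respect to which [w] is trivially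
    [2 m / e]-Lipschitz; this fixes a time step on which the two estimates are
    bootstrapped, and with [A = 1 + ln (3 + l / m)] they give [A' <= C * (m + N) * A].
    Finally [e] tends to [0].

    The L^q norm does not increase: test the equation for a C^1 approximation of
    [|w|^q] with a cutoff built from the barrier.  The weak divergence of [u] vanishes
    by Fubini, because that of the regularized kernel [(z.2, - z.1) / (|z|^2 + k)]
    does. *)
Require Import Defs.
From HB Require Import structures.
From mathcomp Require Import all_boot all_order all_algebra.
From mathcomp Require Import all_classical all_reals all_analysis.
From mathcomp Require Import measurable_realfun ess_sup_inf.
From mathcomp Require Import ring lra.
Set Implicit Arguments.
Unset Strict Implicit.
Unset Printing Implicit Defensive.
Import Order.TTheory GRing.Theory Num.Theory.
Import numFieldNormedType.Exports.
Local Open Scope classical_set_scope.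
Local Open Scope ring_scope.

(** * Euclidean length and integrals of powers of the distance *)

(** The obstacle is a circularity: a Lipschitz bound for the velocity needs a modulus of continuity
    of [w], and propagating that modulus needs the Lipschitz bound. At positive times the gradient
    of [w] is only known to be continuous inside the open half plane, so a continuity argument on
    its sup norm has no starting point. With the regularized distance every bounded function has a
    modulus, and the final bound [lipmod] does not depend on [e], although the number of time steps
    does. Suprema over the half plane need not be attained, because of infinity and of the boundary;
    the penalization makes the maximum an interior one, where first derivatives suffice. The same
    comparison with [l = 0] bounds [w] by [m]. Decay of the L^q norm has to be proved because a
    solution is only assumed bounded in L^q on bounded time intervals, while the exponent contains
    the initial norm; and the velocity, given as an integral, is not known to be differentiable,
    hence the weak form of the divergence. *)

Section Plane.
Context {R : realType}.
Implicit Types (x y z a b : R * R).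

Local Notation mu := (@leb2 R).
Local Notation T2 := (measurableTypeR R * measurableTypeR R)%type.
Local Notation leb := (@lebesgue_measure R).

Definition len z : R := Num.sqrt (sqr_length z).

Lemma sqr_length_ge0 z : 0 <= sqr_length z.
Proof. by rewrite /sqr_length addr_ge0 ?sqr_ge0. Qed.

Lemma len_ge0 z : 0 <= len z.
Proof. exact: sqrtr_ge0. Qed.

Lemma sqr_len z : len z ^+ 2 = sqr_length z.
Proof. by rewrite sqr_sqrtr// sqr_length_ge0. Qed.

Lemma len_ge1 z : `|z.1| <= len z.
Proof.
by rewrite -sqrtr_sqr ler_wsqrtr// /sqr_length lerDl sqr_ge0.
Qed.

Lemma len_ge2 z : `|z.2| <= len z.
Proof.
by rewrite -sqrtr_sqr ler_wsqrtr// /sqr_length lerDr sqr_ge0.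
Qed.

Lemma len_le_sum z : len z <= `|z.1| + `|z.2|.
Proof.
rewrite -(ger0_norm (addr_ge0 (normr_ge0 z.1) (normr_ge0 z.2))) -sqrtr_sqr.
rewrite ler_wsqrtr// /sqr_length sqrrD !real_normK ?num_real//.
by rewrite lerD2r lerDl mulrn_wge0// mulr_ge0.
Qed.

Lemma len0P z : (len z == 0) = (z == 0).
Proof.
rewrite /len sqrtr_eq0 le_eqVlt ltNge sqr_length_ge0 orbF.
rewrite /sqr_length paddr_eq0 ?sqr_ge0// !sqrf_eq0.
by case: z.
Qed.

Lemma lenN z : len (- z) = len z.
Proof. by rewrite /len /sqr_length /= !sqrrN. Qed.

Lemma lenB x y : len (x - y) = len (y - x).
Proof. by rewrite -lenN opprB. Qed.

Lemma norm_dot_le a b : `|a.1 * b.1 + a.2 * b.2| <= len a * len b.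
Proof.
rewrite -(@ler_pXn2r _ 2) ?nnegrE ?mulr_ge0 ?len_ge0//.
rewrite real_normK ?num_real// exprMn !sqr_len /sqr_length -subr_ge0.
rewrite (_ : _ - _ = (a.1 * b.2 - a.2 * b.1) ^+ 2) ?sqr_ge0//; ring.
Qed.

Lemma lenD a b : len (a + b) <= len a + len b.
Proof.
rewrite -(@ler_pXn2r _ 2) ?nnegrE ?addr_ge0 ?len_ge0//.
have := le_trans (ler_norm _) (norm_dot_le a b).
by rewrite sqrrD !sqr_len /sqr_length /= -mulr_natl => ?; nra.
Qed.

Lemma lenZ (c : R) z : len (c *: z) = `|c| * len z.
Proof.
rewrite /len /sqr_length /= (_ : _ + _ = c ^+ 2 * (z.1 ^+ 2 + z.2 ^+ 2)).
  by rewrite sqrtrM ?sqr_ge0// sqrtr_sqr.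
by rewrite /GRing.scale/=; ring.
Qed.

Lemma dist_triangle y x z : len (x - z) <= len (x - y) + len (y - z).
Proof. by rewrite (le_trans _ (lenD _ _))// addrA subrK. Qed.

(** Measurability refers to the product sigma-algebra of [T2], openness to the product topology; an
    open set is the union of the countably many rational boxes that it contains. *)
Lemma open_measurable2 (U : set (R * R)) : open U ->
  measurable (U : set T2).
Proof.
move=> oU.
pose B (i : rat * rat * nat) : set T2 :=
  (ball (ratr i.1.1 : R) (i.2.+1%:R^-1)) `*` (ball (ratr i.1.2 : R) (i.2.+1%:R^-1)).
pose F i : set T2 := if `[< B i `<=` U >] then B i else set0.
have -> : U = \bigcup_i F i.
  apply/seteqP; split => [x Ux|x [i _]]; last first.
    by rewrite /F; case: asboolP => // BU Bx; exact: BU.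
  have /nbhs_ballP[e /= e0 eU] : nbhs x U by exact: open_nbhs_nbhs.
  have [n _ /(_ n (leqnn _)) ne] := near_infty_natSinv_lt (PosNum (divr_gt0 e0 (ltr0Sn R 1))).
  have n0 : 0 < (n.+1%:R^-1 : R) by rewrite invr_gt0.
  have P (c : R) : exists r : rat, ball c n.+1%:R^-1 (ratr r).
    have ne0 : ball c (n.+1%:R^-1 : R) !=set0 by exists c; exact: ballxx.
    have ob : open (ball c (n.+1%:R^-1 : R)) by apply: ball_open.
    have [y [h [r _ ry]]] := @dense_rat R _ ne0 ob.
    by exists r; rewrite ry.
  have [r1 h1] := P x.1; have [r2 h2] := P x.2.
  exists ((r1, r2), n) => //; rewrite /F asboolT.
    by split => /=; exact: ball_sym.
  move=> y [/= hy1 hy2]; apply: eU.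
  have le (c d : R) : ball c n.+1%:R^-1 d -> ball c (e / 2) d.
    exact: le_ball (ltW ne) _.
  rewrite [e]splitr.
  by split; apply: ball_triangle; apply: le; [exact: h1|exact: hy1|exact: h2|exact: hy2].
apply: countable_bigcupT_measurable => //.
move=> i; rewrite /F; case: asboolP => // _.
by apply: measurableX; exact: measurable_ball.
Qed.

Lemma continuous_measurable2 (D : set (R * R)) (f : R * R -> R) : open D ->
  {in D, continuous f} -> measurable_fun (D : set T2) (f : T2 -> R).
Proof.
move=> oD cf.
apply: (measurability _ (RGenOInfty.measurableE R)).
move=> _ [_ [r ->] <-].
apply: open_measurable2.
rewrite openE => x [Dx frx]; rewrite /interior.
apply: filterI; first exact: open_nbhs_nbhs.
apply: (cf x (mem_set Dx)).
apply: open_nbhs_nbhs; split => //; exact: interval_open.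
Qed.

Lemma half_plane_open : open (@half_plane R).
Proof.
rewrite (_ : half_plane = snd @^-1` [set` `]0, +oo[%R]).
  by apply: open_comp; [move=> x _; exact: cvg_snd|exact: interval_open].
by apply/seteqP; split => x; rewrite /half_plane/= in_itv/= andbT.
Qed.

Lemma measurable_half_plane : measurable (@half_plane R : set T2).
Proof. exact: open_measurable2 half_plane_open. Qed.

(** The reciprocal is odd and equals the power of exponent -1 on [0 <= x], the point 0 included
    since both sides are 0 there. *)
Lemma measurable_invr : measurable_fun setT (@GRing.inv R : R -> R).
Proof.
have -> : (@GRing.inv R : R -> R) = fun x : R => if 0 <= x then powR x (-1) else - powR (- x) (-1).
  apply/funext => x; case: ifPn => [x0|]; first by rewrite powR_inv1.
  by rewrite -ltNge => x0; rewrite powR_inv1 ?oppr_ge0 ?ltW// invrN opprK.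
apply: measurable_fun_ifT => /=.
- by apply: measurable_fun_ler.
- exact: measurable_powR.
- by apply: measurable_funN; apply: (measurableT_comp (f := fun t : R => powR t (-1))).
Qed.

Lemma measurable_invr_comp d (T : measurableType d) (D : set T) (f : T -> R) :
  measurable_fun D f -> measurable_fun D (fun t => (f t)^-1).
Proof. by move=> mf; apply: (measurableT_comp measurable_invr). Qed.

Lemma measurable_lenB d (T : measurableType d) (f g : T -> T2) :
  measurable_fun setT f -> measurable_fun setT g ->
  measurable_fun setT (fun t => len ((f t : R * R) - (g t : R * R))).
Proof.
move=> /measurable_fun_pairP[f1 f2] /measurable_fun_pairP[g1 g2].
apply: (@measurableT_comp _ _ _ _ _ _ (@Num.sqrt R)).
  by apply: continuous_measurable_fun; exact: sqrt_continuous.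
by apply: measurable_funD; apply: measurable_funX; apply: measurable_funB.
Qed.

Lemma leb2_tonelli1 (f : T2 -> \bar R) : measurable_fun setT f ->
  (forall z, 0 <= f z)%E ->
  (\int[mu]_z f z = \int[leb]_u \int[leb]_v f (u, v))%E.
Proof. exact: fubini_tonelli1. Qed.

Lemma leb2_tonelli2 (f : T2 -> \bar R) : measurable_fun setT f ->
  (forall z, 0 <= f z)%E ->
  (\int[mu]_z f z = \int[leb]_v \int[leb]_u f (u, v))%E.
Proof. exact: fubini_tonelli2. Qed.

Lemma integral_oneDsqrT :
  (\int[leb]_z ((@trigo.oneDsqr R z)^-1)%:E = pi%:E)%E.
Proof.
rewrite ge0_symfun_integralT.
- rewrite -set_itvcy integral0y_oneDsqr -EFinM; congr (_%:E).
  by rewrite mulrC divfK.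
- by move=> z; rewrite invr_ge0 addr_ge0 ?sqr_ge0.
- exact: continuous_oneDsqrV.
- by move=> z /=; rewrite /oneDsqr sqrrN.
Qed.

(** The affine change of variable [F] turns the integrand into the derivative of the arctangent. *)
Lemma integral_poisson (c s : R) : s != 0 ->
  (\int[leb]_z (`|s| / ((z - c) ^+ 2 + s ^+ 2))%:E = pi%:E)%E.
Proof.
move=> s0; have s1 : 0 < `|s| by rewrite normr_gt0.
pose F (z : R) := `|s|^-1 * (z - c).
have dF (z : R) : is_derive z (1 : R) F (`|s|^-1).
  rewrite /F; apply: is_derive_eq; rewrite subr0 /GRing.scale/= ?mulr1 ?mulr0 ?addr0//.
have F'E : F^`()%classic = cst `|s|^-1.
  by apply/funext => z; rewrite derive1E derive_val.
rewrite -integral_oneDsqrT; symmetry; rewrite (@increasing_ge0_integration_by_substitutionT _ F).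
- apply: eq_integral => z _; rewrite F'E; congr (_%:E).
  change ((1 + (`|s|^-1 * (z - c)) ^+ 2)^-1 * `|s|^-1 = `|s| / ((z - c) ^+ 2 + s ^+ 2)).
  rewrite -[s ^+ 2]real_normK ?num_real//; field.
  by rewrite !gt_eqF// ltr_wpDl ?sqr_ge0// exprn_gt0.
- by move=> x y xy; rewrite /F ltr_pM2l ?invr_gt0// ltrD2r.
- by rewrite F'E => z; exact: cvg_cst.
- by rewrite F'E; exact: is_cvg_cst.
- by rewrite F'E; exact: is_cvg_cst.
- by move=> z; apply: ex_derive.
- apply/cvgrNyPle => A; near=> z.
  rewrite /F ler_pdivrMl// lerBlDr; near: z; apply: nbhs_ninfty_le; exact: num_real.
- apply/cvgryPge => A; near=> z.
  rewrite /F ler_pdivlMl// lerBrDr; near: z; apply: nbhs_pinfty_ge; exact: num_real.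
- exact: continuous_oneDsqrV.
- by move=> z; rewrite invr_ge0 addr_ge0 ?sqr_ge0.
Unshelve. all: by end_near. Qed.

Lemma lebesgue_measure_dist_lt (c r : R) : 0 <= r ->
  (leb [set s : R | (`|s - c| < r)%R] = (2 * r)%:E)%E.
Proof.
move=> r0; rewrite (_ : [set s | _] = ball c r).
  by rewrite lebesgue_measure_ball// mulr_natl.
by apply/seteqP; split => s; rewrite /ball/= distrC.
Qed.

(* [|z1| + |z2| >= |z|] splits [1 / |z|] into two Poisson kernels, one in each
   variable, so that Tonelli reduces the planar integral to [integral_poisson]. *)
Lemma integral_invlen_le x (r : R) : 0 <= r ->
  (\int[mu]_(z in [set z | (len (z - x) < r)%R]) ((len (z - x))^-1)%:E
   <= (4 * pi * r)%:E)%E.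
Proof.
move=> r0.
pose g (c s u v : R) : R := (`|u - c| < r)%R%:R * (`|u - c| / ((v - s) ^+ 2 + (u - c) ^+ 2)).
have mg (c s : R) : measurable_fun setT (fun z : T2 => g c s z.1 z.2).
  apply: measurable_funM.
    apply: (@measurableT_comp _ _ _ _ _ _ (fun b : bool => b%:R : R)) => //.
    apply: measurable_fun_ltr => //; apply: measurableT_comp => //.
    exact: measurable_funB.
  apply: measurable_funM.
    by apply: measurableT_comp => //; exact: measurable_funB.
  apply: measurable_invr_comp.
  by apply: measurable_funD; apply: measurable_funX; apply: measurable_funB.
have mg' (c s : R) : measurable_fun setT (fun z : T2 => g c s z.2 z.1).
  exact: (measurableT_comp (mg c s) (@measurable_swap _ _ _ _)).
have g0 c s u v : 0 <= g c s u v.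
  by rewrite /g mulr_ge0// divr_ge0// addr_ge0 ?sqr_ge0.
have gint c s u : (\int[leb]_v (g c s u v)%:E <= (pi * \1_[set u : R | (`|u - c| < r)%R] u)%:E)%E.
  rewrite /g indicE; case: ltP => h; last first.
    rewrite memNset/= ?mulr0; last by apply/negP; rewrite -leNgt.
    by under eq_integral do rewrite mul0r; rewrite integral0.
  rewrite mem_set//= mulr1.
  under eq_integral do rewrite mul1r.
  have [->|uc] := eqVneq (u - c) 0.
    under eq_integral do rewrite normr0 mul0r.
    by rewrite integral0 lee_fin pi_ge0.
  by rewrite integral_poisson.
have gint2 (c s : R) : (\int[leb]_u \int[leb]_v (g c s u v)%:E <= (2 * pi * r)%:E)%E.
  apply: (@le_trans _ _ (\int[leb]_u (pi * \1_[set u : R | (`|u - c| < r)%R] u)%:E)%E).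
    apply: ge0_le_integral => //.
    - by move=> u _; apply: integral_ge0 => v _; rewrite lee_fin.
    - by apply: (@measurable_fun_fubini_tonelli_F _ _ _ _ _ leb (fun z : T2 => (g c s z.1 z.2)%:E)); [exact/measurable_EFinP|move=> z; rewrite lee_fin].
    - apply/measurable_EFinP; apply: measurable_funM => //.
      apply: measurable_indic; rewrite (_ : [set _ | _] = ball c r); first exact: measurable_ball.
      by apply/seteqP; split => t; rewrite /ball/= distrC.
  have mB : measurable [set u : measurableTypeR R | `|u - c| < r].
    rewrite (_ : [set _ | _] = ball c r); first exact: measurable_ball.
    by apply/seteqP; split => t; rewrite /ball/= distrC.
  under eq_integral do rewrite EFinM.
  rewrite ge0_integralZl//; last 2 first.
  - exact/measurable_EFinP/measurable_indic.
  - by rewrite lee_fin pi_ge0.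
  rewrite integral_indic// setIT.
  change (pi%:E * leb [set u : R | (`|u - c| < r)%R] <= (2 * pi * r)%:E)%E.
  rewrite lebesgue_measure_dist_lt//.
  by rewrite -EFinM lee_fin; lra.
have key z : len (z - x) < r ->
    (len (z - x))^-1 <= g x.1 x.2 z.1 z.2 + g x.2 x.1 z.2 z.1.
  move=> zr; rewrite /g.
  have h1 : `|z.1 - x.1| < r := le_lt_trans (len_ge1 (z - x)) zr.
  have h2 : `|z.2 - x.2| < r := le_lt_trans (len_ge2 (z - x)) zr.
  rewrite h1 h2 !mul1r [(z.1 - x.1) ^+ 2 + _]addrC -mulrDl.
  rewrite (_ : _ ^+ 2 + _ = len (z - x) ^+ 2); last by rewrite sqr_len /sqr_length addrC.
  have [->|l0] := eqVneq (len (z - x)) 0; first by rewrite expr0n/= invr0 mulr0.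
  have lp : 0 < len (z - x) by rewrite lt_def l0 len_ge0.
  by rewrite ler_pdivlMr ?exprn_gt0// expr2 mulKf//; exact: len_le_sum.
have mL : measurable_fun setT (fun z : T2 => len ((z : R * R) - x)).
  exact: measurable_lenB.
have mS : measurable [set z : T2 | len ((z : R * R) - x) < r].
  by rewrite -[X in measurable X]setTI; apply: measurable_fun_ltr.
rewrite integral_mkcond.
apply: (@le_trans _ _ (\int[mu]_z ((g x.1 x.2 z.1 z.2)%:E + (g x.2 x.1 z.2 z.1)%:E))%E).
  apply: ge0_le_integral => //.
  - by move=> z _; apply: erestrict_ge0 => t _; rewrite lee_fin invr_ge0 len_ge0.
  - by apply/(measurable_restrictT _ _).1 => //; apply: measurable_funTS; apply/measurable_EFinP; exact: measurable_invr_comp.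
  - by apply: emeasurable_funD; exact/measurable_EFinP.
  move=> z _; rewrite patchE; case: ifPn; last by move=> _; rewrite -EFinD lee_fin addr_ge0.
  by rewrite inE/= => zr; rewrite -EFinD lee_fin; exact: key.
rewrite ge0_integralD//; last 4 first.
- by move=> z _; rewrite lee_fin.
- exact/measurable_EFinP.
- by move=> z _; rewrite lee_fin.
- exact/measurable_EFinP.
have -> : (4 * pi * r = 2 * pi * r + 2 * pi * r)%R by move=> *; lra.
rewrite EFinD leeD//.
  rewrite leb2_tonelli1; last 2 first.
  - exact/measurable_EFinP.
  - by move=> z; rewrite lee_fin.
  exact: gint2.
rewrite leb2_tonelli2; last 2 first.
- exact/measurable_EFinP.
- by move=> z; rewrite lee_fin.
exact: gint2.
Qed.

Lemma measurable_len_sub x : measurable_fun setT (fun z : T2 => len ((z : R * R) - x)).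
Proof. exact: measurable_lenB. Qed.

Lemma measurable_len_lt x (b : R) :
  measurable [set z : T2 | len ((z : R * R) - x) < b].
Proof.
rewrite -[X in measurable X]setTI; apply: measurable_fun_ltr => //.
exact: measurable_len_sub.
Qed.

Lemma measurable_len_ge x (a : R) :
  measurable [set z : T2 | a <= len ((z : R * R) - x)].
Proof.
rewrite -[X in measurable X]setTI; apply: measurable_fun_ler => //.
exact: measurable_len_sub.
Qed.

Lemma measurable_annulus x (a b : R) :
  measurable [set z : T2 | a <= len ((z : R * R) - x) < b].
Proof.
rewrite (_ : [set _ | _] = [set z : T2 | a <= len ((z : R * R) - x)] `&`
   [set z : T2 | len ((z : R * R) - x) < b]); last first.
  by apply/seteqP; split => z /=; [move/andP|move=> [-> ->]].
by apply: measurableI; [exact: measurable_len_ge|exact: measurable_len_lt].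
Qed.

(** Other powers of the distance are compared with a multiple of [1 / len (z - x)] on dyadic shells,
    so that [integral_invlen_le] suffices and polar coordinates are avoided. The constant is
    [4 * pi * (2 * a) * M]. *)
Lemma integral_shell_le x (a M : R) (f : T2 -> R) : 0 < a -> 0 <= M ->
  measurable_fun setT f ->
  (forall z : R * R, a <= len (z - x) < 2 * a ->
     0 <= f z <= M * (len (z - x))^-1) ->
  (\int[mu]_(z in [set z | (a <= len (z - x) < 2 * a)%R]) (f z)%:E
    <= (8 * pi * a * M)%:E)%E.
Proof.
move=> a0 M0 mf hf.
have mL := measurable_len_sub x.
have mI : measurable_fun setT (fun z : T2 => (len ((z : R * R) - x))^-1).
  exact: measurable_invr_comp.
apply: (@le_trans _ _ (\int[mu]_(z in [set z | (a <= len (z - x) < 2 * a)%R])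
    (M * (len (z - x))^-1)%:E)%E).
  apply: ge0_le_integral.
  - exact: measurable_annulus.
  - by move=> z /hf /andP[+ _]; rewrite lee_fin.
  - by apply/measurable_EFinP; exact: measurable_funTS.
  - by apply/measurable_EFinP; apply: measurable_funTS; exact: measurable_funM.
  - by move=> z /hf /andP[_]; rewrite lee_fin.
apply: (@le_trans _ _ (\int[mu]_(z in [set z | (len (z - x) < 2 * a)%R])
    (M * (len (z - x))^-1)%:E)%E).
  apply: ge0_subset_integral.
  - exact: measurable_annulus.
  - exact: measurable_len_lt.
  - by apply/measurable_EFinP; apply: measurable_funTS; exact: measurable_funM.
  - by move=> z _; rewrite lee_fin mulr_ge0// invr_ge0 len_ge0.
  - by move=> z /= /andP[].
under eq_integral do rewrite EFinM.
rewrite ge0_integralZl_EFin//; last 3 first.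
- exact: measurable_len_lt.
- by move=> z _; rewrite lee_fin invr_ge0 len_ge0.
- by apply/measurable_EFinP; exact: measurable_funTS.
have -> : (8 * pi * a * M = M * (4 * pi * (2 * a)))%R by ring.
rewrite EFinM lee_wpmul2l ?lee_fin//.
by apply: integral_invlen_le; rewrite mulr_ge0// ltW.
Qed.

Lemma integral_annulus_le x (a : R) (M : nat -> R) (f : T2 -> R) (n : nat) :
  0 < a -> (forall k, 0 <= M k) -> measurable_fun setT f ->
  (forall k (z : R * R), 2 ^+ k * a <= len (z - x) < 2 ^+ k.+1 * a ->
     0 <= f z <= M k * (len (z - x))^-1) ->
  (\int[mu]_(z in [set z | (a <= len (z - x) < 2 ^+ n * a)%R]) (f z)%:E
    <= (\sum_(k < n) (8 * pi * (2 ^+ k * a) * M k))%:E)%E.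
Proof.
move=> a0 M0 mf hf; elim: n => [|n IH].
  rewrite big_ord0 expr0 mul1r (_ : [set _ | _] = set0); last first.
    by apply/seteqP; split => // z /=; case: leP => //= h; rewrite ltNge h.
  by rewrite integral_set0.
have f0 (z : R * R) : (a <= len (z - x) < 2 ^+ n.+1 * a)%R -> 0 <= f z.
  move=> h.
  suff [k /hf /andP[]//] : exists k, (2 ^+ k * a <= len (z - x) < 2 ^+ k.+1 * a)%R.
  elim: (n) h => [/andP[h1 h2]|k IHk].
    by exists 0%N; rewrite expr0 mul1r h1.
  move=> /andP[h1 h2]; case: (ltP (len (z - x)) (2 ^+ k.+1 * a)) => h.
    by apply: IHk; rewrite h1.
  by exists k.+1; rewrite h.
rewrite (_ : [set _ | _] = [set z : R * R | (a <= len (z - x) < 2 ^+ n * a)%R] `|`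
  [set z | (2 ^+ n * a <= len (z - x) < 2 * (2 ^+ n * a))%R]); last first.
  have h1 : a <= 2 ^+ n * a by rewrite ler_peMl ?exprn_ege1// ?ler1n// ltW.
  have h2 : 2 ^+ n * a <= 2 ^+ n.+1 * a.
    by rewrite exprS -mulrA ler_peMl ?ler1n// mulr_ge0 ?exprn_ge0// ltW.
  apply/seteqP; split => z /=; rewrite mulrA -exprS.
    by move=> /andP[-> ->]; case: (ltP (len (z - x)) (2 ^+ n * a)) => h; [left|right].
  by move=> [/andP[-> h]|/andP[h ->]]; [rewrite (lt_le_trans h)|rewrite (le_trans h1)].
rewrite ge0_integral_setU//=; last 5 first.
- exact: measurable_annulus.
- exact: measurable_annulus.
- by apply/measurable_EFinP; exact: measurable_funTS.
- move=> z hz; rewrite lee_fin; apply: f0.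
  have h1 : a <= 2 ^+ n * a by rewrite ler_peMl ?exprn_ege1// ?ler1n// ltW.
  have h2 : 2 ^+ n * a <= 2 ^+ n.+1 * a.
    by rewrite exprS -mulrA ler_peMl ?ler1n// mulr_ge0 ?exprn_ge0// ltW.
  move: hz => /= [/andP[-> h]|]; first by rewrite (lt_le_trans h).
  by rewrite mulrA -exprS => /andP[h ->]; rewrite (le_trans h1).
- apply/disj_setPS => z /= [/andP[_ h1] /andP[h2 _]].
  by move: (lt_le_trans h1 h2); rewrite ltxx.
rewrite big_ord_recr/= EFinD leeD//.
apply: integral_shell_le => //.
  by rewrite mulr_gt0 ?exprn_gt0.
by move=> z hz; apply: hf; rewrite exprS -mulrA.
Qed.

Lemma integral_exterior_le x (a S : R) (M : nat -> R) (f : T2 -> R) :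
  0 < a -> (forall k, 0 <= M k) -> measurable_fun setT f ->
  (forall z, 0 <= f z) ->
  (forall k (z : R * R), 2 ^+ k * a <= len (z - x) < 2 ^+ k.+1 * a ->
     f z <= M k * (len (z - x))^-1) ->
  (forall n, \sum_(k < n) (8 * pi * (2 ^+ k * a) * M k) <= S) ->
  (\int[mu]_(z in [set z | (a <= len (z - x))%R]) (f z)%:E <= S%:E)%E.
Proof.
move=> a0 M0 mf f0 hf hS.
pose E n := [set z : T2 | (a <= len ((z : R * R) - x) < 2 ^+ n * a)%R].
rewrite (_ : [set _ | _] = \bigcup_n E n); last first.
  apply/seteqP; split => z /=; last by move=> [n _ /andP[]].
  move=> az; have [n _ /(_ n (leqnn n)) /= hn] := near_infty_natSinv_expn_lt (PosNum (divr_gt0 a0 (lt_le_trans a0 az))).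
  exists n => //; rewrite /E/= az/=.
  move: hn; rewrite ltr_pdivlMr ?(lt_le_trans a0)//.
  by rewrite div1r ltr_pdivrMl// exprn_gt0.
have mE n : measurable (E n) by exact: measurable_annulus.
have ndE : nondecreasing_seq E.
  move=> n m nm; apply/subsetPset => z; rewrite /E/= => /andP[-> h]/=.
  by rewrite (lt_le_trans h)// ler_wpM2r ?(ltW a0)// ler_weXn2l ?ler1n.
have cv : (\int[mu]_(z in E n) (f z)%:E @[n --> \oo] -->
    \int[mu]_(z in \bigcup_n E n) (f z)%:E)%E.
  apply: ge0_nondecreasing_set_cvg_integral => //.
  - by move=> i; apply/measurable_EFinP; exact: measurable_funTS.
  - by move=> i z _; rewrite lee_fin.
rewrite -(cvg_lim _ cv)//; apply: lime_le; first by apply/cvg_ex; eexists; exact: cv.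
apply: nearW => n; apply: (@le_trans _ _ (\sum_(k < n) (8 * pi * (2 ^+ k * a) * M k))%:E).
  by apply: integral_annulus_le => // k z hz; rewrite f0/= hf.
by rewrite lee_fin.
Qed.

End Plane.

(** * Integrable majorants *)

Section IntegralBounds.
Context {R : realType}.

Local Notation mu := (@leb2 R).
Local Notation T2 := (measurableTypeR R * measurableTypeR R)%type.
Local Notation leb := (@lebesgue_measure R).
Implicit Types (f g F : R * R -> R) (x : R * R).

Lemma ind1 (A : set (R * R)) (z : R * R) : A z -> \1_A z = 1 :> R.
Proof. by move=> Az; rewrite indicE mem_set. Qed.

Lemma ind0 (A : set (R * R)) (z : R * R) : ~ A z -> \1_A z = 0 :> R.
Proof. by move=> Az; rewrite indicE memNset. Qed.

Lemma indb (P : pred (R * R)) (z : R * R) : \1_[set z | P z] z = (P z)%:R :> R.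
Proof.
rewrite indicE; suff -> : (z \in [set z | P z]) = P z by [].
by apply/idP/idP; rewrite inE.
Qed.

(** Majorants that carry an explicit bound of their integral: each velocity estimate adds a few of
    them, one for each zone of the plane, and concludes by [ibound_Rintegral]. *)
Definition ibound f (a : R) := [/\ measurable_fun setT (f : T2 -> R),
  forall z, 0 <= f z & (\int[mu]_z (f z)%:E <= a%:E)%E].

Lemma iboundD f g a b : ibound f a -> ibound g b ->
  ibound (fun z => f z + g z) (a + b).
Proof.
move=> [mf f0 fa] [mg g0 gb]; split.
- exact: measurable_funD.
- by move=> z; rewrite addr_ge0.
- under eq_integral do rewrite EFinD.
  rewrite ge0_integralD//; last 4 first.
  + by move=> z _; rewrite lee_fin.
  + exact/measurable_EFinP.
  + by move=> z _; rewrite lee_fin.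
  + exact/measurable_EFinP.
  by rewrite EFinD leeD.
Qed.

Lemma iboundZ f a c : 0 <= c -> ibound f a -> ibound (fun z => c * f z) (c * a).
Proof.
move=> c0 [mf f0 fa]; split.
- exact: measurable_funM.
- by move=> z; rewrite mulr_ge0.
- under eq_integral do rewrite EFinM.
  rewrite ge0_integralZl//; last 2 first.
  + exact/measurable_EFinP.
  + by move=> z _; rewrite lee_fin.
  by rewrite EFinM lee_wpmul2l ?lee_fin.
Qed.

Lemma ibound_dom f g a : measurable_fun setT (f : T2 -> R) ->
  (forall z, 0 <= f z <= g z) -> ibound g a -> ibound f a.
Proof.
move=> mf fg [mg g0 ga]; split => //.
  by move=> z; have /andP[] := fg z.
apply: le_trans ga; apply: ge0_le_integral => //.
- by move=> z _; rewrite lee_fin; have /andP[] := fg z.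
- exact/measurable_EFinP.
- exact/measurable_EFinP.
- by move=> z _; rewrite lee_fin; have /andP[] := fg z.
Qed.

Lemma ibound_indic (A : set T2) f a : measurable A ->
  measurable_fun setT (f : T2 -> R) ->
  (forall z, 0 <= f z) -> (\int[mu]_(z in A) (f z)%:E <= a%:E)%E ->
  ibound (fun z => \1_A z * f z) a.
Proof.
move=> mA mf f0 fa; split.
- by apply: measurable_funM => //; exact: measurable_indic.
- by move=> z; rewrite mulr_ge0// indicE.
- move: fa; rewrite integral_mkcond; congr (_ <= _)%E.
  apply: eq_integral => z _; rewrite patchE indicE.
  by case: ifPn => _; rewrite ?mul1r// mul0r.
Qed.

Lemma negligible_set1 x : mu.-negligible [set x].
Proof.
exists [set x]; split => //.
  rewrite (_ : [set x] = [set x.1] `*` [set x.2]); first exact: measurableX.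
  by apply/seteqP; split => [z ->//|[a b] [/= -> ->]]; case: x.
rewrite (_ : [set x] = [set x.1] `*` [set x.2]).
  have -> : (mu ([set x.1] `*` [set x.2]) = leb [set x.1] * leb [set x.2])%E.
    exact: product_measure1E.
  by rewrite lebesgue_measure_set1 mul0e.
by apply/seteqP; split => [z ->//|[a b] [/= -> ->]]; case: x.
Qed.

(** Two points are excepted because the inverse of 0 is 0: at the poles [x] and [x'] of two kernels
    a majorant built from [(len (z - x))^-1] degenerates, while the reflected part of the kernel
    does not vanish. *)
Lemma ibound_Rintegral (D : set T2) (phi : R * R -> R) h a x x' :
  measurable D -> measurable_fun D (phi : T2 -> R) -> ibound h a ->
  (forall z : R * R, D z -> z <> x -> z <> x' -> `|phi z| <= h z) ->
  mu.-integrable D (EFin \o phi) /\ `|\int[mu]_(z in D) phi z| <= a.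
Proof.
move=> mD mphi [mh h0 ha] hphi.
have le : (\int[mu]_(z in D) `|(phi z)%:E| <= a%:E)%E.
  apply: le_trans ha.
  apply: (@le_trans _ _ (\int[mu]_(z in D) (h z)%:E)%E); last first.
    apply: ge0_subset_integral => //; first exact/measurable_EFinP.
    by move=> z _; rewrite lee_fin.
  apply: ae_ge0_le_integral => //.
  - by apply: measurableT_comp => //; exact/measurable_EFinP.
  - by move=> z _; rewrite lee_fin.
  - by apply/measurable_EFinP; exact: measurable_funTS.
  have := negligibleU (negligible_set1 x) (negligible_set1 x').
  apply: negligibleS => z /=; apply: contra_notP => zxx Dz.
  rewrite lee_fin; apply: hphi => //.
    by move=> zx; apply: zxx; left.
  by move=> zx; apply: zxx; right.
have int : mu.-integrable D (EFin \o phi).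
  apply/integrableP; split; first exact/measurable_EFinP.
  by apply: le_lt_trans le _; rewrite ltry.
split => //.
apply: le_trans (le_normr_Rintegral mD int) _.
rewrite -lee_fin /Rintegral fineK//.
rewrite ge0_fin_numE; last by apply: integral_ge0.
by apply: le_lt_trans le _; rewrite ltry.
Qed.

Local Notation ball2 x r := [set z : R * R | len (z - x) < r].

Lemma ibound_near x r : 0 <= r ->
  ibound (fun z => \1_(ball2 x r) z * (len (z - x))^-1) (4 * pi * r).
Proof.
move=> r0; apply: ibound_indic.
- exact: measurable_len_lt.
- by apply: measurable_invr_comp; exact: measurable_len_sub.
- by move=> z; rewrite invr_ge0 len_ge0.
- exact: integral_invlen_le.
Qed.

(** Each dyadic shell contributes [8 * pi] whatever its radius, so only their number [n] matters;
    [ln 2 >= 1 / 2] bounds it by [2 * (1 + ln r^-1)]. *)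
Lemma ibound_log x (r : R) : 0 < r <= 1 ->
  ibound (fun z => \1_[set z : R * R | r <= len (z - x) < 1] z * (len (z - x))^-1 ^+ 2)
    (16 * pi * (1 + ln r^-1)).
Proof.
move=> /andP[r0 r1].
have mI : measurable_fun setT (fun z : T2 => (len ((z : R * R) - x))^-1 ^+ 2).
  apply: measurable_funX; apply: measurable_invr_comp; exact: measurable_len_sub.
apply: ibound_indic => //; first exact: measurable_annulus.
  by move=> z; rewrite sqr_ge0.
have ln2 : 2^-1 <= ln (2 : R).
  rewrite -ler_expR lnK ?posrE//.
  have := @expR_ge1Dx R (- 2^-1); rewrite expRN => h.
  rewrite -(invrK (expR _)) -[leRHS]invrK lef_pV2 ?posrE ?invr_gt0 ?expR_gt0//.
  by apply: le_trans h; lra.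
have l0 : 0 <= ln r^-1 by rewrite ln_ge0// invf_ge1.
pose n := (Num.truncn (ln r^-1 / ln 2)).+1.
have nr : 1 <= 2 ^+ n * r.
  rewrite -ler_pdivrMr// div1r -ler_ln ?posrE ?invr_gt0 ?exprn_gt0// lnXn//.
  rewrite -[_ *+ n]mulr_natl -ler_pdivrMr ?ln_gt0 ?ltr1n//.
  by rewrite ltW// truncnS_gt.
have nle : n%:R <= 2 * (1 + ln r^-1) :> R.
  rewrite /n -natr1.
  have p2 : 0 <= ln (2 : R) by rewrite (le_trans _ ln2).
  have /andP[h _] := truncn_itv (divr_ge0 l0 p2).
  have h2 : ln r^-1 / ln 2 <= 2 * ln r^-1.
    rewrite ler_pdivrMr ?(lt_le_trans _ ln2)// [2 * _]mulrC -mulrA ler_peMr//.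
    by rewrite mulrC -ler_pdivrMr// div1r.
  rewrite mulrDr mulr1 addrC lerD ?ler1n//; exact: le_trans h h2.
apply: (@le_trans _ _ (\int[mu]_(z in [set z | (r <= len (z - x) < 2 ^+ n * r)%R])
   ((len (z - x))^-1 ^+ 2)%:E)%E).
  apply: ge0_subset_integral.
  - exact: measurable_annulus.
  - exact: measurable_annulus.
  - by apply/measurable_EFinP; exact: measurable_funTS.
  - by move=> z _; rewrite lee_fin sqr_ge0.
  - by move=> z /= /andP[-> h]; rewrite (lt_le_trans h).
apply: le_trans (@integral_annulus_le _ x r (fun k => (2 ^+ k * r)^-1) _ n r0 _ mI _) _.
- by move=> k; rewrite invr_ge0 mulr_ge0 ?exprn_ge0// ltW.
- move=> k z /andP[h _]; rewrite sqr_ge0/= expr2 ler_wpM2r ?invr_ge0 ?len_ge0//.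
  have p : 0 < 2 ^+ k * r by rewrite mulr_gt0// exprn_gt0.
  by rewrite lef_pV2 ?posrE// (lt_le_trans p).
rewrite lee_fin.
under eq_bigr => k _.
  rewrite mulfK; last by rewrite gt_eqF// mulr_gt0// exprn_gt0.
  over.
rewrite sumr_const card_ord -[_ *+ n]mulr_natl.
rewrite (_ : 16 * pi * _ = 2 * (1 + ln r^-1) * (8 * pi)); last by ring.
by rewrite ler_wpM2r// mulr_ge0// pi_ge0.
Qed.

(** On the shell of index [k] one power of the distance is kept and the other [s - 1] are bounded by
    [(2 ^ k)] to the power [1 - s]; the area factor leaves a geometric series of ratio [th], less
    than 1 because [s > 2]. *)
Lemma ibound_tail x (s : R) : 2 < s ->
  ibound (fun z => \1_[set z : R * R | 1 <= len (z - x)] z * (len (z - x))^-1 `^ s)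
    (8 * pi / (1 - 2 `^ (2 - s))).
Proof.
move=> s2.
have mI : measurable_fun setT (fun z : T2 => (len ((z : R * R) - x))^-1 `^ s).
  apply: (measurableT_comp (f := fun t : R => powR t s)) => //.
  by apply: measurable_invr_comp; exact: measurable_len_sub.
apply: ibound_indic => //; first exact: measurable_len_ge.
  by move=> z; rewrite powR_ge0.
pose th : R := 2 `^ (2 - s).
have th0 : 0 < th by rewrite powR_gt0.
have th1 : th < 1.
  rewrite /th -[X in _ < X](@powRr0 _ 2) /powR gt_eqF//= mul0r.
  by rewrite ltr_expR pmulr_llt0 ?ln_gt0 ?ltr1n// subr_lt0.
apply: (@integral_exterior_le _ x 1 _ (fun k => (2 `^ (1 - s)) ^+ k)) => //.
- by move=> z; rewrite powR_ge0.
- move=> k z; rewrite mulr1 => /andP[h _].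
  have p : 0 < (2 : R) ^+ k by rewrite exprn_gt0.
  have lp : 0 < len (z - x) by rewrite (lt_le_trans p).
  rewrite -mulr_powRB1 ?invr_ge0 ?len_ge0 ?(lt_trans _ s2)//.
  rewrite mulrC ler_wpM2r ?invr_ge0 ?len_ge0//.
  apply: (@le_trans _ _ ((2 ^+ k)^-1 `^ (s - 1))).
    apply: ge0_ler_powR; rewrite ?nnegrE ?invr_ge0 ?len_ge0 ?(ltW p)//.
      by rewrite subr_ge0 ltW// (lt_trans _ s2)// ltr1n.
    by rewrite lef_pV2 ?posrE.
  rewrite -powR_invn// -powRrM -powR_mulrn ?powR_ge0// -powRrM.
  by rewrite (_ : _ * _ = (1 - s) * k%:R)//; ring.
- move=> n; under eq_bigr => k _.
    rewrite mulr1 -mulrA -exprMn (_ : 2 * 2 `^ (1 - s) = th); last first.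
      rewrite /th -[X in X * _]powRr1// -powRD; last by rewrite pnatr_eq0 implybT.
      by congr (_ `^ _); ring.
    over.
  rewrite -mulr_sumr ler_wpM2l ?mulr_ge0 ?pi_ge0//.
  rewrite -[leRHS]mul1r ler_pdivlMr ?subr_gt0//.
  suff -> : (\sum_(i < n) th ^+ i) * (1 - th) = 1 - th ^+ n.
    by rewrite gerBl exprn_ge0// ltW.
  by rewrite mulrC -opprB mulNr -subrX1 opprB.
Qed.

(** The Hoelder conjugate of [q]. For [q = 1] it is infinite and 3 stands for it: any finite
    exponent above 2 is good there. The condition [q < 2] says exactly that the conjugate exceeds 2,
    the threshold of integrability at infinity in the plane. *)
Definition conj_exp (q : R) : R := if q == 1 then 3 else q / (q - 1).

Lemma conj_exp_gt2 q : 1 <= q < 2 -> 2 < conj_exp q.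
Proof.
move=> /andP[q1 q2]; rewrite /conj_exp; case: eqVneq => [_|qn]; first by rewrite ltr_nat.
have h : 0 < q - 1 by rewrite subr_gt0 lt_def qn q1.
by rewrite ltr_pdivlMr//; lra.
Qed.

(** Young's inequality with its coefficients bounded by 1. For [q = 1] the bound [b <= 1] already
    gives [a * b <= a]. *)
Lemma mul_le_powR_conj q a b : 1 <= q < 2 -> 0 <= a -> 0 <= b <= 1 ->
  a * b <= a `^ q + b `^ conj_exp q.
Proof.
move=> q12 a0 /andP[b0 b1]; have s2 := conj_exp_gt2 q12.
move: q12 => /andP[q1 q2].
move: s2; rewrite /conj_exp; case: eqVneq => [->|qn] s2.
  by rewrite powRr1//; rewrite -[leLHS]addr0 lerD ?powR_ge0// ler_piMr.
have h : 0 < q - 1 by rewrite subr_gt0 lt_def qn q1.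
have q0 : 0 < q by lra.
have s0 : 0 < q / (q - 1) by lra.
apply: le_trans (conjugate_powR (p := q) (q := q / (q - 1)) a0 b0 q0 s0 _) _.
  by field; rewrite !gt_eqF.
apply: lerD; rewrite ler_pdivrMr// ler_peMr ?powR_ge0//; lra.
Qed.

(** Young's inequality is applied to [F z / N] instead of [F z]; this normalization makes the bound
    linear in [N]. *)
Lemma ibound_far x q F (N : R) : 1 <= q < 2 -> 0 < N ->
  measurable_fun setT (F : T2 -> R) -> (forall z, 0 <= F z) ->
  (\int[mu]_z (F z `^ q)%:E <= (N `^ q)%:E)%E ->
  ibound (fun z => \1_[set z : R * R | 1 <= len (z - x)] z * (F z * (len (z - x))^-1))
    (N * (1 + 8 * pi / (1 - 2 `^ (2 - conj_exp q)))).
Proof.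
move=> q12 N0 mF F0 FN; have /andP[q1 q2] := q12.
have mL : measurable_fun setT (fun z : T2 => (len ((z : R * R) - x))^-1).
  by apply: measurable_invr_comp; exact: measurable_len_sub.
have mE := measurable_len_ge x 1.
have b1 : ibound (fun z => (F z / N) `^ q) 1.
  split.
  - apply: (measurableT_comp (f := fun t : R => powR t q)) => //.
    exact: measurable_funM.
  - by move=> z; rewrite powR_ge0.
  - under eq_integral => z _.
      rewrite powRM ?invr_ge0 ?(ltW N0)// mulrC EFinM; over.
    rewrite ge0_integralZl//; last 3 first.
    + by apply/measurable_EFinP/(measurableT_comp (f := fun t : R => powR t q)).
    + by move=> z _; rewrite lee_fin powR_ge0.
    + by rewrite lee_fin powR_ge0.
    apply: le_trans (lee_wpmul2l _ FN) _; first by rewrite lee_fin powR_ge0.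
    by rewrite -EFinM lee_fin -powRM ?invr_ge0 ?(ltW N0)// mulVf ?gt_eqF// powR1.
have := iboundZ (ltW N0) (iboundD b1 (ibound_tail x (conj_exp_gt2 q12))).
apply: ibound_dom.
  by apply: measurable_funM; [exact: measurable_indic|exact: measurable_funM].
move=> z; have [h|h] := boolP (1 <= len (z - x)); last first.
  rewrite !ind0 ?mul0r ?addr0 ?lexx ?mulr_ge0 ?(ltW N0) ?powR_ge0//; exact/negP.
rewrite !ind1// !mul1r mulr_ge0 ?invr_ge0 ?len_ge0//=.
rewrite -ler_pdivrMl// mulrCA mulrA.
apply: mul_le_powR_conj => //; first by rewrite divr_ge0// ltW.
by rewrite invr_ge0 len_ge0/= invf_le1// (lt_le_trans _ h).
Qed.

(** A constant vorticity on an infinite strip has no L^q bound; the bounded height replaces it. The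
    horizontal integral is a Poisson integral, equal to [pi], and the vertical one the length 2 of
    an interval. *)
Lemma ibound_strip (x : R * R) (c : R) :
  ibound (fun z => \1_[set z : R * R | `|z.2 - c| < 1] z *
     ((z.1 - x.1) ^+ 2 + 1)^-1) (2 * pi).
Proof.
pose g (u v : R) : R := \1_[set v : R | `|v - c| < 1] v * ((u - x.1) ^+ 2 + 1)^-1.
have mS : measurable [set v : R | `|v - c| < 1].
  rewrite (_ : [set _ | _] = ball c 1); first exact: measurable_ball.
  by apply/seteqP; split => t; rewrite /ball/= distrC.
have mg : measurable_fun setT (fun z : T2 => g z.1 z.2).
  apply: measurable_funM.
    change (measurable_fun setT (\1_[set z : T2 | `|z.2 - c| < 1] : T2 -> R)).
    apply: measurable_indic; rewrite (_ : [set _ | _] = setT `*` [set v : R | `|v - c| < 1]).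
      exact: measurableX.
    by apply/seteqP; split => z //= [].
  apply: measurable_invr_comp.
  by apply: measurable_funD => //; apply: measurable_funX; exact: measurable_funB.
have g0 u v : 0 <= g u v.
  by rewrite /g mulr_ge0// ?indicE// invr_ge0 addr_ge0// sqr_ge0.
split => //.
  by move=> z; exact: (g0 z.1 z.2).
change (\int[mu]_z (g z.1 z.2)%:E <= (2 * pi)%:E)%E.
rewrite leb2_tonelli2; last 2 first.
- exact/measurable_EFinP.
- by move=> z; rewrite lee_fin.
rewrite /=.
under eq_integral => v _.
  rewrite /g; under eq_integral do rewrite EFinM.
  rewrite ge0_integralZl//; last 2 first.
  - apply/measurable_EFinP; apply: measurable_invr_comp.
    by apply: measurable_funD => //; apply: measurable_funX; exact: measurable_funB.
  - by move=> u _; rewrite lee_fin invr_ge0 addr_ge0// sqr_ge0.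
  rewrite (_ : (\int[_]_u _ = pi%:E)%E); last first.
    rewrite -(@integral_poisson _ x.1 1)//; apply: eq_integral => u _.
    by rewrite normr1 expr1n div1r.
  rewrite muleC; over.
rewrite ge0_integralZl//; last 2 first.
- exact/measurable_EFinP/measurable_indic.
- by rewrite lee_fin pi_ge0.
rewrite integral_indic// setIT.
change (pi%:E * leb [set v : R | (`|v - c| < 1)%R] <= (2 * pi)%:E)%E.
by rewrite lebesgue_measure_dist_lt// -EFinM lee_fin mulr1 mulrC.
Qed.

End IntegralBounds.

(** * The Biot-Savart kernel *)

Section Kernel.
Context {R : realType}.

Local Notation mu := (@leb2 R).
Local Notation T2 := (measurableTypeR R * measurableTypeR R)%type.
Local Notation leb := (@lebesgue_measure R).
Local Notation H := (@half_plane R).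
Implicit Types (x y z a b p : R * R).

(** A boolean index lets one statement cover both components of the velocity. *)
Definition pr (i : bool) (v : R * R) : R := if i then v.1 else v.2.

Lemma prB i a b : pr i (a - b) = pr i a - pr i b.
Proof. by case: i. Qed.

Lemma pr_le_len i a : `|pr i a| <= len a.
Proof. by case: i; [exact: len_ge1|exact: len_ge2]. Qed.

Definition K z : R * R := (sqr_length z)^-1 *: perp z.

Lemma BS_kernelE x y : BS_kernel x y = K (x - y) - K (x - reflect_bdry y).
Proof. by []. Qed.

Lemma len_perp z : len (perp z) = len z.
Proof. by rewrite /len /sqr_length /perp /= sqrrN addrC. Qed.

Lemma len_K z : len (K z) = (len z)^-1.
Proof.
rewrite /K lenZ len_perp ger0_norm ?invr_ge0 ?sqr_length_ge0// -sqr_len.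
have [->|l0] := eqVneq (len z) 0; first by rewrite mulr0 invr0.
by rewrite expr2 invfM mulfVK.
Qed.

(** Up to a rotation [K] is the inversion in the unit circle, and this is the classical distance
    formula for it. *)
Lemma len_KB a b : a != 0 -> b != 0 ->
  len (K a - K b) = len (a - b) * ((len a)^-1 * (len b)^-1).
Proof.
rewrite -!len0P => a0 b0.
apply/eqP; rewrite -(@eqrXn2 _ 2) ?mulr_ge0 ?invr_ge0 ?len_ge0//; apply/eqP.
rewrite !exprMn !exprVn !sqr_len.
move: a0 b0; rewrite -sqrf_eq0 sqr_len -[len b == 0]sqrf_eq0 sqr_len.
have sc (c d : R) : c *: d = c * d :> R by [].
by rewrite /K /sqr_length /perp /= !sc => a0 b0; field; rewrite a0 b0.
Qed.

Lemma len_gt0 z : z != 0 -> 0 < len z.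
Proof. by move=> z0; rewrite lt_def len0P z0 len_ge0. Qed.

Lemma len_reflect x z : H x -> H z -> len (z - x) <= len (x - reflect_bdry z).
Proof.
rewrite /half_plane/= => x0 z0; rewrite lenB ler_wsqrtr// /sqr_length /reflect_bdry/=.
rewrite lerD2l opprK; nra.
Qed.

Lemma len_reflect_ge x z : H x -> H z -> x.2 + z.2 <= len (x - reflect_bdry z).
Proof.
rewrite /half_plane/= => x0 z0; apply: le_trans (len_ge2 _).
by rewrite /= opprK ler_norm.
Qed.

Lemma reflect_neq0 x z : H x -> H z -> x - reflect_bdry z != 0.
Proof.
move=> Hx Hz; rewrite -len0P gt_eqF// (lt_le_trans _ (len_reflect_ge Hx Hz))//.
by rewrite addr_gt0.
Qed.

Lemma BS_le x z i : H x -> H z -> z <> x ->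
  `|pr i (BS_kernel x z)| <= 2 * (len (z - x))^-1.
Proof.
move=> Hx Hz zx; have zx0 : 0 < len (z - x) by apply: len_gt0; rewrite subr_eq0; apply/eqP.
rewrite BS_kernelE prB (le_trans (ler_normB _ _))// mulr_natl mulr2n lerD//.
  by rewrite (le_trans (pr_le_len _ _))// len_K lenB.
rewrite (le_trans (pr_le_len _ _))// len_K lef_pV2 ?posrE//; first exact: len_reflect.
by rewrite (lt_le_trans zx0)// len_reflect.
Qed.

(** The point [z] and its mirror image are at distance [2 * z.2], which [len_KB] converts into one
    more power of decay. This is what makes the kernel integrable on a strip, where [z.2] is
    bounded. *)
Lemma BS_le_height x z i : H x -> H z -> z <> x ->
  `|pr i (BS_kernel x z)| <= 2 * z.2 * (len (z - x))^-1 ^+ 2.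
Proof.
move=> Hx Hz zx; have zx0 : z - x != 0 by rewrite subr_eq0; apply/eqP.
have l0 := len_gt0 zx0.
rewrite BS_kernelE (le_trans (pr_le_len _ _))// len_KB//; last 2 first.
- by rewrite subr_eq0 eq_sym -subr_eq0.
- exact: reflect_neq0.
rewrite (_ : len (x - z - _) = 2 * z.2); last first.
  rewrite /len /sqr_length /reflect_bdry /=.
  rewrite (_ : _ + _ = (2 * z.2) ^+ 2); last by ring.
  by rewrite sqrtr_sqr ger0_norm// mulr_ge0// ltW.
have z20 : 0 <= 2 * z.2 by rewrite mulr_ge0// ltW.
rewrite ler_wpM2l// expr2 lenB ler_wpM2l ?invr_ge0 ?len_ge0//.
rewrite lef_pV2 ?posrE//; first exact: len_reflect.
by rewrite (lt_le_trans l0)// len_reflect.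
Qed.

(* The second component of the kernel vanishes on the boundary. *)
Lemma BS2_le x z : H x -> H z -> z <> x ->
  `|(BS_kernel x z).2| <= 4 * x.2 * (len (z - x))^-1 ^+ 2.
Proof.
move=> Hx Hz zx; have zx0 : x - z != 0 by rewrite subr_eq0 eq_sym; apply/eqP.
have l0 := len_gt0 zx0; have m0 := len_gt0 (reflect_neq0 Hx Hz).
have e : (BS_kernel x z).2 = - (x - reflect_bdry z).1 * (4 * x.2 * z.2) *
    ((sqr_length (x - z))^-1 * (sqr_length (x - reflect_bdry z))^-1).
  have := lt0r_neq0 m0; have := lt0r_neq0 l0.
  rewrite -sqrf_eq0 sqr_len => a0; rewrite -sqrf_eq0 sqr_len => b0; move: a0 b0.
  have sc (c d : R) : c *: d = c * d :> R by [].
  rewrite BS_kernelE /K /sqr_length /perp /reflect_bdry /= !sc opprK => a0 b0.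
  by field; rewrite a0 b0.
have p1 : 0 <= 4 * x.2 * z.2 by rewrite !mulr_ge0 ?(ltW Hx) ?(ltW Hz).
have p2 : 0 <= (sqr_length (x - z))^-1 * (sqr_length (x - reflect_bdry z))^-1.
  by rewrite mulr_ge0 ?invr_ge0 ?sqr_length_ge0.
rewrite e normrM [X in X * _]normrM normrN (ger0_norm p1) (ger0_norm p2).
rewrite exprVn lenB -!sqr_len -!exprVn.
set d := len (x - z); set D := len (x - reflect_bdry z).
have rg (A B C E D' : R) : A * (4 * B * C) * (E * D') = 4 * B * E * (A * C * D').
  by ring.
rewrite rg.
have p3 : 0 <= 4 * x.2 * d^-1 ^+ 2.
  by apply: mulr_ge0; [rewrite mulr_ge0// ltW|exact: sqr_ge0].
rewrite ler_piMr// exprVn ler_pdivrMr ?exprn_gt0// mul1r expr2 ler_pM ?(ltW Hz)//.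
  exact: len_ge1.
by apply: le_trans (len_reflect_ge Hx Hz); rewrite lerDr ltW.
Qed.

(** The formula [len_KB] is used for [z] and for its mirror image, which is at least as far from [x]
    and [x'] as [z] is. *)
Lemma BSB_le x x' z i : H x -> H x' -> H z -> z <> x -> z <> x' ->
  `|pr i (BS_kernel x z) - pr i (BS_kernel x' z)| <=
  2 * len (x - x') * ((len (z - x))^-1 * (len (z - x'))^-1).
Proof.
move=> Hx Hx' Hz zx zx'.
have zx0 : x - z != 0 by rewrite subr_eq0 eq_sym; apply/eqP.
have zx0' : x' - z != 0 by rewrite subr_eq0 eq_sym; apply/eqP.
have e : pr i (BS_kernel x z) - pr i (BS_kernel x' z) =
    pr i (K (x - z) - K (x' - z)) -
    pr i (K (x - reflect_bdry z) - K (x' - reflect_bdry z)).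
  by rewrite !BS_kernelE !prB; ring.
rewrite e (le_trans (ler_normB _ _))// -mulrA mulr_natl mulr2n lerD//.
  rewrite (le_trans (pr_le_len _ _))// len_KB// lenB (lenB x z) (lenB x' z).
  by rewrite (_ : x' - z - _ = x' - x) 1?lenB//; rewrite opprB addrA subrK.
rewrite (le_trans (pr_le_len _ _))// len_KB ?reflect_neq0//.
rewrite opprB addrA subrK ler_wpM2l ?len_ge0//.
have l0 : 0 < len (z - x) by rewrite lenB len_gt0.
have l0' : 0 < len (z - x') by rewrite lenB len_gt0.
apply: ler_pM; rewrite ?invr_ge0 ?len_ge0// lef_pV2 ?posrE// ?len_reflect//.
- by rewrite (lt_le_trans l0)// len_reflect.
- by rewrite (lt_le_trans l0')// len_reflect.
Qed.

Lemma measurable_K d (T : measurableType d) (f : T -> T2) i :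
  measurable_fun setT f -> measurable_fun setT (fun t => pr i (K (f t))).
Proof.
move=> /measurable_fun_pairP[f1 f2].
have ms : measurable_fun setT (fun t => (sqr_length (f t : R * R))^-1).
  by apply: measurable_invr_comp; apply: measurable_funD; exact: measurable_funX.
by case: i; apply: measurable_funM => //; exact: measurable_funN.
Qed.

Lemma measurable_BS d (T : measurableType d) (f g : T -> T2) i :
  measurable_fun setT f -> measurable_fun setT g ->
  measurable_fun setT (fun t => pr i (BS_kernel (f t) (g t))).
Proof.
move=> mf mg.
have [f1 f2] := (measurable_fun_pairP _).1 mf.
have [g1 g2] := (measurable_fun_pairP _).1 mg.
under eq_fun do rewrite BS_kernelE prB.
apply: measurable_funB.
  apply: (@measurable_K _ _ (fun t => ((f t : R * R) - (g t : R * R)) : T2)).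
  by apply/measurable_fun_pairP; split; exact: measurable_funB.
apply: (@measurable_K _ _ (fun t => ((f t : R * R) - reflect_bdry (g t)) : T2)).
apply/measurable_fun_pairP; split; first exact: measurable_funB.
by apply: measurable_funB => //; exact: measurable_funN.
Qed.

End Kernel.

(** * The shear generated by a strip *)

Section Shear.
Context {R : realType}.

Local Notation mu := (@leb2 R).
Local Notation T2 := (measurableTypeR R * measurableTypeR R)%type.
Local Notation leb := (@lebesgue_measure R).
Local Notation H := (@half_plane R).
Implicit Types (x z p : R * R).

Lemma measurable_reflect (c : R) :
  measurable_fun setT (fun u : measurableTypeR R => (c - u : measurableTypeR R)).
Proof. exact: measurable_funB. Qed.

Lemma lebesgue_measure_reflect (c : R) (A : set R) : measurable A ->
  pushforward leb (fun u : measurableTypeR R => (c - u : measurableTypeR R)) A = leb A.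
Proof.
have mphi := measurable_reflect c.
pose phi : {mfun measurableTypeR R >-> measurableTypeR R} :=
  HB.pack (fun u : measurableTypeR R => (c - u : measurableTypeR R))
    (isMeasurableFun.Build _ _ _ _ _ mphi).
move=> mA; apply/esym; apply: (@lebesgue_measure_unique R (pushforward leb phi)) => //= _ [[a b]] _ <-.
rewrite /pushforward (_ : _ @^-1` _ = `[c - b, c - a[%classic); last first.
  by apply/seteqP; split => u /=; rewrite !in_itv/= ltrBrDr lerBlDr ltrBrDl lerBlDl addrC => /andP[? ?]; apply/andP; split; lra.
rewrite !lebesgue_measure_itv/= !lte_fin ltrD2l ltrN2.
by case: ifP => // _; rewrite !EFinN -!EFinB; congr (_%:E); ring.
Qed.

Lemma integral_odd (c : R) (h : R -> \bar R) :
  leb.-integrable setT h -> (forall u : R, h (c - u)%R = - h u)%E ->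
  (\int[leb]_u h u = 0)%E.
Proof.
move=> ih hodd.
have mh : measurable_fun setT h := measurable_int _ ih.
have e : (\int[leb]_u h u = - \int[leb]_u h u)%E.
  rewrite -integralN//=; last exact: integrable_add_def.
  transitivity (\int[pushforward leb (fun u : measurableTypeR R => (c - u)%R : measurableTypeR R)]_u h u)%E.
    apply: eq_measure_integral => [|Hm A mA _]; first exact: measurable_reflect.
    exact/esym/lebesgue_measure_reflect.
  rewrite (integral_pushforward (measurable_reflect c)) ?preimage_setT//.
    by apply: eq_integral => u _ /=; rewrite hodd.
  rewrite (_ : _ \o _ = \- h)%E; first exact: integrableN.
  by apply/funext => u /=; rewrite hodd.
have /fin_numPlt/= := integrable_fin_num measurableT ih.
move: e; case: (\int[leb]_u h u)%E => //= r [] e _.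
by congr (_%:E); lra.
Qed.

Lemma integral_signed_poisson (c s : R) :
  leb.-integrable setT (fun u => (s / ((u - c) ^+ 2 + s ^+ 2))%:E) /\
  (\int[leb]_u (s / ((u - c) ^+ 2 + s ^+ 2))%:E = (pi * Num.sg s)%:E)%E.
Proof.
have [->|s0] := eqVneq s 0.
  rewrite sgr0 mulr0; under eq_fun do rewrite mul0r; split; first exact: integrable0.
  by rewrite integral0.
have mf : measurable_fun setT (fun u : R => `|s| / ((u - c) ^+ 2 + s ^+ 2)).
  apply: measurable_funM => //; apply: measurable_invr_comp.
  by apply: measurable_funD => //; apply: measurable_funX; exact: measurable_funB.
have i1 : leb.-integrable setT (fun u => (`|s| / ((u - c) ^+ 2 + s ^+ 2))%:E).
  apply/integrableP; split; first exact/measurable_EFinP.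
  under eq_integral => u _.
    rewrite gee0_abs; last by rewrite lee_fin divr_ge0// addr_ge0 ?sqr_ge0.
    over.
  by rewrite integral_poisson// ltry.
have e u : (s / ((u - c) ^+ 2 + s ^+ 2))%:E = ((Num.sg s)%:E * (`|s| / ((u - c) ^+ 2 + s ^+ 2))%:E)%E.
  by rewrite -EFinM mulrA -numEsg.
split.
  by under eq_fun do rewrite e; exact: integrableZl.
under eq_integral do rewrite e.
by rewrite integralZl// integral_poisson// -EFinM mulrC.
Qed.

Lemma leb2_fubini21 (f : T2 -> \bar R) : mu.-integrable setT f ->
  (\int[mu]_z f z = \int[leb]_v \int[leb]_u f (u, v))%E.
Proof. by move=> fi; rewrite -(integral21_prod_meas1 fi). Qed.

Lemma leb2_fubini12 (f : T2 -> \bar R) : mu.-integrable setT f ->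
  (\int[mu]_z f z = \int[leb]_u \int[leb]_v f (u, v))%E.
Proof. by move=> fi; rewrite -(integral12_prod_meas1 fi). Qed.

Lemma restrict_EFin_indic (D : set (R * R)) (g : R * R -> R) :
  (fun z => (g z)%:E) \_ D = (fun z => (\1_D z * g z)%:E).
Proof.
apply/funext => z; rewrite patchE indicE.
by case: ifPn => _; rewrite ?mul1r ?mul0r.
Qed.

(** The support of the constant vorticity subtracted in [velI_lip]. Extended by odd reflection, a
    vorticity jumps across the boundary, so a ball meeting the boundary offers no cancellation; on a
    full horizontal strip the velocity is explicit, and the bounded height keeps the kernel
    integrable. *)
Definition strip (c : R) : set (R * R) := [set z | 0 < z.2 /\ `|z.2 - c| < 1].

Lemma measurable_strip c : measurable (strip c : set T2).
Proof.
apply: measurableI; first exact: measurable_half_plane.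
rewrite -[X in measurable X]setTI; apply: measurable_fun_ltr => //.
by apply: measurableT_comp => //; exact: measurable_funB.
Qed.

Definition strip_weight (c : R) p (z : R * R) : R :=
  \1_[set z : R * R | `|z.2 - c| < 1] z * ((z.1 - p.1) ^+ 2 + 1)^-1.

Lemma invlen2_le_strip c p z : strip c z -> 1 <= len (z - p) ->
  (len (z - p))^-1 ^+ 2 <= 2 * strip_weight c p z.
Proof.
move=> [_ zc] l1; rewrite /strip_weight ind1// mul1r.
have p1 : 0 < (z.1 - p.1) ^+ 2 + 1 by rewrite ltr_wpDl// sqr_ge0.
rewrite ler_pdivlMr// exprVn mulrC ler_pdivrMr ?exprn_gt0 ?(lt_le_trans _ l1)//.
have : (z.1 - p.1) ^+ 2 <= len (z - p) ^+ 2.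
  by rewrite sqr_len /sqr_length/= lerDl sqr_ge0.
have : 1 <= len (z - p) ^+ 2 by rewrite exprn_ege1.
lra.
Qed.

Lemma strip_BS_integrable i c p : H p ->
  mu.-integrable (strip c : set T2) (EFin \o (fun z => pr i (BS_kernel p z))).
Proof.
move=> Hp.
have b := iboundD (iboundZ (ler0n R 2) (ibound_near p (@ler01 R)))
  (iboundZ (mulr_ge0 (ler0n R 4) (addr_ge0 (normr_ge0 c) (@ler01 R))) (ibound_strip p c)).
refine (ibound_Rintegral (x := p) (x' := p) _ _ b _).1.
- exact: measurable_strip.
- by apply: measurable_funTS; exact: measurable_BS.
move=> z Sz zp _; have Hz : H z by case: Sz.
have sw0 : 0 <= strip_weight c p z.
  by rewrite /strip_weight mulr_ge0 ?indicE// invr_ge0 addr_ge0 ?sqr_ge0.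
have [l1|l1] := ltP (len (z - p)) 1.
  rewrite ind1// mul1r (le_trans (BS_le i Hp Hz zp))// lerDl.
  by rewrite mulr_ge0// mulr_ge0// addr_ge0.
rewrite ind0 ?mul0r ?mulr0 ?add0r; last by apply/negP; rewrite -leNgt.
rewrite (le_trans (BS_le_height i Hp Hz zp))//.
have h1 : z.2 <= `|c| + 1.
  case: Sz => _; rewrite ltr_norml => /andP[_]; rewrite ltrBlDr => h.
  by rewrite (le_trans (ltW h))// addrC lerD2r ler_norm.
have h2 := invlen2_le_strip Sz l1.
have h3 : 0 <= (len (z - p))^-1 ^+ 2 by exact: sqr_ge0.
rewrite (_ : 4 * (`|c| + 1) = 2 * (`|c| + 1) * 2); last by ring.
rewrite -[leRHS]mulrA ler_pM// ?mulr_ge0// ?(ltW Hz)//.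
by rewrite ler_wpM2l.
Qed.

(** The reflection [u -> 2 * p.1 - u] of the horizontal variable preserves the strip and changes the
    sign of this component. *)
Lemma strip_integral2 c p : H p ->
  (\int[mu]_(z in strip c) ((BS_kernel p z).2)%:E = 0)%E.
Proof.
move=> Hp; have ip := strip_BS_integrable false c Hp.
have mS := measurable_strip c.
rewrite integral_mkcond restrict_EFin_indic.
move: ip => /(integrable_mkcond _ mS); rewrite restrict_EFin_indic /pr.
set f := (X in mu.-integrable _ X) => fi.
rewrite leb2_fubini21//.
transitivity (\int[leb]_v (cst 0%E v) : \bar R)%E; last exact: integral0.
apply: ae_eq_integral => //.
  exact: (measurable_fubini_G fi).
have := ae_integrable2 fi.
apply: filterS => v iv _ /=; apply: (@integral_odd (2 * p.1)) => // u.
rewrite /f /= !indicE.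
rewrite (_ : ((2 * p.1 - u, v) \in strip c) = ((u, v) \in strip c)); last first.
  by apply/idP/idP; rewrite !inE.
apply: congr1; rewrite -[RHS]mulrN; congr (_ * _).
have sc (a b : R) : a *: b = a * b :> R by [].
rewrite /sqr_length /reflect_bdry /= !sc.
rewrite (_ : (p.1 - (2 * p.1 - u)) = - (p.1 - u)); last by ring.
by rewrite !sqrrN; ring.
Qed.

(** With the horizontal integration done first, the kernel is a difference of two signed Poisson
    kernels of heights [p.2 - v] and [p.2 + v]; the second height is positive, whence the [- 1]. *)
Lemma strip_integral1 c p : H p ->
  (\int[mu]_(z in strip c) ((BS_kernel p z).1)%:E =
   \int[leb]_(v in [set v : R | (0 < v)%R /\ (`|v - c| < 1)%R])
     (pi * (Num.sg (p.2 - v) - 1))%:E)%E.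
Proof.
move=> Hp; have ip := strip_BS_integrable true c Hp.
have mS := measurable_strip c.
rewrite integral_mkcond restrict_EFin_indic.
move: ip => /(integrable_mkcond _ mS); rewrite restrict_EFin_indic /pr.
set f := (X in mu.-integrable _ X) => fi.
rewrite leb2_fubini21// [RHS]integral_mkcond; apply: eq_integral => v _.
rewrite patchE; case: ifPn => [/set_mem hv|/negP hv]; last first.
  rewrite -[RHS](@integral0 _ _ _ leb setT); apply: eq_integral => u _.
  by rewrite /f ind0 ?mul0r// => Suv; apply: hv; apply/mem_set.
have v0 : 0 < v by case: hv.
have [i1 e1] := integral_signed_poisson p.1 (p.2 - v).
have [i2 e2] := integral_signed_poisson p.1 (p.2 + v).
rewrite (_ : (pi * _)%:E = (pi * Num.sg (p.2 - v))%:E - (pi * Num.sg (p.2 + v))%:E)%E; last first.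
  by rewrite -EFinB -mulrBr [Num.sg (p.2 + v)]gtr0_sg// addr_gt0.
rewrite -e1 -e2 -integralB//; apply: eq_integral => u _.
rewrite /f ind1// mul1r.
rewrite -EFinB; congr (_%:E).
have sc (a b : R) : a *: b = a * b :> R by [].
rewrite BS_kernelE /K /perp /sqr_length /reflect_bdry /= !sc opprK.
have -> : (p.1 - u) ^+ 2 = (u - p.1) ^+ 2 by ring.
by rewrite mulrC [X in _ - X]mulrC.
Qed.

(** The densities for [p] and [p'] differ only for [v] between the two heights, where the signs
    differ by at most 2. *)
Lemma strip_integral_lip i c p p' : H p -> H p' ->
  `|\int[mu]_(z in strip c) pr i (BS_kernel p z) -
    \int[mu]_(z in strip c) pr i (BS_kernel p' z)| <= 2 * pi * len (p - p').
Proof.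
move=> Hp Hp'.
have r0 : 0 <= 2 * pi * len (p - p') by rewrite !mulr_ge0 ?pi_ge0 ?len_ge0.
case: i; last by rewrite /Rintegral /= !strip_integral2// subrr normr0.
rewrite /Rintegral/= !strip_integral1//.
set I := [set v : R | _].
have mI : measurable (I : set (measurableTypeR R)).
  apply: measurableI.
    by rewrite -[X in measurable X]setTI; apply: measurable_fun_ltr.
  rewrite -[X in measurable X]setTI; apply: measurable_fun_ltr => //.
  by apply: measurableT_comp => //; exact: measurable_funB.
have msg (a : R) : measurable_fun setT (fun v : measurableTypeR R => pi * (Num.sg (a - v) - 1)).
  apply: measurable_funM => //; apply: measurable_funB => //.
  apply: (measurableT_comp (f := @Num.sg R)); last exact: measurable_funB.
  apply: nondecreasing_measurable => //; move=> u v uv.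
  have [u0|u0|u0] := ltgtP u 0.
  - rewrite (ltr0_sg u0); have [v0|v0|->] := ltgtP v 0; rewrite ?sgr0 ?lerN10//.
      by rewrite (ltr0_sg v0).
    by rewrite (gtr0_sg v0); lra.
  - by rewrite (gtr0_sg u0) (gtr0_sg (lt_le_trans u0 uv)).
  - by move: uv; rewrite u0 sgr0 le_eqVlt => /predU1P[<-|v0]; rewrite ?sgr0 ?(gtr0_sg v0).
have ii (a : R) : leb.-integrable I (EFin \o (fun v => pi * (Num.sg (a - v) - 1))).
  apply: measurable_bounded_integrable => //.
  - apply: (@le_lt_trans _ _ (leb (ball c 1))); last by rewrite lebesgue_measure_ball ?ltry.
    apply: le_measure; rewrite ?inE//; first exact: measurable_ball.
    by move=> v [_]; rewrite /ball/= distrC.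
  - exact: measurable_funTS.
  - exists (pi * 2); split; first exact: num_real.
    move=> y y2 v _ /=; rewrite (le_trans _ (ltW y2))// normrM (ger0_norm (pi_ge0 R)).
    rewrite ler_wpM2l ?pi_ge0// (le_trans (ler_normB _ _))// normr1.
    by rewrite -[2]/(1 + 1) lerD2r normr_sg; case: (_ != 0).
rewrite -[X in _ <= X]/(2 * pi * len (p - p')).
have -> : fine (\int[leb]_(v in I) (pi * (Num.sg (p.2 - v) - 1))%:E) -
  fine (\int[leb]_(v in I) (pi * (Num.sg (p'.2 - v) - 1))%:E) =
  \int[leb]_(v in I) (pi * (Num.sg (p.2 - v) - 1) - pi * (Num.sg (p'.2 - v) - 1)).
  by rewrite RintegralB.
have iB : leb.-integrable I (EFin \o (fun v =>
    pi * (Num.sg (p.2 - v) - 1) - pi * (Num.sg (p'.2 - v) - 1))).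
  exact: (integrableB mI (ii p.2) (ii p'.2)).
apply: le_trans (le_normr_Rintegral mI iB) _.
pose J := `[Num.min p.2 p'.2, Num.max p.2 p'.2]%classic.
have lJ : (leb J = `|p.2 - p'.2|%:E)%E.
  rewrite lebesgue_measure_itv/= lte_fin; case: (ltgtP p.2 p'.2) => h.
  - by rewrite h -EFinB ltr0_norm ?subr_lt0// opprB.
  - by rewrite h -EFinB gtr0_norm ?subr_gt0.
  - by rewrite h ltxx subrr normr0.
have hJ v : `|pi * (Num.sg (p.2 - v) - 1) - pi * (Num.sg (p'.2 - v) - 1)| <= 2 * pi * \1_J v.
  rewrite -mulrBr normrM (ger0_norm (pi_ge0 R)) mulrAC [leRHS]mulrC ler_wpM2l ?pi_ge0//.
  rewrite opprB addrA subrK indicE.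
  have [vJ|vJ] := boolP (v \in J).
    rewrite mulr1 (le_trans (ler_normB _ _))// -[2]/(1 + 1) lerD// normr_sg; by case: (_ != 0).
  rewrite mulr0 normr_le0 subr_eq0; apply/eqP.
  have : (v < Num.min p.2 p'.2) || (Num.max p.2 p'.2 < v).
    move: vJ; rewrite notin_setE /J/= in_itv/= => /negP; rewrite negb_and -!ltNge; by [].
  rewrite lt_min gt_max => /orP[/andP[h1 h2]|/andP[h1 h2]].
    by rewrite !gtr0_sg ?subr_gt0.
  by rewrite !ltr0_sg ?subr_lt0.
apply: (@le_trans _ _ (2 * pi * `|p.2 - p'.2|)); last first.
  by rewrite ler_wpM2l ?mulr_ge0 ?pi_ge0//; exact: (len_ge2 (p - p')).
rewrite /Rintegral -lee_fin fineK; last first.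
  rewrite ge0_fin_numE; last by apply: integral_ge0 => v _; rewrite lee_fin.
  by case/integrableP : iB.
have mJ : measurable J by exact: measurable_itv.
apply: (@le_trans _ _ (\int[leb]_v (2 * pi * \1_J v)%:E)%E).
  apply: (@le_trans _ _ (\int[leb]_(v in I) (2 * pi * \1_J v)%:E)%E).
    apply: ge0_le_integral => //.
    - apply/measurable_EFinP; apply: measurableT_comp => //; apply: measurable_funTS.
      exact: measurable_funB (msg _) (msg _).
    - by apply/measurable_EFinP; apply: measurable_funTS; apply: measurable_funM => //; exact: measurable_indic.
    - by move=> v _; rewrite lee_fin.
  apply: ge0_subset_integral => //.
    by apply/measurable_EFinP; apply: measurable_funM => //; exact: measurable_indic.
  by move=> v _; rewrite lee_fin !mulr_ge0 ?pi_ge0// indicE.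
under eq_integral do rewrite EFinM.
rewrite ge0_integralZl//; last 2 first.
- exact/measurable_EFinP/measurable_indic.
- by rewrite lee_fin mulr_ge0// pi_ge0.
rewrite integral_indic// setIT.
by rewrite [X in (_ * X)%E]lJ -EFinM.
Qed.

End Shear.

(** * Velocity bounds *)

(** The seven terms are those of [velI_lip]: six majorants and the shear. The constant is 258 = 32 +
    48 + 32 + 128 + 16 + 2, the multiples of [p * n * rr] in the order of the terms, while the fifth
    term, the far field, gives [4 * c]. The third term uses [l * d <= n]. *)
Lemma velI_lip_arith (R : realType) (p c n N' r rr k l d : R) :
  0 <= p -> 0 <= c -> 0 <= n -> 0 <= N' -> 0 <= r -> r <= rr -> 0 <= k -> l * d <= n ->
  4 * n * (4 * p * (2 * rr)) + 4 * n * (4 * p * (3 * rr)) +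
    8 * r * l * (4 * p * d) + 8 * r * n * (16 * p * (1 + k)) +
    4 * r * (N' * c) + 8 * r * n * (2 * p) + n * (2 * p * r)
  <= (258 * p + 4 * c) * (n + N') * (1 + k) * rr.
Proof.
move=> p0 c0 n0 N0' r0 r1 k0 ldn.
have rr0 : 0 <= rr by exact: le_trans r1.
have h1 : 0 <= p * r * (n - l * d) by rewrite !mulr_ge0// subr_ge0.
have h2 : 0 <= p * n * (rr - r) by rewrite !mulr_ge0// subr_ge0.
have h3 : 0 <= p * n * k * (rr - r) by rewrite !mulr_ge0// subr_ge0.
have h4 : 0 <= c * N' * (rr - r) by rewrite !mulr_ge0// subr_ge0.
have h5 : 0 <= p * n * k * rr by rewrite !mulr_ge0.
have h6 : 0 <= c * N' * k * rr by rewrite !mulr_ge0.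
have h7 : 0 <= p * N' * (1 + k) * rr by rewrite !mulr_ge0// addr_ge0.
have h8 : 0 <= c * n * (1 + k) * rr by rewrite !mulr_ge0// addr_ge0.
move: h1 h2 h3 h4 h5 h6 h7 h8; clear; move=> *; lra.
Qed.

Section VelocityBounds.
Context {R : realType}.

Local Notation mu := (@leb2 R).
Local Notation T2 := (measurableTypeR R * measurableTypeR R)%type.
Local Notation H := (@half_plane R).
Implicit Types (x z p : R * R).

Variables (q N m : R) (f : R * R -> R).
Hypotheses (q12 : 1 <= q < 2) (N0 : 0 < N) (m0 : 0 <= m).
Hypothesis mf : measurable_fun (H : set T2) (f : T2 -> R).
Hypothesis fm : forall z, H z -> `|f z| <= m.
Hypothesis fN : (\int[mu]_(z in H) (`|f z| `^ q)%:E <= (N `^ q)%:E)%E.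

Definition velI i x : R := \int[mu]_(y in H) (pr i (BS_kernel x y) * f y).

Lemma velocityE x :
  velocity f x = ((2 * pi)^-1 * velI true x, (2 * pi)^-1 * velI false x).
Proof. by []. Qed.

Definition far_const : R := 1 + 8 * pi / (1 - 2 `^ (2 - conj_exp q)).

Lemma far_const_ge1 : 1 <= far_const.
Proof.
rewrite /far_const lerDl divr_ge0 ?mulr_ge0 ?pi_ge0// subr_ge0.
have s2 := conj_exp_gt2 q12.
by rewrite -[leRHS](@powRr0 _ 2) ler_powR ?ler1n// subr_le0 ltW.
Qed.

Let F z : R := \1_H z * `|f z|.

Let mH : measurable (H : set T2) := measurable_half_plane.

Let mF : measurable_fun setT (F : T2 -> R).
Proof.
rewrite (_ : F = (fun z => `|f z|) \_ H); last first.
  by apply/funext => z; rewrite /F patchE indicE; case: ifPn => _; rewrite ?mul1r ?mul0r.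
have mn : measurable_fun (H : set T2) (fun z : T2 => `|f z|) by exact: measurableT_comp.
exact: (measurable_restrictT _ mH).1 mn.
Qed.

Let F0 z : 0 <= F z. Proof. by rewrite /F mulr_ge0 ?indicE. Qed.

Let FE z : H z -> F z = `|f z|. Proof. by move=> Hz; rewrite /F ind1// mul1r. Qed.

Let FN : (\int[mu]_z (F z `^ q)%:E <= (N `^ q)%:E)%E.
Proof.
apply: le_trans fN; rewrite [leRHS]integral_mkcond le_eqVlt; apply/orP; left; apply/eqP.
have q0 : q != 0 by move: q12; case: eqP => // ->; rewrite ler10.
apply: eq_integral => z _; rewrite patchE /F indicE.
by case: ifPn => _; rewrite ?mul1r// mul0r powR0.
Qed.

Let bfar x := ibound_far x q12 N0 mF F0 FN.

Local Notation L x z := ((len (z - x))^-1).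

Lemma mBS i x : measurable_fun (H : set T2) (fun y : T2 => pr i (BS_kernel x y)).
Proof. by apply: measurable_funTS; exact: measurable_BS. Qed.

Let BSf_dom i x z : H x -> H z -> z <> x -> `|pr i (BS_kernel x z) * f z| <=
  2 * (m * (\1_[set z | len (z - x) < 1] z * L x z) +
       \1_[set z | 1 <= len (z - x)] z * (F z * L x z)).
Proof.
move=> Hx Hz zx; rewrite normrM -(FE Hz).
apply: (le_trans (ler_wpM2r (F0 z) (BS_le i Hx Hz zx))).
rewrite -mulrA ler_wpM2l//.
have l0 : 0 <= L x z by rewrite invr_ge0 len_ge0.
rewrite !indb; have [l1|l1] := ltP (len (z - x)) 1; rewrite /= !mul1r !mul0r.
  by rewrite addr0 mulrC ler_wpM2r// FE// fm.
by rewrite mulr0 add0r mulrC.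
Qed.

Let BSf_ibound x :
  ibound (fun z => 2 * (m * (\1_[set z | len (z - x) < 1] z * L x z) +
       \1_[set z | 1 <= len (z - x)] z * (F z * L x z))) (2 * (m * (4 * pi) + N * far_const)).
Proof.
have b := iboundZ (ler0n R 2) (iboundD (iboundZ m0 (ibound_near x (@ler01 R))) (bfar x)).
by rewrite mulr1 in b.
Qed.

Lemma velI_bound i x : H x ->
  mu.-integrable (H : set T2) (EFin \o (fun y => pr i (BS_kernel x y) * f y)) /\
  `|velI i x| <= 2 * (m * (4 * pi) + N * far_const).
Proof.
move=> Hx; apply: (ibound_Rintegral (x := x) (x' := x) _ _ (BSf_ibound x)) => //.
  by apply: measurable_funM => //; exact: mBS.
by move=> z Hz zx _; exact: BSf_dom.
Qed.

Lemma velI_abs_bound i x : H x ->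
  (\int[mu]_(y in H) `|pr i (BS_kernel x y) * f y|%:E <= (2 * (m * (4 * pi) + N * far_const))%:E)%E.
Proof.
move=> Hx.
have [|z Hz zx _|int le] := ibound_Rintegral (phi := fun y => `|pr i (BS_kernel x y) * f y|)
    (x := x) (x' := x) mH _ (BSf_ibound x).
- by apply: measurableT_comp => //; apply: measurable_funM => //; exact: mBS.
- by rewrite normr_id; exact: BSf_dom.
rewrite -(fineK (integrable_fin_num _ int))// lee_fin.
by rewrite (le_trans (ler_norm _)).
Qed.

Ltac linear := clear - fm fN bfar FE mf m0 mH; move=> *; lra.

(** Below height 1, the disc of radius [x.2] contributes a multiple of [x.2] through [BS_le];
    outside it [BS2_le] provides the factor [x.2], multiplied by the logarithm of the shells up to
    radius 1 and by the far field. Above height 1 the uniform bound is enough. The coefficient is 72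
    = 8 + 64. *)
Lemma velI2_bound x : H x ->
  `|velI false x| <= (72 * pi * m + 4 * N * far_const) * (x.2 * (1 + `|ln x.2|)).
Proof.
move=> Hx; have x20 : 0 < x.2 := Hx.
have c1 := far_const_ge1; have p0 := pi_gt0 R.
have NC : 0 <= N * far_const by rewrite mulr_ge0 ?(ltW N0)// (le_trans ler01).
have pm : 0 <= pi * m by rewrite mulr_ge0 ?pi_ge0.
have [x1|x1] := leP 1 x.2.
  apply: (le_trans (velI_bound false Hx).2).
  apply: (@le_trans _ _ ((72 * pi * m + 4 * N * far_const) * 1)); first by move: NC pm; linear.
  rewrite ler_wpM2l//; first by move: NC pm; linear.
  by rewrite -[leLHS]mulr1 ler_pM// lerDl.
have x01 : 0 < x.2 <= 1 by rewrite x20 ltW.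
have c2 : 0 <= 4 * x.2 by rewrite mulr_ge0// ltW.
have b := iboundD (iboundD (iboundZ (mulr_ge0 (ler0n R 2) m0) (ibound_near x (ltW x20)))
   (iboundZ (mulr_ge0 c2 m0) (ibound_log x x01))) (iboundZ c2 (bfar x)).
have [||_ h] := ibound_Rintegral (x := x) (x' := x) (D := H)
   (phi := fun y => (BS_kernel x y).2 * f y) mH _ b.
- by apply: measurable_funM => //; exact: (mBS false).
- move=> z Hz zx _; rewrite normrM -(FE Hz).
  have l0 : 0 <= L x z by rewrite invr_ge0 len_ge0.
  have Fm : F z <= m by rewrite FE// fm.
  rewrite !indb; have [l1|l1] := ltP (len (z - x)) x.2.
    have l2 : len (z - x) < 1 := lt_trans l1 x1.
    rewrite (leNgt 1) l2/= mul0r mulr0 !addr0 mul1r mul0r mulr0 addr0.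
    apply: (le_trans (ler_wpM2r (F0 z) (BS_le false Hx Hz zx))).
    by rewrite mulrAC ler_wpM2r// ler_wpM2l.
  rewrite mul0r mulr0 add0r.
  apply: (le_trans (ler_wpM2r (F0 z) (BS2_le Hx Hz zx))).
  have [l2|l2] := ltP (len (z - x)) 1; rewrite /= !mul1r !mul0r mulr0 ?addr0 ?add0r.
    by rewrite mulrAC ler_wpM2r ?sqr_ge0// ler_wpM2l.
  rewrite (_ : 4 * x.2 * L x z ^+ 2 * F z = 4 * x.2 * (F z * L x z ^+ 2)); last by ring.
  apply: ler_wpM2l => //; apply: ler_wpM2l => //.
  by rewrite expr2 ler_piMr// invf_le1// (lt_le_trans _ l2).
apply: (le_trans h).
have -> : `|ln x.2| = ln x.2^-1.
  by rewrite lnV ?posrE// ler0_norm// ln_le0// ltW.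
have l0 : 0 <= ln x.2^-1 by rewrite ln_ge0// invf_ge1// ltW.
rewrite [leLHS](_ : _ = x.2 * (8 * (pi * m) + 64 * (pi * m) * (1 + ln x.2^-1) + 4 * (N * far_const))); last by rewrite /far_const; ring.
rewrite [leRHS]mulrCA ler_wpM2l ?(ltW x20)//.
have : 0 <= (pi * m) * ln x.2^-1 by rewrite mulr_ge0.
have : 0 <= (N * far_const) * ln x.2^-1 by rewrite mulr_ge0.
move: NC pm l0; linear.
Qed.

Let Rintegral_strip (g : R * R -> R) c :
  \int[mu]_(z in H) (\1_(strip c) z * g z) = \int[mu]_(z in strip c) g z.
Proof.
rewrite /Rintegral; congr fine; rewrite [LHS]integral_mkcond [RHS]integral_mkcond.
rewrite !restrict_EFin_indic; apply: eq_integral => z _; congr (_%:E).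
have [Sz|Sz] := pselect (strip c z).
  by rewrite !ind1//; [rewrite !mul1r|case: Sz].
by rewrite !(ind0 Sz) !mul0r mulr0.
Qed.

Ltac linear_strip := clear - fm fN bfar FE Rintegral_strip mf m0 mH; move=> *; lra.

Definition vel_const : R := 258 * pi + 4 * far_const.

(* Subtracting the shear with vorticity [f x] on the strip around [x] leaves a
   vorticity which is small near [x]; this replaces the cancellation in the
   singular integral for the velocity gradient. *)
Lemma velI_lip i x x' (e l : R) : 0 < m -> 0 < e -> 0 <= l -> H x -> H x' ->
  (forall z, H z -> `|f z - f x| <= l * Num.sqrt (len (z - x) ^+ 2 + e ^+ 2)) ->
  `|velI i x - velI i x'| <= vel_const * (m + N) * (1 + ln (3 + l / m)) *
     Num.sqrt (len (x - x') ^+ 2 + e ^+ 2).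
Proof.
move=> mp e0 l0 Hx Hx' hl.
set r := len (x - x'); set rr := Num.sqrt _.
have r0 : 0 <= r := len_ge0 _.
have rr_r : r <= rr.
  by rewrite -[leLHS]ger0_norm// -sqrtr_sqr ler_wsqrtr// lerDl sqr_ge0.
have rr_e : e <= rr.
  by rewrite -[leLHS](ger0_norm (ltW e0)) -sqrtr_sqr ler_wsqrtr// lerDr sqr_ge0.
have rr0 : 0 < rr := lt_le_trans e0 rr_e.
(* This radius is less than 1, makes [l * d <= m], so that the innermost disc costs no more than the
   sup bound, and turns [ln d^-1] into the logarithm of the statement. *)
pose d := (3 + l / m)^-1.
have d3 : 3 <= 3 + l / m by rewrite lerDl divr_ge0// ltW.
have d0 : 0 < d by rewrite invr_gt0 (lt_le_trans _ d3).
have d1 : d < 1 by rewrite invf_lt1 (lt_le_trans _ d3)// ltr1n.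
have ld : l * d <= m.
  rewrite ler_pdivrMr; last by rewrite (lt_le_trans _ d3).
  by rewrite mulrDr mulrCA divff ?gt_eqF// mulr1 lerDr mulr_ge0.
have d01 : 0 < d <= 1 by rewrite d0 ltW.
have m4 : 0 <= 4 * m by rewrite mulr_ge0.
have c3 : 0 <= 8 * r * l by rewrite !mulr_ge0.
have c4 : 0 <= 8 * r * m by rewrite !mulr_ge0.
have c5 : 0 <= 4 * r by rewrite !mulr_ge0.
have c6 : 0 <= 8 * r * m by rewrite !mulr_ge0.
have p2 : 0 <= 2 * rr by rewrite mulr_ge0// ltW.
have p3 : 0 <= 3 * rr by rewrite mulr_ge0// ltW.
(* One majorant for each zone: discs around both poles, where the two kernels are bounded
   separately; the disc of radius [d], where the modulus gains a power of the distance; the shells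
   between [d] and 1; the far field of [f]; the far part of the subtracted strip. *)
have b := iboundD (iboundD (iboundD (iboundD (iboundD
  (iboundZ m4 (ibound_near x p2)) (iboundZ m4 (ibound_near x' p3)))
  (iboundZ c3 (ibound_near x (ltW d0)))) (iboundZ c4 (ibound_log x d01)))
  (iboundZ c5 (bfar x))) (iboundZ c6 (ibound_strip x x.2)).
pose D z := pr i (BS_kernel x z) - pr i (BS_kernel x' z).
pose phi z := D z * (f z - f x * \1_(strip x.2) z).
have mS := measurable_strip x.2.
have mD : measurable_fun (H : set T2) (D : T2 -> R) by apply: measurable_funB; exact: mBS.
have [||iphi hphi] := ibound_Rintegral (x := x) (x' := x') (D := H) (phi := phi) mH _ b.
- apply: measurable_funM => //; apply: measurable_funB => //.
  by apply: measurable_funM => //; apply: measurable_funTS; exact: measurable_indic.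
- move=> z Hz zx zx'; rewrite normrM.
  have fz := fm Hz; have fx := fm Hx.
  have L0 : 0 <= L x z by rewrite invr_ge0 len_ge0.
  have L0' : 0 <= L x' z by rewrite invr_ge0 len_ge0.
  have I0 (A : set (R * R)) : 0 <= \1_A z :> R by rewrite indicE.
  have g2m : `|f z - f x * \1_(strip x.2) z| <= 2 * m.
    rewrite (le_trans (ler_normB _ _))// mulr_natl mulr2n lerD//.
    rewrite normrM (ger0_norm (I0 _)) (le_trans _ fx)// ler_piMr//.
  have sw0 : 0 <= strip_weight x.2 x z.
    by rewrite /strip_weight mulr_ge0// invr_ge0 addr_ge0 ?sqr_ge0.
  have t1 : 0 <= 4 * m * (\1_[set z0 | len (z0 - x) < 2 * rr] z * L x z) by rewrite !mulr_ge0.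
  have t2 : 0 <= 4 * m * (\1_[set z0 | len (z0 - x') < 3 * rr] z * L x' z) by rewrite !mulr_ge0.
  have t3 : 0 <= 8 * r * l * (\1_[set z0 | len (z0 - x) < d] z * L x z) by rewrite !mulr_ge0.
  have t4 : 0 <= 8 * r * m * (\1_[set z0 | d <= len (z0 - x) < 1] z * L x z ^+ 2).
    by rewrite mulr_ge0// mulr_ge0// sqr_ge0.
  have t5 : 0 <= 4 * r * (\1_[set z0 | 1 <= len (z0 - x)] z * (F z * L x z)) by rewrite !mulr_ge0.
  have t6 : 0 <= 8 * r * m * strip_weight x.2 x z by rewrite mulr_ge0.
  rewrite -/(strip_weight x.2 x z).
  have tri : len (z - x) <= len (z - x') + r.
    by rewrite (le_trans (dist_triangle x' _ _))// lerD2l /r lenB.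
  have tri' : len (z - x') <= len (z - x) + r by exact: dist_triangle.
  have [lr|lr] := ltP (len (z - x)) (2 * rr).
    have h1 : `|D z| <= 2 * L x z + 2 * L x' z.
      by rewrite (le_trans (ler_normB _ _))// lerD// BS_le.
    apply: (@le_trans _ _ (4 * m * (\1_[set z0 | len (z0 - x) < 2 * rr] z * L x z) +
       4 * m * (\1_[set z0 | len (z0 - x') < 3 * rr] z * L x' z))); last first.
      by move: t3 t4 t5 t6; linear_strip.
    have l3 : len (z - x') < 3 * rr by move: lr tri' rr_r; linear_strip.
    rewrite !indb lr l3 !mul1r.
    apply: (le_trans (ler_pM (normr_ge0 _) (normr_ge0 _) h1 g2m)); linear_strip.
  have lz0 : 0 < len (z - x) by move: lr rr0; linear_strip.
  have lz0' : 0 < len (z - x') by move: lr rr0 tri rr_r; linear_strip.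
  (* Here [r <= rr <= len (z - x) / 2], so [z] is about equally far from [x] and from [x']. *)
  have LL' : L x' z <= 2 * L x z.
    by rewrite -[L x' z]mul1r ler_pdivrMr// mulrAC ler_pdivlMr//; move: lr tri rr_r; linear_strip.
  have h1 : `|D z| <= 4 * r * L x z ^+ 2.
    apply: (le_trans (BSB_le i Hx Hx' Hz zx zx')); rewrite -/r.
    have : 0 <= r * L x z * (2 * L x z - L x' z) by rewrite !mulr_ge0// subr_ge0.
    rewrite expr2; linear_strip.
  have h10 : 0 <= 4 * r * L x z ^+ 2 by rewrite mulr_ge0// sqr_ge0.
  have [ld'|ld'] := ltP (len (z - x)) d.
    have Sz : strip x.2 z by split => //; rewrite (le_lt_trans (len_ge2 (z - x)))// (lt_trans ld').
    apply: (@le_trans _ _ (8 * r * l * (\1_[set z0 | len (z0 - x) < d] z * L x z))); last first.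
      by move: t1 t2 t4 t5 t6; linear_strip.
    rewrite [\1_(strip x.2) z]ind1// mulr1 indb ld' mul1r.
    (* Outside the disc of radius [2 * rr] one has [e <= len (z - x)], so the regularized distance
       is at most twice the true one. *)
    have h2 : `|f z - f x| <= l * (2 * len (z - x)).
      apply: (le_trans (hl _ Hz)); rewrite ler_wpM2l//.
      rewrite -[leRHS]ger0_norm ?mulr_ge0 ?len_ge0// -sqrtr_sqr ler_wsqrtr//.
      have le1 : e <= len (z - x) by move: lr rr_e rr0; linear_strip.
      have : e ^+ 2 <= len (z - x) ^+ 2 by rewrite ler_sqr ?nnegrE ?len_ge0 ?(ltW e0).
      have := sqr_ge0 (len (z - x)); rewrite exprMn; linear_strip.
    apply: (le_trans (ler_pM (normr_ge0 _) (normr_ge0 _) h1 h2)).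
    rewrite [leLHS](_ : _ = 8 * r * l * (L x z * (L x z * len (z - x)))); last by rewrite expr2; ring.
    by rewrite mulVf ?gt_eqF// mulr1.
  have [l1|l1] := ltP (len (z - x)) 1.
    apply: (@le_trans _ _ (8 * r * m * (\1_[set z0 | d <= len (z0 - x) < 1] z * L x z ^+ 2))); last first.
      by move: t1 t2 t3 t5 t6; linear_strip.
    rewrite indb ld' l1 mul1r.
    apply: (le_trans (ler_pM (normr_ge0 _) (normr_ge0 _) h1 g2m)); linear_strip.
  apply: (@le_trans _ _ (4 * r * (\1_[set z0 | 1 <= len (z0 - x)] z * (F z * L x z)) +
     8 * r * m * strip_weight x.2 x z)); last first.
    by move: t1 t2 t3 t4; linear_strip.
  rewrite indb l1 mul1r.
  have L1 : L x z <= 1 by rewrite invf_le1.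
  have h2 : `|f z - f x * \1_(strip x.2) z| <= F z + m * \1_(strip x.2) z.
    rewrite (le_trans (ler_normB _ _))// FE// lerD2l normrM (ger0_norm (I0 _)).
    by rewrite ler_wpM2r.
  apply: (le_trans (ler_pM (normr_ge0 _) (normr_ge0 _) h1 h2)).
  have -> : 4 * r * L x z ^+ 2 * (F z + m * \1_(strip x.2) z) =
     4 * r * F z * L x z * L x z + 4 * r * m * (L x z ^+ 2 * \1_(strip x.2) z).
    by rewrite expr2; ring.
  have h3 : 4 * r * F z * L x z * L x z <= 4 * r * (F z * L x z).
    by rewrite mulrA ler_piMr// !mulr_ge0.
  apply: lerD => //.
  rewrite (_ : 8 * r * m = 4 * r * m * 2); last by ring.
  rewrite -[leRHS]mulrA ler_wpM2l//; first by rewrite !mulr_ge0.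
  have [Sz|Sz] := pselect (strip x.2 z).
    by rewrite ind1// mulr1 invlen2_le_strip.
  by rewrite (ind0 Sz) mulr0 mulr_ge0.
have [ix _] := velI_bound i Hx; have [ix' _] := velI_bound i Hx'.
have iS : mu.-integrable (strip x.2 : set T2) (EFin \o D).
  exact: (integrableB mS (strip_BS_integrable i x.2 Hx) (strip_BS_integrable i x.2 Hx')).
have e1 : velI i x - velI i x' = \int[mu]_(z in H) (D z * f z).
  rewrite /velI -RintegralB//; apply: eq_Rintegral => z _; by rewrite /D mulrBl.
have iDf : mu.-integrable (H : set T2) (EFin \o (fun z => D z * f z)).
  have := integrableB mH ix ix'; apply: eq_integrable => // z _.
  by rewrite /= -EFinB /D mulrBl.
have e2 : velI i x - velI i x' = \int[mu]_(z in H) phi z +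
    f x * (\int[mu]_(z in strip x.2) pr i (BS_kernel x z) -
           \int[mu]_(z in strip x.2) pr i (BS_kernel x' z)).
  rewrite -RintegralB//; last 2 first.
  - exact: strip_BS_integrable.
  - exact: strip_BS_integrable.
  rewrite -RintegralZl// -Rintegral_strip.
  rewrite e1 -[LHS](subrK (\int[mu]_(z in H) phi z)) addrC; congr (_ + _).
  rewrite -RintegralB//; apply: eq_Rintegral => z _.
  by rewrite /phi /D; ring.
rewrite e2.
apply: (le_trans (ler_normD _ _)); rewrite normrM.
have h4 := ler_pM (normr_ge0 _) (normr_ge0 _) (fm Hx) (strip_integral_lip i x.2 Hx Hx').
apply: (le_trans (lerD hphi h4)).
rewrite -/r -/far_const.
have -> : d^-1 = 3 + l / m by rewrite /d invrK.
set LL := ln _.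
have LL0 : 0 <= LL by rewrite /LL ln_ge0// (le_trans _ d3)// ler1n.
have c1 : 0 <= far_const := le_trans ler01 far_const_ge1.
exact: (velI_lip_arith (pi_ge0 R) c1 m0 (ltW N0) r0 rr_r LL0 ld).
Qed.

End VelocityBounds.

(** * Comparison by doubling of variables *)

Section Derivatives.
Context {R : realType}.
Implicit Types (x y z v : R * R).

(** Only earlier arguments are compared, because the maximum in time may sit at the end of the
    interval. *)
Lemma is_derive_left_ge0 (V : normedModType R) (f : V -> R) (x v : V) (D r : R) :
  is_derive x v f D -> 0 < r ->
  (forall h : R, - r < h < 0 -> f (h *: v + x) <= f x) -> 0 <= D.
Proof.
move=> [df <-] r0 hf; rewrite leNgt; apply/negP => D0.
have : \forall h \near (0 : R)^', h^-1 *: ((f \o shift x) (h *: v) - f x) < 0.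
  exact: (cvgr_lt _ df).
move=> /nbhs_ballP[e /= e0 he].
pose h := - (Num.min e r / 2).
have m0 : 0 < Num.min e r by rewrite lt_min e0.
have h0 : h < 0 by rewrite oppr_lt0 divr_gt0.
have /he : ball (0 : R) e h.
  rewrite /ball/= sub0r /h opprK gtr0_norm ?divr_gt0//.
  by rewrite (@lt_le_trans _ _ (Num.min e r))// ?ge_min ?lexx// gtr_pMr// invf_lt1// ltr1n.
have hn : h != 0 by rewrite lt_eqF.
move=> /(_ hn); apply/negP; rewrite -leNgt /GRing.scale/= mulr_le0// ?invr_le0 ?(ltW h0)//.
rewrite subr_le0 hf// h0 andbT ltrN2.
by rewrite (@lt_le_trans _ _ (Num.min e r))// ?ge_min ?lexx ?orbT// gtr_pMr// invf_lt1// ltr1n.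
Qed.

Lemma is_derive_line (V : normedModType R) (f : V -> R) (x v : V) (D : R) :
  is_derive (0 : R) (1 : R) (fun h : R => f (h *: v + x)) D <-> is_derive x v f D.
Proof.
have e : 'D_v f x = 'D_1 (fun h : R => f (h *: v + x)) (0 : R).
  rewrite /derive /=.
  by under [in RHS]eq_fun do rewrite addr0 scale0r add0r /GRing.scale/= mulr1.
split => -[d <-]; apply: DeriveDef.
- exact: (derivable1P f x v).2 d.
- by rewrite e.
- exact: (derivable1P f x v).1 d.
- by rewrite e.
Qed.

Lemma is_derive_max_eq0 (V : normedModType R) (f : V -> R) (x v : V) (D r : R) :
  is_derive x v f D -> 0 < r ->
  (forall h : R, - r < h < r -> f (h *: v + x) <= f x) -> D = 0.
Proof.
move=> df r0 hf; apply/eqP; rewrite eq_le; apply/andP; split; last first.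
  by apply: (is_derive_left_ge0 df r0) => h /andP[h1 h2]; apply: hf; rewrite h1 (lt_trans h2).
rewrite -oppr_ge0.
have df' : is_derive x (- v) f (- D).
  apply/is_derive_line; move/is_derive_line : df => df.
  pose g (h : R) := f (h *: v + x).
  have dg : is_derive (- (0 : R)) (1 : R) g D by rewrite oppr0.
  under eq_fun do rewrite scalerN -scaleNr.
  have := is_derive1_comp dg (is_deriveNid (0 : R) (1 : R)).
  by rewrite /GRing.scale/= mulrN1.
apply: (is_derive_left_ge0 df' r0) => h /andP[h1 h2].
by rewrite scalerN -scaleNr; apply: hf; rewrite ltrN2 (lt_trans h2)//= ltrNl.
Qed.

(** Unlike the distance it is differentiable on the diagonal, so a maximum point with equal
    arguments is no special case, and it is bounded below by [e]. *)
Definition sdist (e : R) x y : R := Num.sqrt (len (x - y) ^+ 2 + e ^+ 2).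

Lemma sdistC e x y : sdist e x y = sdist e y x.
Proof. by rewrite /sdist lenB. Qed.

Lemma sdist_gt0 e x y : 0 < e -> 0 < sdist e x y.
Proof. by move=> e0; rewrite sqrtr_gt0 ltr_wpDl ?sqr_ge0// exprn_gt0. Qed.

Lemma len_le_sdist e x y : len (x - y) <= sdist e x y.
Proof.
by rewrite -[leLHS]ger0_norm ?len_ge0// -sqrtr_sqr ler_wsqrtr// lerDl sqr_ge0.
Qed.

Lemma is_derive_sdist e x y v : 0 < e ->
  is_derive x v (fun x => sdist e x y)
    (((x - y).1 * v.1 + (x - y).2 * v.2) / sdist e x y).
Proof.
move=> e0; apply/is_derive_line.
pose g (h : R) : R := (h * v.1 + (x - y).1) ^+ 2 + (h * v.2 + (x - y).2) ^+ 2 + e ^+ 2.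
have gE h : sdist e (h *: v + x) y = Num.sqrt (g h).
  by rewrite /sdist sqr_len /sqr_length /g /= !addrA.
under eq_fun do rewrite gE.
have g0 : g 0 = len (x - y) ^+ 2 + e ^+ 2.
  by rewrite /g !mul0r !add0r sqr_len.
have gp : 0 < g 0 by rewrite g0 ltr_wpDl ?sqr_ge0// exprn_gt0.
have dg : is_derive (0 : R) (1 : R) g (2 * ((x - y).1 * v.1 + (x - y).2 * v.2)).
  rewrite /g; apply: is_derive_eq; rewrite /GRing.scale/=; ring.
have ds := is_derive1_sqrt gp.
have dc := is_derive1_comp ds dg.
apply: (is_derive_eq dc).
rewrite g0 -/(sdist e x y) /GRing.scale/=.
have := sdist_gt0 x y e0; set s := sdist _ _ _ => s0.
by field; rewrite gt_eqF.
Qed.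

Definition barrier x : R := 1 + x.1 ^+ 2 + x.2 ^+ 2 - ln x.2.

Lemma is_derive_barrier x v : 0 < x.2 ->
  is_derive x v barrier (2 * x.1 * v.1 + 2 * x.2 * v.2 - v.2 / x.2).
Proof.
move=> x0; apply/is_derive_line.
have dl : is_derive (0 : R) (1 : R) (fun h => ln (h * v.2 + x.2)) (v.2 / x.2).
  pose g (h : R) : R := h * v.2 + x.2.
  have g0 : g 0 = x.2 by rewrite /g mul0r add0r.
  have gp : 0 < g 0 by rewrite g0.
  have dg : is_derive (0 : R) (1 : R) g v.2.
    by rewrite /g; apply: is_derive_eq; rewrite /GRing.scale/=; ring.
  apply: is_derive_eq; first exact: (is_derive1_comp (is_derive1_ln gp) dg).
  by rewrite g0 /GRing.scale/= mulrC.
rewrite /barrier /=.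
apply: is_derive_eq; rewrite /GRing.scale/=; ring.
Qed.

Lemma ln_le_sub1 (s : R) : 0 < s -> ln s <= s - 1.
Proof. by move=> s0; have := @le_ln1Dx R (s - 1); rewrite addrCA subrr addr0; apply; lra. Qed.

Lemma barrier_ge1 x : 0 < x.2 -> 1 <= barrier x.
Proof.
move=> x0; have := ln_le_sub1 x0; rewrite /barrier.
have := sqr_ge0 x.1; have := sqr_ge0 (2 * x.2 - 1); clear; move=> *; nra.
Qed.

(** Sublevel sets of the barrier lie in compact boxes of the open half plane; this is why maxima
    exist in [comparison] and why the cutoffs have compact support. *)
Lemma barrier_bounds x (g : R) : 0 < x.2 -> 2 <= g -> barrier x <= g ->
  [/\ - g <= x.1 <= g, x.2 <= g & expR (- g) <= x.2].
Proof.
move=> x0 g2; have := ln_le_sub1 x0; rewrite /barrier => hl hb.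
have s1 := sqr_ge0 x.1; have s2 := sqr_ge0 (2 * x.2 - 1).
split.
- by apply/andP; split; nra.
- by nra.
- rewrite -[leRHS]lnK ?posrE// ler_expR; nra.
Qed.

End Derivatives.

(** * Maximum principle for the doubled and penalized difference *)

Section Comparison.
Context {R : realType}.
Local Notation H := (@half_plane R).
Implicit Types (x y : R * R).

Lemma cvg_within_comp (X Y : topologicalType) (f : X -> Y) (A : set X) (D : set Y) (z : X) :
  {for z, continuous f} -> (forall z', A z' -> D (f z')) ->
  f @ within A (nbhs z) --> within D (nbhs (f z)).
Proof.
move=> cf fAD P; rewrite /within/= => hP.
have : nbhs z (f @^-1` (fun y' : Y => D y' -> P y')) by exact: cf.
by apply: filterS => z' /= h /fAD; exact: h.
Qed.

Lemma continuous_fst1 (X Y : topologicalType) : continuous (@fst X Y).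
Proof. by move=> z; exact: cvg_fst. Qed.

Lemma continuous_snd1 (X Y : topologicalType) : continuous (@snd X Y).
Proof. by move=> z; exact: cvg_snd. Qed.

Lemma continuous_pair_comp (X Y Z : topologicalType) (f : X -> Y) (g : X -> Z) (z : X) :
  {for z, continuous f} -> {for z, continuous g} -> {for z, continuous (fun z => (f z, g z))}.
Proof. by move=> cf cg; apply: cvg_pair. Qed.

Lemma continuous_sdist (e : R) (z : (R * R) * (R * R)) :
  {for z, continuous (fun z : (R * R) * (R * R) => sdist e z.1 z.2)}.
Proof.
pose g (z : (R * R) * (R * R)) : R := (z.1.1 - z.2.1) * (z.1.1 - z.2.1) +
  (z.1.2 - z.2.2) * (z.1.2 - z.2.2) + e ^+ 2.
have -> : (fun z : (R * R) * (R * R) => sdist e z.1 z.2) = Num.sqrt \o g.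
  by apply/funext => z'; rewrite /sdist sqr_len.
apply: continuous_comp; last exact: sqrt_continuous.
have c1 : {for z, continuous (fun z : (R * R) * (R * R) => z.1.1)}.
  by apply: continuous_comp; exact: continuous_fst1.
have c2 : {for z, continuous (fun z : (R * R) * (R * R) => z.1.2)}.
  by apply: continuous_comp; [exact: continuous_fst1|exact: continuous_snd1].
have c3 : {for z, continuous (fun z : (R * R) * (R * R) => z.2.1)}.
  by apply: continuous_comp; [exact: continuous_snd1|exact: continuous_fst1].
have c4 : {for z, continuous (fun z : (R * R) * (R * R) => z.2.2)}.
  by apply: continuous_comp; exact: continuous_snd1.
apply: cvgD; last exact: cvg_cst.
apply: cvgD; apply: cvgM; apply: cvgB => //.
Qed.

Lemma continuous_barrier x : 0 < x.2 -> {for x, continuous barrier}.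
Proof.
move=> x0; apply: cvgB.
  apply: cvgD; last by apply: cvgM; exact: continuous_snd1.
  by apply: cvgD; [exact: cvg_cst|apply: cvgM; exact: continuous_fst1].
apply: continuous_comp; first exact: continuous_snd1.
exact: continuous_ln.
Qed.

Lemma is_derive_penalized (V : normedModType R) (f d G : V -> R) (x v : V)
    (A b0 c0 L T g Df Dd DG : R) :
  is_derive x v f Df -> is_derive x v d Dd -> is_derive x v G DG ->
  is_derive x v (fun z => A * f z - b0 - c0 - L * d z - T * (G z + g))
    (A * Df - L * Dd - T * DG).
Proof.
move=> df dd dG; apply: is_derive_eq.
by rewrite /GRing.scale/= !subr0 !addr0.
Qed.

Lemma is_derive_expR_lin (k t0 t : R) :
  is_derive t (1 : R) (fun s => expR (k * (s - t0))) (k * expR (k * (t - t0))).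
Proof.
pose g (s : R) : R := k * (s - t0).
have dg : is_derive t (1 : R) g k.
  by rewrite /g; apply: is_derive_eq; rewrite /GRing.scale/= subr0 mulr1.
by have := is_derive1_comp (is_derive_expR (g t)) dg; rewrite mulrC.
Qed.

Lemma dot_ge a b (s l k : R) : 0 < s -> len b <= s -> 0 <= l -> l * len a <= k ->
  - k <= l * ((a.1 * b.1 + a.2 * b.2) / s).
Proof.
move=> s0 bs l0 hk.
rewrite lerNl -mulrN -mulNr; apply: le_trans hk; apply: ler_wpM2l => //.
rewrite ler_pdivrMr//; apply: (@le_trans _ _ (len a * len b)); last first.
  by rewrite ler_wpM2l ?len_ge0.
by rewrite (le_trans _ (norm_dot_le a b))// -normrN ler_norm.
Qed.

(** The four gradient conditions are multiplied by the velocity components and added to the time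
    condition; by the two equations all derivatives of the solution cancel. What remains is the
    growth of the distance, paid by [lam * B * s], and that of the barriers, paid by [k]; the
    surplus 1 in [k + 1] contradicts [0 < th * (bx + by_)]. *)
Lemma max_point_contradiction (a b s lam th k B bx by_ Dtx Dty D1x D2x D1y D2y : R) (x y ux uy : R * R) :
  a * D1x - lam * (((x - y).1 * 1 + (x - y).2 * 0) / s) -
    th * (2 * x.1 * 1 + 2 * x.2 * 0 - 0 / x.2) = 0 ->
  a * D2x - lam * (((x - y).1 * 0 + (x - y).2 * 1) / s) -
    th * (2 * x.1 * 0 + 2 * x.2 * 1 - 1 / x.2) = 0 ->
  - b * D1y - lam * (((y - x).1 * 1 + (y - x).2 * 0) / s) -
    th * (2 * y.1 * 1 + 2 * y.2 * 0 - 0 / y.2) = 0 ->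
  - b * D2y - lam * (((y - x).1 * 0 + (y - x).2 * 1) / s) -
    th * (2 * y.1 * 0 + 2 * y.2 * 1 - 1 / y.2) = 0 ->
  0 <= a * Dtx - b * Dty - lam * B * s - th * (k + 1) * (bx + by_) ->
  - (lam * (B * s)) <= lam * (((ux - uy).1 * (x - y).1 + (ux - uy).2 * (x - y).2) / s) ->
  th * - (k * bx) <= th * (ux.1 * (2 * x.1) + ux.2 * (2 * x.2 - x.2^-1)) ->
  th * - (k * by_) <= th * (uy.1 * (2 * y.1) + uy.2 * (2 * y.2 - y.2^-1)) ->
  0 < th * (bx + by_) ->
  Dtx + (ux.1 * D1x + ux.2 * D2x) = 0 -> Dty + (uy.1 * D1y + uy.2 * D2y) = 0 -> False.
Proof.
case: x y ux uy => x1 x2 [y1 y2] [u1 u2] [v1 v2] /=.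
move: (s^-1) (x2^-1) (y2^-1) => r p q X1 X2 Y1 Y2 time dot tux tuy tpos ex ey.
have {}X1 := congr1 ( *%R u1) X1; have {}X2 := congr1 ( *%R u2) X2.
have {}Y1 := congr1 ( *%R v1) Y1; have {}Y2 := congr1 ( *%R v2) Y2.
have {}ex := congr1 ( *%R a) ex; have {}ey := congr1 ( *%R b) ey.
by move: X1 X2 Y1 Y2 time dot tux tuy tpos ex ey; clear; move=> *; lra.
Qed.

Definition e1 : R * R := (1, 0).
Definition e2 : R * R := (0, 1).

Variables (w : R -> R * R -> R) (u : R -> R * R -> R * R).
Hypothesis wc : {within [set tx : R * (R * R) | 0 <= tx.1 /\ H tx.2],
  continuous (fun tx => w tx.1 tx.2)}.
Hypothesis wd : forall (t : R) x, 0 < t -> H x -> exists Dt D1 D2 : R,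
  [/\ is_derive t (1 : R) (fun s => w s x) Dt, is_derive x e1 (w t) D1,
      is_derive x e2 (w t) D2 & Dt + ((u t x).1 * D1 + (u t x).2 * D2) = 0].

Lemma cvg_solution (z : R * (R * R)) : 0 <= z.1 -> H z.2 ->
  (fun tx : R * (R * R) => w tx.1 tx.2) @
     within [set tx : R * (R * R) | 0 <= tx.1 /\ H tx.2] (nbhs z) --> w z.1 z.2.
Proof. by move=> z1 z2; have /subspace_continuousP h := wc; exact: h. Qed.

(** The weights allow two uses: [b = l = 0] gives the maximum principle for [a * w], and
    [a = b = 1], [c = 0] the propagation of a modulus. The factor [l] on both sides of the Lipschitz
    hypothesis lets the first use precede any Lipschitz bound for the velocity. *)
Lemma comparison (a b c l B kappa M e t0 t1 : R) :
  0 <= t0 -> 0 < e -> 0 <= l -> 0 <= kappa ->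
  (forall t x, t0 <= t <= t1 -> H x -> `|w t x| <= M) ->
  (forall t x, t0 < t <= t1 -> H x ->
     `|(u t x).1 * (2 * x.1) + (u t x).2 * (2 * x.2 - x.2^-1)| <= kappa * barrier x) ->
  (forall t x y, t0 < t <= t1 -> H x -> H y ->
     l * len (u t x - u t y) <= l * (B * sdist e x y)) ->
  (forall x y, H x -> H y -> a * w t0 x - b * w t0 y - c <= l * sdist e x y) ->
  forall t x y, t0 <= t <= t1 -> H x -> H y ->
    a * w t x - b * w t y - c <= l * expR (B * (t - t0)) * sdist e x y.
Proof.
move=> t00 e0 l0 k0 wM uG uL w0 t2 p p' /andP[t02 t21] Hp Hp'.
rewrite leNgt; apply/negP => gap.
(* One more than the growth rate of the barrier along the velocity: the surplus gives the strict
   inequality at the end. *)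
pose k := kappa + 1.
pose E t := expR (k * (t - t0)).
have Gp0 : 0 < barrier p + barrier p'.
  by rewrite addr_gt0// (lt_le_trans ltr01)// barrier_ge1.
pose delta := a * w t2 p - b * w t2 p' - c - l * expR (B * (t2 - t0)) * sdist e p p'.
have d0 : 0 < delta by rewrite subr_gt0.
(* With this choice the penalty at [(t2, (p, p'))] is exactly half of the gap, and [Phi] stays
   positive there. *)
pose eta := delta / (2 * E t2 * (barrier p + barrier p')).
have E0 t : 0 < E t by exact: expR_gt0.
have eta0 : 0 < eta by rewrite divr_gt0// !mulr_gt0.
pose Phi (z : R * ((R * R) * (R * R))) : R :=
  a * w z.1 z.2.1 - b * w z.1 z.2.2 - c - l * expR (B * (z.1 - t0)) * sdist e z.2.1 z.2.2
  - eta * E z.1 * (barrier z.2.1 + barrier z.2.2).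
have Phi2 : 0 < Phi (t2, (p, p')).
  rewrite /Phi/= -/delta subr_gt0 /eta.
  rewrite (_ : _ * _ = delta / 2); last by field; rewrite !gt_eqF.
  by rewrite ltr_pdivrMr// ltr_pMr// ltr1n.
pose S := (`|a| + `|b|) * M + `|c|.
have M0 : 0 <= M by apply: le_trans (wM t2 p _ Hp); rewrite ?normr_ge0 ?t02.
(* Where [Phi] is positive both barriers are at most [S / eta]; the lower bound 2 is the one
   required by [barrier_bounds]. *)
pose g := Num.max 2 (S / eta).
have g2 : 2 <= g by rewrite le_max lexx.
have PhiG t x y : t0 <= t <= t1 -> H x -> H y -> 0 < Phi (t, (x, y)) ->
    barrier x <= g /\ barrier y <= g.
  move=> tt Hx Hy; rewrite /Phi/= subr_gt0 => hP.
  have ax : a * w t x <= `|a| * M.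
    by rewrite (le_trans (ler_norm _))// normrM ler_wpM2l// wM.
  have bx : - (b * w t y) <= `|b| * M.
    by rewrite (le_trans (ler_norm _))// normrN normrM ler_wpM2l// wM.
  have cx : - c <= `|c| by rewrite lerNl lerNnormlW.
  have s0 : 0 <= l * expR (B * (t - t0)) * sdist e x y.
    by rewrite !mulr_ge0 ?expR_ge0// ltW// sdist_gt0.
  have E1 : 1 <= E t.
    have kp : 0 <= k by rewrite addr_ge0.
    have tt0 : 0 <= t - t0 by rewrite subr_ge0; case/andP: tt.
    by rewrite /E -[X in X <= _]expR0 ler_expR mulr_ge0.
  have Gx := barrier_ge1 Hx; have Gy := barrier_ge1 Hy.
  have h : eta * (barrier x + barrier y) <= S.
    apply: (@le_trans _ _ (eta * E t * (barrier x + barrier y))).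
      apply: ler_wpM2r; first by rewrite addr_ge0// (le_trans ler01).
      by rewrite ler_peMr// ltW.
    by move: hP ax bx cx s0; rewrite /S; clear; move=> *; lra.
  have hx : barrier x + barrier y <= S / eta by rewrite ler_pdivlMr// mulrC.
  split; rewrite /g le_max; apply/orP; right; move: hx Gx Gy; clear; move=> *; lra.
(* The boxes use [g + 1] instead of [g], so the maximum point stays away from their sides by at
   least the [rad] defined below and the first-order conditions hold in both coordinate
   directions. *)
pose I1 : set R := `[- (g + 1), g + 1]%classic.
pose I2 : set R := `[expR (- (g + 1)), g + 1]%classic.
pose Q : set (R * ((R * R) * (R * R))) := `[t0, t1]%classic `*` ((I1 `*` I2) `*` (I1 `*` I2)).
have cQ : compact Q.
  by apply: compact_setX; [exact: segment_compact|apply: compact_setX; apply: compact_setX; exact: segment_compact].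
have I2H x : (I1 `*` I2) x -> H x.
  move=> [_]; rewrite /I2/= in_itv/= => /andP[h _].
  by rewrite /half_plane/=; apply: lt_le_trans h; exact: expR_gt0.
have box x : H x -> barrier x <= g -> [/\ - g <= x.1 <= g, x.2 <= g, expR (- g) <= x.2 & (I1 `*` I2) x].
  move=> Hx hx; have [h1 h2 h3] := barrier_bounds Hx g2 hx.
  split => //; split; rewrite /I1 /I2/= in_itv/=.
    case/andP: h1 => h1 h1'; apply/andP; split; last by rewrite (le_trans h1')// lerDl.
    by rewrite (le_trans _ h1)// lerN2 lerDl.
  apply/andP; split; last by rewrite (le_trans h2)// lerDl.
  by rewrite (le_trans _ h3)// ler_expR lerN2 lerDl.
have Q2 : Q (t2, (p, p')).
  have tt2 : t0 <= t2 <= t1 by rewrite t02.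
  have [b1 b2] := PhiG _ _ _ tt2 Hp Hp' Phi2.
  have [_ _ _ B1] := box _ Hp b1; have [_ _ _ B2] := box _ Hp' b2.
  by split => //=; rewrite in_itv.
have cPhi : {within Q, continuous Phi}.
  apply/subspace_continuousP => z Qz.
  have [Qt [Qx Qy]] := Qz.
  have Hx := I2H _ Qx; have Hy := I2H _ Qy.
  have WD (f : R * ((R * R) * (R * R)) -> R * (R * R)) : {for z, continuous f} ->
     (forall z', Q z' -> 0 <= (f z').1 /\ H (f z').2) ->
     (fun z => w (f z).1 (f z).2) @ within Q (nbhs z) --> w (f z).1 (f z).2.
    move=> cf fQ; have [f1 f2] := fQ z Qz.
    exact: (cvg_comp _ _ (cvg_within_comp cf fQ) (cvg_solution f1 f2)).
  have Qpos z' : Q z' -> [/\ 0 <= z'.1, H z'.2.1 & H z'.2.2].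
    move=> [q1 [q2 q3]]; split; [|exact: I2H|exact: I2H].
    by move: q1; rewrite /= in_itv/= => /andP[q1 _]; exact: le_trans q1.
  have cz1 : {for z, continuous (@fst R ((R * R) * (R * R)))} by exact: continuous_fst1.
  have cz21 : {for z, continuous (fun z : R * ((R * R) * (R * R)) => z.2.1)}.
    by apply: continuous_comp; [exact: continuous_snd1|exact: continuous_fst1].
  have cz22 : {for z, continuous (fun z : R * ((R * R) * (R * R)) => z.2.2)}.
    by apply: continuous_comp; exact: continuous_snd1.
  have cexp (k' : R) : {for z, continuous (fun z : R * ((R * R) * (R * R)) => expR (k' * (z.1 - t0)))}.
    apply: continuous_comp; last exact: continuous_expR.
    by apply: cvgM; [exact: cvg_cst|apply: cvgB; [exact: cz1|exact: cvg_cst]].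
  have cw1 := WD (fun z => (z.1, z.2.1)) (continuous_pair_comp cz1 cz21)
    (fun z' Qz' => let: And3 h1 h2 h3 := Qpos z' Qz' in conj h1 h2).
  have cw2 := WD (fun z => (z.1, z.2.2)) (continuous_pair_comp cz1 cz22)
    (fun z' Qz' => let: And3 h1 h2 h3 := Qpos z' Qz' in conj h1 h3).
  apply: cvgB; last first.
    apply: (@cvg_within_filter _ _ _ (nbhs z)).
    apply: cvgM; first by apply: cvgM; [exact: cvg_cst|exact: cexp].
    apply: cvgD.
      by apply: (continuous_comp cz21); exact: continuous_barrier.
    by apply: (continuous_comp cz22); exact: continuous_barrier.
  apply: cvgB; last first.
    apply: (@cvg_within_filter _ _ _ (nbhs z)).
    apply: cvgM; first by apply: cvgM; [exact: cvg_cst|exact: cexp].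
    apply: (@continuous_comp _ _ _ snd (fun z => sdist e z.1 z.2)).
      exact: continuous_snd1.
    exact: continuous_sdist.
  apply: cvgB; last exact: cvg_cst.
  by apply: cvgB; apply: cvgM => //; exact: cvg_cst.
have [ts [xs [ys [Qs maxs]]]] : exists (ts : R) (xs ys : R * R), Q (ts, (xs, ys)) /\
    forall z, Q z -> Phi z <= Phi (ts, (xs, ys)).
  have [[ts [xs ys]] /set_mem Qs maxs] := compact_EVT_max (ex_intro _ _ Q2) cQ cPhi.
  by exists ts, xs, ys; split => // z Qz; exact/maxs/mem_set.
have Phis : 0 < Phi (ts, (xs, ys)) by apply: lt_le_trans Phi2 _; exact: maxs.
have [/= + [Qx Qy]] := Qs; rewrite in_itv/= => /andP[t0s ts1].
have Hx := I2H _ Qx; have Hy := I2H _ Qy.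
have tts : t0 <= ts <= t1 by rewrite t0s.
(* At time [t0] the initial hypothesis makes [Phi] nonpositive. *)
have t0ts : t0 < ts.
  rewrite lt_neqAle t0s andbT; apply/eqP => t0E.
  move: Phis; rewrite /Phi/= -t0E subrr mulr0 expR0 mulr1.
  have := w0 _ _ Hx Hy.
  have : 0 <= eta * E t0 * (barrier xs + barrier ys).
    apply: mulr_ge0; first by apply: mulr_ge0; exact: ltW.
    by apply: addr_ge0; apply: (le_trans ler01); exact: barrier_ge1.
  by clear; move=> *; lra.
have tsp : 0 < ts := le_lt_trans t00 t0ts.
have [Gx Gy] := PhiG _ _ _ tts Hx Hy Phis.
have [bx1 bx2 bx3 _] := box _ Hx Gx; have [by1 by2 by3 _] := box _ Hy Gy.
have [Dtx [D1x [D2x [dtx d1x d2x eqx]]]] := wd tsp Hx.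
have [Dty [D1y [D2y [dty d1y d2y eqy]]]] := wd tsp Hy.
pose lam := l * expR (B * (ts - t0)).
pose th := eta * E ts.
pose s := sdist e xs ys.
have s0 : 0 < s by exact: sdist_gt0.
have lam0 : 0 <= lam by rewrite mulr_ge0 ?expR_ge0.
have th0 : 0 < th by rewrite mulr_gt0.
pose rad := Num.min 1 (expR (- g) - expR (- (g + 1))).
have rad0 : 0 < rad.
  by rewrite lt_min ltr01 subr_gt0 ltr_expR ltrN2 ltrDl ltr01.
have hbox (x v : R * R) h : H x -> barrier x <= g -> `|v.1| <= 1 -> `|v.2| <= 1 ->
    - rad < h < rad -> (I1 `*` I2) (h *: v + x).
  move=> Hx' Gx' v1 v2 /andP[h1 h2].
  have [/andP[c1 c1'] c2 c3 _] := box _ Hx' Gx'.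
  have hr : `|h| < rad by rewrite ltr_norml h1.
  have r1 : rad <= 1 by rewrite ge_min lexx.
  have r2 : rad <= expR (- g) - expR (- (g + 1)) by rewrite ge_min lexx orbT.
  have q1 : `|h * v.1| <= rad by rewrite normrM (le_trans _ (ltW hr))// ler_piMr.
  have q2 : `|h * v.2| <= rad by rewrite normrM (le_trans _ (ltW hr))// ler_piMr.
  move: q1 q2; rewrite !ler_norml => /andP[q1 q1'] /andP[q2 q2'].
  split; rewrite /I1 /I2/= in_itv/= /GRing.scale/=; apply/andP; split.
  - by move: c1 q1 r1; clear -wc wd; move=> *; lra.
  - by move: c1' q1' r1; clear -wc wd; move=> *; lra.
  - by move: c3 q2 r2; clear -wc wd; move=> *; lra.
  - by move: c2 q2' r1; clear -wc wd; move=> *; lra.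
have maxx v h : `|v.1| <= 1 -> `|v.2| <= 1 -> - rad < h < rad ->
    Phi (ts, (h *: v + xs, ys)) <= Phi (ts, (xs, ys)).
  move=> v1 v2 hh; apply: maxs; split; first exact: Qs.1.
  by split; [exact: hbox|exact: Qy].
have maxy v h : `|v.1| <= 1 -> `|v.2| <= 1 -> - rad < h < rad ->
    Phi (ts, (xs, h *: v + ys)) <= Phi (ts, (xs, ys)).
  move=> v1 v2 hh; apply: maxs; split; first exact: Qs.1.
  by split; [exact: Qx|exact: hbox].
have gradx v D : `|v.1| <= 1 -> `|v.2| <= 1 -> is_derive xs v (w ts) D ->
    a * D - lam * (((xs - ys).1 * v.1 + (xs - ys).2 * v.2) / s) -
    th * (2 * xs.1 * v.1 + 2 * xs.2 * v.2 - v.2 / xs.2) = 0.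
  move=> v1 v2 dD.
  have dP := @is_derive_penalized _ _ _ _ _ _ a (b * w ts ys) c lam th (barrier ys)
    _ _ _ dD (is_derive_sdist xs ys v e0) (is_derive_barrier v Hx).
  by apply: (is_derive_max_eq0 dP rad0) => h hh; exact: maxx.
have grady v D : `|v.1| <= 1 -> `|v.2| <= 1 -> is_derive ys v (w ts) D ->
    (- b) * D - lam * (((ys - xs).1 * v.1 + (ys - xs).2 * v.2) / s) -
    th * (2 * ys.1 * v.1 + 2 * ys.2 * v.2 - v.2 / ys.2) = 0.
  move=> v1 v2 dD.
  have dP := @is_derive_penalized _ _ _ _ _ _ (- b) (- (a * w ts xs)) c lam th (barrier xs)
    _ _ _ dD (is_derive_sdist ys xs v e0) (is_derive_barrier v Hy).
  rewrite /s sdistC; apply: (is_derive_max_eq0 dP rad0) => h hh.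
  have := maxy _ _ v1 v2 hh; rewrite /Phi/= -/lam -/th.
  rewrite (sdistC _ xs (_ + _)) (sdistC _ xs ys) mulNr opprK mulNr.
  by rewrite ![- (b * _) + _]addrC ![barrier xs + _]addrC.
have one1 : `|1 : R| <= 1 by rewrite normr1.
have one0 : `|0 : R| <= 1 by rewrite normr0.
have X1 := gradx e1 D1x one1 one0 d1x.
have X2 := gradx e2 D2x one0 one1 d2x.
have Y1 := grady e1 D1y one1 one0 d1y.
have Y2 := grady e2 D2y one0 one1 d2y.
have time : 0 <= a * Dtx - b * Dty - lam * B * s - th * k * (barrier xs + barrier ys).
  have dt : is_derive ts (1 : R) (fun t => Phi (t, (xs, ys)))
      (a * Dtx - b * Dty - lam * B * s - th * k * (barrier xs + barrier ys)).
    have de1 := is_derive_expR_lin B t0 ts.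
    have de2 := is_derive_expR_lin k t0 ts.
    rewrite /Phi /E /=; apply: is_derive_eq.
    by rewrite /GRing.scale/= /lam /th /E /s; ring.
  have ts0 : 0 < ts - t0 by rewrite subr_gt0.
  apply: (is_derive_left_ge0 dt ts0) => h /andP[h1 h2].
  apply: maxs; split; last exact: Qs.2.
  rewrite /= in_itv/= [h%:A]mulr1.
  apply/andP; split; first by move: h1; clear -wc wd; move=> *; lra.
  by move: h2 ts1; clear -wc wd; move=> *; lra.
have lip : lam * len (u ts xs - u ts ys) <= lam * (B * s).
  rewrite /lam mulrAC [leRHS]mulrAC ler_wpM2r ?expR_ge0//.
  by apply: uL; rewrite ?t0ts.
have ttx : t0 < ts <= t1 by rewrite t0ts.
have dot := dot_ge s0 (len_le_sdist e xs ys) lam0 lip.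
have ux := uG _ _ ttx Hx; have uy := uG _ _ ttx Hy.
have Bx := barrier_ge1 Hx; have By := barrier_ge1 Hy.
move: ux uy; rewrite !ler_norml => /andP[ux _] /andP[uy _].
have tux := ler_wpM2l (ltW th0) ux.
have tuy := ler_wpM2l (ltW th0) uy.
have tpos : 0 < th * (barrier xs + barrier ys) by rewrite mulr_gt0// addr_gt0// (lt_le_trans ltr01).
move: X1 X2 Y1 Y2 time dot tux tuy tpos eqx eqy; rewrite /e1 /e2 /k [(_, _).1]/= [(_, _).2]/=.
clearbody s lam th; clear -wc wd.
by apply: max_point_contradiction.
Qed.
End Comparison.

(** * Norms and gradients *)

Section Norms.
Context {R : realType}.
Local Notation H := (@half_plane R).
Local Notation mu := (@leb2 R).
Local Notation T2 := (measurableTypeR R * measurableTypeR R)%type.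
Implicit Types (x y z v : R * R) (f : R * R -> R).

Lemma leb2_ball_gt0 x (r : R) : 0 < r -> (0 < mu (ball x.1 r `*` ball x.2 r : set T2))%E.
Proof.
move=> r0.
have -> : mu (ball x.1 r `*` ball x.2 r : set T2) =
    (@lebesgue_measure R (ball x.1 r) * @lebesgue_measure R (ball x.2 r))%E.
  by apply: product_measure1E; exact: measurable_ball.
rewrite !lebesgue_measure_ball ?(ltW r0)//.
by rewrite -EFinM lte_fin mulr_gt0// pmulrn_lgt0.
Qed.

Lemma leb2_setT_gt0 : (0 < mu setT)%E.
Proof.
apply: (lt_le_trans (@leb2_ball_gt0 0 1 ltr01)).
apply: le_measure => //; rewrite inE//.
by apply: measurableX; exact: measurable_ball.
Qed.

(** If [|f|] exceeds the essential supremum at one point of the half plane, it does so on a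
    neighbourhood, which has positive measure. *)
Lemma le_normLp_oo f x : {for x, continuous f} -> H x -> (`|f x|%:E <= normLp +oo f)%E.
Proof.
move=> fx Hx; rewrite leNgt; apply/negP => lt.
have := lt; rewrite /normLp unlock leb2_setT_gt0 => lt'.
set c := ess_sup _ _ in lt'.
have [cl|cl] : (c < 0 \/ 0 <= c)%E by case: (ltP c 0%E); [left|right].
  have : (0 <= c)%E.
    by apply: ess_sup_gee; [exact: leb2_setT_gt0|apply: aeW => y /=; rewrite lee_fin].
  by rewrite leNgt cl.
have cfin : c \is a fin_num.
  by rewrite ge0_fin_numE// (lt_trans lt')// ltry.
have := @ess_sup_ge _ _ _ mu (abse \o (EFin \o (f \_ H))).
rewrite -/c => -[A [mA A0 subA]].
have : \forall y \near x, fine c < `|f y| /\ H y.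
  apply: filterI; last by apply: open_nbhs_nbhs; split => //; exact: half_plane_open.
  have : `|f x| > fine c by rewrite -lte_fin fineK.
  have cn : {for x, continuous (fun y => `|f y|)}.
    by apply: continuous_comp => //; exact: norm_continuous.
  by move=> lx; apply: (cvgr_gt _ cn).
move=> /nbhs_ballP[r /= r0 sub].
have : (mu (ball x.1 r `*` ball x.2 r : set T2) <= mu A)%E.
  apply: le_measure; rewrite ?inE//.
    by apply: measurableX; exact: measurable_ball.
  move=> y [y1 y2]; apply: subA => /=.
  have [h1 h2] : fine c < `|f y| /\ H y by apply: sub; split.
  by rewrite patchE mem_set//= -(fineK cfin) lee_fin leNgt h1.
by rewrite A0 leNgt leb2_ball_gt0.
Qed.

Lemma normLp_oo_le f (c : R) : 0 <= c -> (forall x, H x -> `|f x| <= c) ->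
  (normLp +oo f <= c%:E)%E.
Proof.
move=> c0 fc; rewrite /normLp unlock leb2_setT_gt0; apply/ess_supP/aeW => y /=.
rewrite patchE; case: ifPn => [/set_mem /fc|_]; first by rewrite lee_fin.
by rewrite normr0 lee_fin.
Qed.

Lemma normLp_ge0 p f : (0 <= normLp p f)%E.
Proof. exact: Lnorm_ge0. Qed.

Lemma normLp_powE f (q : R) :
  normLp q%:E f = ((\int[mu]_(x in H) (`|f x| `^ q)%:E) `^ q^-1)%E \/ q = 0.
Proof.
have [->|q0] := eqVneq q 0; [by right|left].
rewrite /normLp unlock [in RHS]integral_mkcond; congr (_ `^ _)%E.
apply: eq_integral => x _ /=; rewrite !patchE; case: ifPn => //= _.
by rewrite normr0 powR0.
Qed.

Lemma integral_pow_normLp f (q N : R) : 0 < q -> 0 <= N ->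
  (\int[mu]_(x in H) (`|f x| `^ q)%:E <= (N `^ q)%:E)%E <-> (normLp q%:E f <= N%:E)%E.
Proof.
move=> q0 N0; have [->|] := normLp_powE f q; last by move=> qE; rewrite qE ltxx in q0.
set I := (\int[_]_(_ in _) _)%E.
have I0 : (0 <= I)%E by apply: integral_ge0 => x _; rewrite lee_fin powR_ge0.
have itv (y : \bar R) : (0 <= y)%E -> y \in `[0%E, +oo%E] by move=> y0; rewrite in_itv/= y0 leey.
split=> h.
  have := @gt0_ler_poweR _ q^-1 _ _ _ (itv _ I0) (itv (N `^ q)%:E _) h.
  rewrite poweR_EFin -powRrM mulfV ?gt_eqF// powRr1//; apply; last by rewrite lee_fin powR_ge0.
  by rewrite invr_ge0 ltW.
have := @gt0_ler_poweR _ q (ltW q0) _ _ (itv _ (poweR_ge0 I q^-1)) (itv N%:E _) h.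
by rewrite -poweRrM mulVf ?gt_eqF// poweRe1// poweR_EFin; apply; rewrite lee_fin.
Qed.

End Norms.

Section Gradient.
Context {R : realType}.
Local Notation H := (@half_plane R).
Implicit Types (x y z v : R * R) (f : R * R -> R).

Lemma class_C1_is_derive (V : normedModType R) (A : set V) (F : V -> R) (x v : V) :
  class_C 1 A F -> A x -> is_derive x v F ('D_v F x).
Proof. by move=> [_ /(_ v)[h _]] Ax; apply: DeriveDef => //; exact: h. Qed.

Lemma class_C1_continuous (V : normedModType R) (A : set V) (F : V -> R) (x v : V) :
  class_C 1 A F -> A x -> {for x, continuous ('D_v F)}.
Proof. by move=> [_ /(_ v)[_ [h _]]] Ax; exact: h. Qed.

Lemma is_derive_along (V : normedModType R) (f : V -> R) (p w : V) (s D : R) :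
  is_derive (s *: w + p) w f D -> is_derive s (1 : R) (fun s : R => f (s *: w + p)) D.
Proof.
move=> /is_derive_line h; apply/is_derive_line; move: h.
by under eq_fun do rewrite addrA -scalerDl -[X in X + s]mulr1.
Qed.

Lemma mean_value (V : normedModType R) (f : V -> R) (D : V -> R) (p e : V) (a : R) :
  (forall s : R, 0 <= s <= 1 ->
     is_derive ((s * a) *: e + p) e f (D ((s * a) *: e + p))) ->
  exists2 s, 0 <= s <= 1 & f (a *: e + p) - f p = a * D ((s * a) *: e + p).
Proof.
move=> fD; pose g (s : R) := f ((s * a) *: e + p).
have gD (s : R) : 0 <= s <= 1 -> is_derive s (1 : R) g (a * D ((s * a) *: e + p)).
  move=> /fD /is_derive_along h.
  have da : is_derive s (1 : R) (fun s : R => s * a) a.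
    by apply: is_derive_eq; rewrite /GRing.scale/= mulr0 add0r mulr1.
  by have := @is_derive1_comp _ _ (fun s : R => s * a) _ _ _ h da; rewrite mulrC.
have dg (s : R) : s \in `]0, 1[ -> is_derive s (1 : R) g (a * D ((s * a) *: e + p)).
  by move=> /subset_itv_oo_cc; rewrite in_itv/= => /gD.
have cg : {within `[(0 : R), 1], continuous g}.
  apply: derivable_within_continuous => s; rewrite in_itv/= => /gD h.
  exact: ex_derive.
have [c c01 gc] := MVT ltr01 dg cg.
exists c; first by move/subset_itv_oo_cc: c01; rewrite in_itv.
by move: gc; rewrite /g mul1r mul0r scale0r add0r subr0 mulr1.
Qed.

(* The directional derivative is linear: apply the mean value theorem along the
   coordinate path from [x] to [x + h *: v]. *)
Lemma is_derive_partials f D1 D2 x v : H x ->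
  (forall z, H z -> is_derive z (e1 : R * R) f (D1 z)) ->
  (forall z, H z -> is_derive z (e2 : R * R) f (D2 z)) ->
  {for x, continuous D1} -> {for x, continuous D2} ->
  is_derive x v f (v.1 * D1 x + v.2 * D2 x).
Proof.
move=> Hx d1 d2 c1 c2.
suff cv : h^-1 *: (f (h *: v + x) - f x) @[h --> 0^'] --> v.1 * D1 x + v.2 * D2 x.
  by apply: DeriveDef; [apply/cvg_ex; exists (v.1 * D1 x + v.2 * D2 x)|exact: cvg_lim].
apply/cvgrPdist_le => /= eps eps0.
pose K := 1 + `|v.1| + `|v.2|.
have K0 : 0 < K by rewrite /K -addrA ltr_pwDl// addr_ge0.
have k0 : 0 < eps / K by rewrite divr_gt0.
have : \forall z \near x, [/\ `|D1 x - D1 z| <= eps / K, `|D2 x - D2 z| <= eps / K & H z].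
  near=> z; split.
  - by near: z; move/cvgrPdist_le : c1 => /(_ _ k0).
  - by near: z; move/cvgrPdist_le : c2 => /(_ _ k0).
  - by near: z; apply: open_nbhs_nbhs; split => //; exact: half_plane_open.
move=> /nbhs_ballP[r /= r0 sub].
have box a b : `|a| < r -> `|b| < r -> ball x r (a + x.1, b + x.2).
  by move=> ar br; split; rewrite /ball/= opprD addrCA subrr addr0 normrN.
near=> h.
have h0 : h != 0 by near: h; exact: nbhs_dnbhs_neq.
have hK : `|h| * K < r.
  rewrite -ltr_pdivlMr//; near: h; apply: dnbhs0_lt; by rewrite divr_gt0.
have hv1 : `|h * v.1| < r.
  rewrite (le_lt_trans _ hK)// normrM ler_wpM2l// /K.
  by have := normr_ge0 v.2; clear; move=> *; lra.
have hv2 : `|h * v.2| < r.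
  rewrite (le_lt_trans _ hK)// normrM ler_wpM2l// /K.
  by have := normr_ge0 v.1; clear; move=> *; lra.
have seg (a s : R) : `|a| < r -> 0 <= s <= 1 -> `|s * a| < r.
  by move=> ar /andP[s0 s1]; rewrite (le_lt_trans _ ar)// normrM ger0_norm// ler_piMl.
have E1 (s : R) : s *: (e1 : R * R) + x = (s + x.1, x.2).
  by rewrite [LHS]surjective_pairing /e1 /GRing.scale/= /GRing.scale/= mulr1 mulr0 add0r.
have E2 (s b : R) : s *: (e2 : R * R) + (b + x.1, x.2) = (b + x.1, s + x.2).
  by rewrite [LHS]surjective_pairing /e2 /GRing.scale/= /GRing.scale/= mulr1 mulr0 add0r.
have x0 a : `|a| < r -> ball x r (a + x.1, x.2).
  by move=> ar; rewrite -[X in (_, X)]add0r; apply: box; rewrite ?normr0.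
have [s1 s1p m1] : exists2 s, 0 <= s <= 1 &
    f ((h * v.1) *: (e1 : R * R) + x) - f x = h * v.1 * D1 ((s * (h * v.1)) *: (e1 : R * R) + x).
  apply: mean_value => s s01; apply: d1; rewrite E1.
  by have [_ _] := sub _ (x0 _ (seg _ _ hv1 s01)).
have [s2 s2p m2] : exists2 s, 0 <= s <= 1 &
    f ((h * v.2) *: (e2 : R * R) + (h * v.1 + x.1, x.2)) - f (h * v.1 + x.1, x.2) =
    h * v.2 * D2 ((s * (h * v.2)) *: (e2 : R * R) + (h * v.1 + x.1, x.2)).
  apply: mean_value => s s01; apply: d2; rewrite E2.
  by have [_ _] := sub _ (box _ _ hv1 (seg _ _ hv2 s01)).
have hvx : h *: v + x = (h * v.1 + x.1, h * v.2 + x.2) by case: (v) (x) => ? ? [].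
rewrite hvx; rewrite !E1// in m1; rewrite !E2// in m2.
have -> : f (h * v.1 + x.1, h * v.2 + x.2) - f x =
    h * v.2 * D2 (h * v.1 + x.1, s2 * (h * v.2) + x.2) +
    h * v.1 * D1 (s1 * (h * v.1) + x.1, x.2).
  by rewrite -m1 -m2; ring.
have [B1 _ _] := sub _ (x0 _ (seg _ _ hv1 s1p)).
have [_ B2 _] := sub _ (box _ _ hv1 (seg _ _ hv2 s2p)).
rewrite /GRing.scale/= [_ - _](_ : _ =
   v.1 * (D1 x - D1 (s1 * (h * v.1) + x.1, x.2)) +
   v.2 * (D2 x - D2 (h * v.1 + x.1, s2 * (h * v.2) + x.2))); last by field.
apply: (@le_trans _ _ (`|v.1| * (eps / K) + `|v.2| * (eps / K))).
  by rewrite (le_trans (ler_normD _ _))// !normrM lerD// ler_wpM2l.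
rewrite -mulrDl mulrCA ler_piMr ?(ltW eps0)// ler_pdivrMr// mul1r /K.
by clear; lra.
Unshelve. all: by end_near. Qed.

Lemma segment_half_plane x y (s : R) : H x -> H y -> 0 <= s <= 1 -> H (s *: (y - x) + x).
Proof.
rewrite /half_plane/= /GRing.scale/= => x0 y0 /andP[s0 s1].
have [->|sn] := eqVneq s 1; first by rewrite mul1r subrK.
rewrite [ltRHS](_ : _ = s * y.2 + (1 - s) * x.2); last by ring.
by rewrite ltr_wpDl ?mulr_ge0 ?(ltW y0)// mulr_gt0// subr_gt0 lt_neqAle sn.
Qed.

Lemma lipschitz_of_gradient f (G : R) x y : class_C 1 H f ->
  (forall z, H z -> grad_length f z <= G) -> H x -> H y -> `|f y - f x| <= G * len (y - x).
Proof.
move=> fC fG Hx Hy.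
pose D z := (y - x).1 * partial1 f z + (y - x).2 * partial2 f z.
have dD z : H z -> is_derive z (y - x) f (D z).
  move=> Hz; apply: is_derive_partials => //.
  - by move=> z' Hz'; exact: class_C1_is_derive fC Hz'.
  - by move=> z' Hz'; exact: class_C1_is_derive fC Hz'.
  - exact: class_C1_continuous fC Hz.
  - exact: class_C1_continuous fC Hz.
have [s s01] := @mean_value _ f D x (y - x) 1 (fun s s01 =>
  dD _ (segment_half_plane Hx Hy (eq_ind_r (fun t => is_true (0 <= t <= 1)) s01 (mulr1 s)))).
rewrite scale1r subrK mul1r mulr1 => ->.
set z := _ + x; have Hz : H z by exact: segment_half_plane.
apply: (@le_trans _ _ (grad_length f z * len (y - x))); last first.
  by rewrite ler_wpM2r ?len_ge0// fG.
rewrite /D [leRHS]mulrC [grad_length f z](_ : _ = len (partial1 f z, partial2 f z))//.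
exact: (norm_dot_le (y - x) (partial1 f z, partial2 f z)).
Qed.

(** The derivative in the direction of the gradient itself is the square of its length, and the
    Lipschitz bound makes it at most [L] times that length. *)
Lemma gradient_of_lipschitz f (L : R) x : 0 <= L -> class_C 1 H f ->
  (forall y z, H y -> H z -> `|f y - f z| <= L * len (y - z)) -> H x -> grad_length f x <= L.
Proof.
move=> L0 fC fL Hx.
pose v : R * R := (partial1 f x, partial2 f x).
have dv : is_derive x v f (v.1 * partial1 f x + v.2 * partial2 f x).
  apply: is_derive_partials => //.
  - by move=> z' Hz'; exact: class_C1_is_derive fC Hz'.
  - by move=> z' Hz'; exact: class_C1_is_derive fC Hz'.
  - exact: class_C1_continuous fC Hx.
  - exact: class_C1_continuous fC Hx.
have -> : grad_length f x = len v by [].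
have h : len v ^+ 2 <= L * len v.
  rewrite sqr_len /sqr_length /= !expr2.
  have <- : 'D_v f x = partial1 f x * partial1 f x + partial2 f x * partial2 f x.
    exact: derive_val.
  apply: limr_le; first exact: ex_derive.
  near=> h; rewrite /GRing.scale/=.
  have h0 : h != 0 by near: h; exact: nbhs_dnbhs_neq.
  have Hh : H (h *: v + x).
    near: h; apply: nbhs_dnbhs.
    have : (h *: v + x) @[h --> (0 : R)] --> (0 : R) *: v + x.
      by apply: cvgD; [apply: cvgZl|exact: cvg_cst].
    rewrite scale0r add0r; apply; apply: open_nbhs_nbhs; split => //; exact: half_plane_open.
  have := fL _ _ Hh Hx; rewrite addrK lenZ => hh.
  rewrite (le_trans (ler_norm _))// normrM normfV ler_pdivrMl ?normr_gt0//.
  by rewrite mulrCA.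
have [->//|v0] := eqVneq (len v) 0.
by move: h; rewrite expr2 ler_pM2r// lt_neqAle eq_sym v0 len_ge0.
Unshelve. all: by end_near. Qed.

End Gradient.

(** * Solutions of the Euler equation *)

Section Solution.
Context {R : realType}.
Local Notation H := (@half_plane R).
Local Notation mu := (@leb2 R).
Local Notation T2 := (measurableTypeR R * measurableTypeR R)%type.
Implicit Types (x y z v : R * R).

Lemma barrier_weights x : H x ->
  [/\ `|2 * x.1| <= barrier x, 2 * x.2 <= 2 * barrier x & `|ln x.2| <= barrier x].
Proof.
move=> Hx; have x0 : 0 < x.2 by [].
have l1 := ln_le_sub1 x0.
have s1 : 0 <= (x.1 - 1) ^+ 2 by rewrite sqr_ge0.
have s2 : 0 <= (x.1 + 1) ^+ 2 by rewrite sqr_ge0.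
have s3 : 0 <= (x.2 - 1) ^+ 2 by rewrite sqr_ge0.
have s4 : 0 <= x.1 ^+ 2 by rewrite sqr_ge0.
split; rewrite /barrier.
- by rewrite ler_norml; apply/andP; split; move: x0 l1 s1 s2 s3; clear; move=> *; nra.
- by move: x0 l1 s1 s2 s3 s4; clear; move=> *; nra.
- by rewrite ler_norml; apply/andP; split; move: x0 l1 s1 s2 s3 s4; clear; move=> *; nra.
Qed.

(** The singular term is the second velocity component divided by [x.2]: [velI2_bound] reduces it to
    [1 + |ln x.2|], which is at most twice the barrier. The other terms grow linearly and meet a
    bounded velocity. *)
Lemma velocity_barrier (q : R) (f : R * R -> R) (M : R) x :
  1 <= q < 2 -> 0 < M -> measurable_fun (H : set T2) (f : T2 -> R) ->
  (forall z, H z -> `|f z| <= M) ->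
  (\int[mu]_(z in H) (`|f z| `^ q)%:E <= (M `^ q)%:E)%E -> H x ->
  `|(velocity f x).1 * (2 * x.1) + (velocity f x).2 * (2 * x.2 - x.2^-1)| <=
    (6 * (M * (4 * pi) + M * far_const q) + 2 * (72 * pi * M + 4 * M * far_const q)) * barrier x.
Proof.
move=> q12 M0 mf fM fq Hx.
have [_ b1] := velI_bound q12 M0 (ltW M0) mf fM fq true Hx.
have [_ b2] := velI_bound q12 M0 (ltW M0) mf fM fq false Hx.
have b3 := velI2_bound q12 M0 (ltW M0) mf fM fq Hx.
have [g1 g2 g3] := barrier_weights Hx.
have g0 := barrier_ge1 Hx.
have x0 : 0 < x.2 by [].
have p0 := @pi_gt0 R; have c1 := far_const_ge1 q12.
have p1 : 0 <= (2 * pi : R)^-1 by rewrite invr_ge0 mulr_ge0// pi_ge0.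
have p2 : (2 * pi : R)^-1 <= 1.
  rewrite invf_le1 ?mulr_gt0//; have := @pi_ge2 R; clear; move=> *; lra.
rewrite velocityE /=.
set U := 2 * (M * (4 * pi) + M * far_const q) in b1 b2.
set W := 72 * pi * M + 4 * M * far_const q in b3.
have U0 : 0 <= U by rewrite (le_trans _ b1).
have W0 : 0 <= W.
  by rewrite /W addr_ge0// !mulr_ge0 ?(ltW M0) ?(ltW p0)// (le_trans ler01).
have scale (a b : R) : `|a| <= b -> `|(2 * pi)^-1 * a| <= b.
  move=> ab; rewrite normrM (ger0_norm p1) (le_trans _ ab)// ler_piMl//.
rewrite mulrBr addrA (le_trans (ler_normB _ _))//.
have t1 : `|(2 * pi)^-1 * velI f true x * (2 * x.1)| <= U * barrier x.
  by rewrite normrM ler_pM// scale.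
have t2 : `|(2 * pi)^-1 * velI f false x * (2 * x.2)| <= U * (2 * barrier x).
  by rewrite normrM ler_pM ?scale// ger0_norm// mulr_ge0// ltW.
have t3 : `|(2 * pi)^-1 * velI f false x / x.2| <= W * (2 * barrier x).
  rewrite normrM normfV (gtr0_norm x0) ler_pdivrMr// (le_trans (scale _ _ b3))//.
  rewrite -mulrA ler_wpM2l// mulrC ler_wpM2r ?(ltW x0)//.
  by move: g3 g0; clear; move=> *; lra.
apply: (@le_trans _ _ (U * barrier x + U * (2 * barrier x) + W * (2 * barrier x))).
  by rewrite lerD// (le_trans (ler_normD _ _))// lerD.
by rewrite /U /W; clear; lra.
Qed.

Variables (q : R) (w0 : R * R -> R) (w : R -> R * R -> R).
Hypotheses (q12 : 1 <= q < 2) (sol : euler_solution q w0 w).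

Let D := [set tx : R * (R * R) | 0 < tx.1 /\ H tx.2].
Let W (tx : R * (R * R)) := w tx.1 tx.2.

Lemma solution_time (t : R) x : 0 < t -> H x ->
  is_derive t (1 : R) (fun s => w s x) ('D_((1, 0) : R * (R * R)) W (t, x)).
Proof.
move=> t0 Hx.
have Dtx : D (t, x) by [].
have /is_derive_line h := class_C1_is_derive ((1, 0) : R * (R * R)) (euler_C1 sol) Dtx.
apply/is_derive_line; move: h; congr (is_derive _ _ _ _).
by apply/funext => h; rewrite /W/= scaler0 add0r.
Qed.

Lemma solution_space (t : R) x v : 0 < t -> H x ->
  is_derive x v (w t) ('D_((0, v) : R * (R * R)) W (t, x)).
Proof.
move=> t0 Hx.
have Dtx : D (t, x) by [].
have /is_derive_line h := class_C1_is_derive ((0, v) : R * (R * R)) (euler_C1 sol) Dtx.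
apply/is_derive_line; move: h; congr (is_derive _ _ _ _).
by apply/funext => h; rewrite /W/= scaler0 add0r.
Qed.

Lemma continuous_slice (t : R) x (F : R * (R * R) -> R) :
  {for (t, x), continuous F} -> {for x, continuous (fun y => F (t, y))}.
Proof.
by move=> cF; apply: (@continuous_comp _ _ _ (fun y : R * R => (t, y)) F) => //;
  apply: continuous_pair_comp; [exact: cvg_cst|exact: cvg_id].
Qed.

Lemma solution_class_C1 (t : R) : 0 < t -> class_C 1 H (w t).
Proof.
move=> t0; split.
  by move=> x Hx; apply: (@continuous_slice t x W); apply: (euler_C1 sol).1.
move=> v; split; first by move=> x Hx; exact: (@ex_derive _ _ _ _ _ _ _ (solution_space v t0 Hx)).
split => // x Hx.
have c := @continuous_slice t x _ (class_C1_continuous (v := (0, v) : R * (R * R)) (euler_C1 sol) (conj t0 Hx : D (t, x))).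
have e : {near x, 'D_v (w t) =1 (fun y => 'D_((0, v) : R * (R * R)) W (t, y))}.
  have : \forall y \near x, H y by apply: open_nbhs_nbhs; split => //; exact: half_plane_open.
  apply: filterS => y Hy; exact: (@derive_val _ _ _ _ _ _ _ (solution_space v t0 Hy)).
rewrite /prop_for /continuous_at (nbhs_singleton e).
by apply: cvg_trans c; apply: near_eq_cvg; near=> y; apply/esym; near: y; exact: e.
Unshelve. all: by end_near. Qed.

Lemma solution_wd (t : R) x : 0 < t -> H x -> exists Dt D1 D2 : R,
    [/\ is_derive t (1 : R) (fun s => w s x) Dt, is_derive x (e1 : R * R) (w t) D1,
        is_derive x (e2 : R * R) (w t) D2 &
        Dt + ((velocity (w t) x).1 * D1 + (velocity (w t) x).2 * D2) = 0].
Proof.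
move=> t0 Hx; have h1 := solution_time t0 Hx.
have h2 := solution_space (e1 : R * R) t0 Hx; have h3 := solution_space (e2 : R * R) t0 Hx.
have d1 : partial1 (w t) x = _ := @derive_val _ _ _ _ _ _ _ h2.
have d2 : partial2 (w t) x = _ := @derive_val _ _ _ _ _ _ _ h3.
have dt : 'D_(1 : R) (fun s => w s x) t = _ := @derive_val _ _ _ _ _ _ _ h1.
exists ('D_((1, 0) : R * (R * R)) W (t, x)), ('D_((0, e1) : R * (R * R)) W (t, x)),
  ('D_((0, e2) : R * (R * R)) W (t, x)); split; [exact: h1|exact: h2|exact: h3|].
by have := euler_eq sol t0 Hx; rewrite derive1E dt d1 d2.
Qed.

Lemma solution_continuous (t : R) : 0 <= t -> {in H, continuous (w t)}.
Proof.
move=> t0 x /set_mem Hx; change (R * R)%type in x.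
have c := cvg_solution (euler_cont sol) (z := (t, x)) t0 Hx.
apply: (@cvg_comp _ _ _ (fun y : R * R => (t, y)) (fun tx : R * (R * R) => w tx.1 tx.2) _ _ _ _ c).
move=> P; rewrite /within/= => hP.
have ct : {for x, continuous (fun y : R * R => (t, y))}.
  by apply: continuous_pair_comp; [exact: cvg_cst|exact: cvg_id].
have HH : \forall y \near x, H y.
  by apply: open_nbhs_nbhs; split => //; exact: half_plane_open.
have hP' : nbhs (t, x) (fun z : R * (R * R) => 0 <= z.1 /\ H z.2 -> P z) := hP.
have K : nbhs x (fun y : R * R => (0 <= t /\ H y -> P (t, y)) /\ H y).
  by apply: filterI => //; exact: (ct _ hP').
by apply: (filterS _ K) => y [hy Hy]; exact: hy.
Qed.

Lemma solution_measurable (t : R) : 0 <= t -> measurable_fun (H : set T2) (w t : T2 -> R).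
Proof.
by move=> t0; apply: continuous_measurable2; [exact: half_plane_open|exact: solution_continuous].
Qed.

(** Continuity turns the essential bound into a pointwise one; a single positive constant serves for
    both norms. *)
Lemma solution_bounds (T : R) : exists2 M : R, 0 < M &
  forall t, 0 <= t <= T -> (forall x, H x -> `|w t x| <= M) /\
    (\int[mu]_(z in H) (`|w t z| `^ q)%:E <= (M `^ q)%:E)%E.
Proof.
have [M hM] := euler_bounded sol T.
have q0 : 0 < q by case/andP: q12 => + _; exact: lt_le_trans.
exists (`|M| + 1) => [|t tT]; first by rewrite ltr_wpDl.
have MM : (M%:E <= (`|M| + 1)%:E)%E by rewrite lee_fin (le_trans (ler_norm M))// lerDl.
have [h1 h2] := hM t tT; have t0 : 0 <= t by case/andP: tT.
split.
  move=> x Hx; rewrite -lee_fin; apply: (le_trans _ (le_trans h1 MM)).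
  by apply: le_normLp_oo => //; apply: solution_continuous => //; exact/mem_set.
by apply/integral_pow_normLp => //; exact: le_trans h2 MM.
Qed.

Lemma solution_kappa (T : R) : exists2 kappa : R, 0 <= kappa &
  forall t x, 0 <= t <= T -> H x ->
  `|(velocity (w t) x).1 * (2 * x.1) + (velocity (w t) x).2 * (2 * x.2 - x.2^-1)| <=
    kappa * barrier x.
Proof.
have [M M0 hM] := solution_bounds T.
exists (6 * (M * (4 * pi) + M * far_const q) + 2 * (72 * pi * M + 4 * M * far_const q)).
  have c1 : 0 <= far_const q by rewrite (le_trans ler01)// far_const_ge1.
  by rewrite !addr_ge0// !mulr_ge0// ?addr_ge0 ?mulr_ge0 ?(ltW M0) ?pi_ge0.
move=> t x tT Hx; have [h1 h2] := hM t tT.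
apply: velocity_barrier => //; apply: solution_measurable; by case/andP: tT.
Qed.

(** Comparison without doubling: [b = l = 0], with [a = 1] and [a = -1] for the two signs, and
    [c = m]. *)
Lemma solution_sup (m t : R) x : (forall y, H y -> `|w0 y| <= m) -> 0 <= t -> H x ->
  `|w t x| <= m.
Proof.
move=> w0m t0 Hx.
have [M M0 hM] := solution_bounds t.
have [kappa k0 hk] := solution_kappa t.
have cmp (a : R) : `|a| <= 1 -> a * w t x <= m.
  move=> a1.
  have := @comparison R w (fun t => velocity (w t)) (euler_cont sol) solution_wd
    a 0 m 0 0 kappa M 1 0 t (lexx 0) ltr01 (lexx 0) k0 _ _ _ _ t x x.
  rewrite !mul0r !subr0 subr_le0; apply => //.
  - by move=> s y st Hy; have [+ _] := hM s st; exact.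
  - by move=> s y /andP[/ltW s0 st] Hy; apply: hk => //; rewrite s0.
  - by move=> *; rewrite !mul0r.
  - move=> y y' Hy _; rewrite !mul0r subr0 subr_le0 (euler_init sol Hy).
    rewrite (le_trans (ler_norm _))// normrM (le_trans _ (w0m _ Hy))//.
    by rewrite ler_piMl.
  - by rewrite t0 lexx.
rewrite ler_norml; apply/andP; split.
  by rewrite lerNl -mulN1r cmp// normrN normr1.
by rewrite -[w t x]mul1r cmp// normr1.
Qed.

End Solution.

(** * The velocity is weakly divergence free *)

Section Box.
Context {R : realType}.
Local Notation H := (@half_plane R).
Local Notation mu := (@leb2 R).
Local Notation leb := (@lebesgue_measure R).
Local Notation T2 := (measurableTypeR R * measurableTypeR R)%type.
Implicit Types (x y z p : R * R) (P Q : R * R -> R).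

Lemma integral_derive_eq0 (g h : R -> R) (a b : R) : a < b ->
  (forall s, a <= s <= b -> is_derive s (1 : R) g (h s)) ->
  (forall s, a <= s <= b -> {for s, continuous h}) -> g a = g b ->
  (\int[leb]_(s in `[a, b]) (h s)%:E = 0)%E.
Proof.
move=> ab gd ch gab.
have cg : {within `[a, b], continuous g}.
  apply: derivable_within_continuous => s; rewrite in_itv/= => /gd gd'.
  exact: ex_derive.
rewrite (continuous_FTC2 (F := g) ab).
- by rewrite gab subee.
- by apply: continuous_in_subspaceT => s /set_mem; rewrite /= in_itv/= => /ch.
- have [h1 h2 h3] := (continuous_within_itvP _ ab).1 cg.
  split => // s /subset_itv_oo_cc; rewrite in_itv/= => /gd gd'; exact: ex_derive.
- move=> s /subset_itv_oo_cc; rewrite in_itv/= => /gd gd'; rewrite derive1E; exact: derive_val.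
Qed.

Variables (a b c d : R).
Hypotheses (ab : a < b) (c0 : 0 < c) (cd : c < d).

Definition box : set (R * R) := `[a, b]%classic `*` `[c, d]%classic.

Lemma measurable_box : measurable (box : set T2).
Proof. by apply: measurableX; exact: measurable_itv. Qed.

Lemma box_half_plane : box `<=` H.
Proof. by move=> x [_]; rewrite /= in_itv/= => /andP[cx _]; exact: lt_le_trans cx. Qed.

Lemma compact_box : compact box.
Proof. by apply: compact_setX; exact: segment_compact. Qed.

Lemma box_measure_fin : (mu box < +oo)%E.
Proof.
have -> : mu box = (leb `[a, b] * leb `[c, d])%E by apply: product_measure1E; exact: measurable_itv.
rewrite !lebesgue_measure_itv/= !lte_fin ab cd -!EFinD -EFinM; exact: ltry.
Qed.

Lemma box_bounded Q : {in H, continuous Q} -> exists2 M : R, 0 <= M & forall x, box x -> `|Q x| <= M.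
Proof.
move=> cQ.
have cQ' : {within box, continuous (fun x => `|Q x|)}.
  apply: continuous_in_subspaceT => x /set_mem /box_half_plane Hx.
  by apply: continuous_comp; [apply: cQ; exact/mem_set|exact: norm_continuous].
have b0 : box !=set0.
  by exists (a, c); split; rewrite /= in_itv/= lexx ltW.
have [z _ zM] := compact_EVT_max b0 compact_box cQ'.
by exists `|Q z| => // x bx; exact/zM/mem_set.
Qed.

Lemma box_integrable Q : {in H, continuous Q} -> mu.-integrable (box : set T2) (EFin \o (Q : T2 -> R)).
Proof.
move=> cQ; have [M M0 QM] := box_bounded cQ.
apply: measurable_bounded_integrable.
- exact: measurable_box.
- exact: box_measure_fin.
- apply: (@measurable_funS _ _ _ _ (H : set T2)) => //.
  + exact: measurable_half_plane.
  + exact: box_half_plane.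
  + by apply: continuous_measurable2 => //; exact: half_plane_open.
- exists M; split; first exact: num_real.
  by move=> K MK x bx /=; rewrite (le_trans (QM _ bx))// ltW.
Qed.

Lemma box_indicE (s u : R) : (\1_box (s, u) : R) = \1_(`[a, b]%classic : set R) s * \1_(`[c, d]%classic : set R) u.
Proof. by rewrite /box indicE in_setX -mulnb natrM -!indicE. Qed.

Lemma integral_indicl (A : set R) (k : R) (h : R -> R) : measurable A ->
  (\int[leb]_s (\1_A s * k * h s)%:E = \int[leb]_(s in A) (k * h s)%:E)%E.
Proof.
move=> mA; rewrite [RHS]integral_mkcond; apply: eq_integral => s _.
rewrite patchE indicE; by case: ifPn; rewrite ?mul1r ?mul0r.
Qed.

Lemma continuous_line1 Q (s u : R) : {for (s, u), continuous Q} -> {for s, continuous (fun t => Q (t, u))}.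
Proof.
move=> cQ; apply: (@continuous_comp _ _ _ (fun t : R => (t, u)) Q) => //.
by apply: continuous_pair_comp; [exact: cvg_id|exact: cvg_cst].
Qed.

Lemma continuous_line2 Q (s u : R) : {for (s, u), continuous Q} -> {for u, continuous (fun t => Q (s, t))}.
Proof.
move=> cQ; apply: (@continuous_comp _ _ _ (fun t : R => (s, t)) Q) => //.
by apply: continuous_pair_comp; [exact: cvg_cst|exact: cvg_id].
Qed.

Lemma is_derive_slice1 P (s u D : R) :
  is_derive (s, u) ((1, 0) : R * R) P D -> is_derive s (1 : R) (fun t => P (t, u)) D.
Proof.
move=> [h <-]; have e : forall h : R, h *: ((1, 0) : R * R) + (s, u) = (h *: (1 : R) + s, u).
  move=> t; rewrite [LHS]surjective_pairing/=; congr (_, _).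
  by rewrite /GRing.scale/= mulr0 add0r.
apply: DeriveDef.
  by move: h; rewrite /derivable; under eq_fun do rewrite /= e.
by rewrite /derive; under [in RHS]eq_fun do rewrite /= e.
Qed.

Lemma is_derive_slice2 P (s u D : R) :
  is_derive (s, u) ((0, 1) : R * R) P D -> is_derive u (1 : R) (fun t => P (s, t)) D.
Proof.
move=> [h <-]; have e : forall h : R, h *: ((0, 1) : R * R) + (s, u) = (s, h *: (1 : R) + u).
  move=> t; rewrite [LHS]surjective_pairing/=; congr (_, _).
  by rewrite /GRing.scale/= mulr0 add0r.
apply: DeriveDef.
  by move: h; rewrite /derivable; under eq_fun do rewrite /= e.
by rewrite /derive; under [in RHS]eq_fun do rewrite /= e.
Qed.

(** On a box the divergence theorem reduces to Fubini and the fundamental theorem of calculus on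
    each horizontal line. *)
Lemma box_integral_derive1 P Q : {in H, continuous Q} ->
  (forall x, H x -> is_derive x ((1, 0) : R * R) P (Q x)) ->
  (forall u, 0 < u -> P (a, u) = P (b, u)) ->
  (\int[mu]_(x in box) (Q x)%:E = 0)%E.
Proof.
move=> cQ dP Pab.
have iQ := box_integrable cQ.
rewrite integral_mkcond restrict_EFin_indic leb2_fubini21; last first.
  by have := (integrable_mkcond _ measurable_box).1 iQ; rewrite restrict_EFin_indic.
apply: integral0_eq => u _.
under eq_integral do rewrite box_indicE.
rewrite integral_indicl; last exact: measurable_itv.
have [ucd|ucd] := boolP (u \in `[c, d]%classic); last first.
  by rewrite indicE (negPf ucd); under eq_integral do rewrite mul0r; rewrite integral0.
rewrite indicE ucd; under eq_integral do rewrite mul1r.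
have u0 : 0 < u by move: ucd; rewrite inE/= in_itv/= => /andP[+ _]; exact: lt_le_trans.
apply: (integral_derive_eq0 (g := fun t => P (t, u)) ab).
- by move=> s _; apply: is_derive_slice1; exact: dP.
- by move=> s _; apply: continuous_line1; apply: cQ; exact/mem_set.
- exact: Pab.
Qed.

Lemma box_integral_derive2 P Q : {in H, continuous Q} ->
  (forall x, H x -> is_derive x ((0, 1) : R * R) P (Q x)) ->
  (forall s, P (s, c) = P (s, d)) ->
  (\int[mu]_(x in box) (Q x)%:E = 0)%E.
Proof.
move=> cQ dP Pcd.
have iQ := box_integrable cQ.
rewrite integral_mkcond restrict_EFin_indic leb2_fubini12; last first.
  by have := (integrable_mkcond _ measurable_box).1 iQ; rewrite restrict_EFin_indic.
apply: integral0_eq => s _.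
under eq_integral do rewrite box_indicE [_ * \1__ _]mulrC.
rewrite integral_indicl; last exact: measurable_itv.
have [scd|scd] := boolP (s \in `[a, b]%classic); last first.
  by rewrite indicE (negPf scd); under eq_integral do rewrite mul0r; rewrite integral0.
rewrite indicE scd; under eq_integral do rewrite mul1r.
have Hu u : c <= u <= d -> H (s, u) by move=> /andP[+ _]; exact: lt_le_trans.
apply: (integral_derive_eq0 (g := fun t => P (s, t)) cd).
- by move=> u ucd; apply: is_derive_slice2; apply: dP; exact: Hu.
- by move=> u ucd; apply: continuous_line2; apply: cQ; apply/mem_set; exact: Hu.
- exact: Pcd.
Qed.

End Box.

Lemma is_derive_invM (R : realType) (V : normedModType R) (f g : V -> R) (w v : V) (Df Dg : R) :
  g w != 0 -> is_derive w v f Df -> is_derive w v g Dg ->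
  is_derive w v (fun y => (g y)^-1 * f y) ((g w)^-1 * Df - f w * Dg * (g w)^-1 ^+ 2).
Proof.
move=> gx df dg.
have dV : is_derive w v (fun y => (g y)^-1) (- (g w)^-1 ^+ 2 * Dg).
  apply: DeriveDef; first by apply: derivableV => //; exact: ex_derive.
  by rewrite deriveV// derive_val /GRing.scale/= exprVn.
have h := is_deriveM dV df.
apply: (is_derive_eq h).
by rewrite /GRing.scale/=; ring.
Qed.

Lemma ler_norm_between (R : realType) (s u v : R) : u <= s -> s <= v -> `|s| <= `|u| + `|v|.
Proof.
move=> us sv; rewrite ler_norml; apply/andP; split.
  by have := ler_norm (- u); rewrite normrN; have := normr_ge0 v; lra.
by have := ler_norm v; have := normr_ge0 u; lra.
Qed.

(** * Fubini's theorem for the product of two planes *)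

Section Fubini4.
Context {R : realType}.
Local Notation mu := (@leb2 R).
Local Notation T2 := (measurableTypeR R * measurableTypeR R)%type.

Lemma leb2_sigma_finite : sigma_finite setT mu.
Proof.
exists (fun n => ball (0 : R) n.+1%:R `*` ball (0 : R) n.+1%:R).
  apply/esym/seteqP; split => // x _.
  have [n _ xn] : exists2 n : nat, True & `|x.1| + `|x.2| < n.+1%:R.
    exists (Num.truncn (`|x.1| + `|x.2|)) => //.
    by rewrite truncnS_gt// addr_ge0.
  exists n => //; split; rewrite /ball/= sub0r normrN (le_lt_trans _ xn)//.
    by rewrite lerDl.
  by rewrite lerDr.
move=> n; split; first by apply: measurableX; exact: measurable_ball.
set b : set R := ball (0 : R) _.
have -> : mu (b `*` b) = (@lebesgue_measure R b * @lebesgue_measure R b)%E.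
  by apply: product_measure1E; exact: measurable_ball.
by rewrite /b !lebesgue_measure_ball// -EFinM ltry.
Qed.

(* The sigma-finite instance of the library for products of measures is shadowed
   by the one for products of subprobabilities, hence this alias. *)
Definition plane_measure : set T2 -> \bar R := mu.
HB.instance Definition _ := Measure.on plane_measure.
HB.instance Definition _ := Measure_isSigmaFinite.Build _ T2 R plane_measure leb2_sigma_finite.

Let smu : {sigma_finite_measure set T2 -> \bar R} := plane_measure.

Lemma leb2_measurable_integral (g : (R * R) * (R * R) -> R) :
  measurable_fun setT (g : T2 * T2 -> R) ->
  measurable_fun setT (fun x : T2 => \int[mu]_y `|(g (x, y))%:E|)%E.
Proof.
move=> mg.
pose G : T2 * T2 -> \bar R := fun z => `|(g z)%:E|%E.
apply: (@measurable_fun_fubini_tonelli_F _ _ T2 T2 R smu G); last by move=> z; exact: abse_ge0.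
by apply: measurableT_comp => //; exact/measurable_EFinP.
Qed.

Lemma leb2_fubini (g : (R * R) * (R * R) -> R) :
  measurable_fun setT (g : T2 * T2 -> R) ->
  (\int[mu]_x \int[mu]_y `|(g (x, y))%:E| < +oo)%E ->
  mu.-integrable setT (fun x : T2 => \int[mu]_y (g (x, y))%:E)%E /\
  (\int[mu]_x \int[mu]_y (g (x, y))%:E = \int[mu]_y \int[mu]_x (g (x, y))%:E)%E.
Proof.
move=> mg gfin.
pose G : T2 * T2 -> \bar R := EFin \o g.
have mG : measurable_fun setT G by exact/measurable_EFinP.
have [_ h] := @integrable12ltyP _ _ T2 T2 R smu smu G mG.
split; first exact: (@integrable_fubini_F _ _ T2 T2 R smu smu G (h gfin)).
exact: (@Fubini _ _ T2 T2 R smu smu G (h gfin)).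
Qed.

End Fubini4.

(** * Weak divergence of the kernels, then of the velocity *)

Section RegularKernel.
Context {R : realType}.
Local Notation H := (@half_plane R).
Local Notation mu := (@leb2 R).
Local Notation T2 := (measurableTypeR R * measurableTypeR R)%type.
Implicit Types (x y z p : R * R) (P Q : R * R -> R).

Definition regK (k : R) z : R * R := (sqr_length z + k)^-1 *: perp z.
(** The second partial derivative of the second component of [regK], and minus the first partial
    derivative of the first: their sum is zero. *)
Definition dregK (k : R) z : R := 2 * z.1 * z.2 * (sqr_length z + k)^-1 ^+ 2.

Lemma regK_den_gt0 (k : R) z : 0 < k -> 0 < sqr_length z + k.
Proof. by move=> k0; rewrite ltr_wpDl// sqr_length_ge0. Qed.

Lemma continuous_shift (p x : R * R) : {for x, continuous (fun x => x - p)}.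
Proof. by apply: cvgB; [exact: cvg_id|exact: cvg_cst]. Qed.

Lemma continuous_regK_inv (k : R) x : 0 < k ->
  {for x, continuous (fun z : R * R => (sqr_length z + k)^-1)}.
Proof.
move=> k0; apply: (@cvgV _ _ _ _ (fun z : R * R => sqr_length z + k)).
  by rewrite gt_eqF// regK_den_gt0.
apply: cvgD; last exact: cvg_cst.
apply: cvgD; apply: cvgM; solve [exact: continuous_fst1|exact: continuous_snd1].
Qed.

Lemma continuous_regK (k : R) i x : 0 < k -> {for x, continuous (fun z => pr i (regK k z))}.
Proof.
move=> k0; case: i; rewrite /regK /= /GRing.scale/=.
  by apply: cvgM; [exact: continuous_regK_inv|exact: continuous_snd1].
by apply: cvgM; [exact: continuous_regK_inv|apply: cvgN; exact: continuous_fst1].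
Qed.

Lemma continuous_dregK (k : R) x : 0 < k -> {for x, continuous (dregK k)}.
Proof.
move=> k0; apply: cvgM; last by apply: cvgM; exact: continuous_regK_inv.
by apply: cvgM; [apply: cvgM; [exact: cvg_cst|exact: continuous_fst1]|exact: continuous_snd1].
Qed.

Lemma is_derive_regK1 (k : R) p x : 0 < k ->
  is_derive x (e1 : R * R) (fun x => pr true (regK k (x - p))) (- dregK k (x - p)).
Proof.
move=> k0; apply/is_derive_line.
pose z := x - p.
have e (h : R) : h *: (e1 : R * R) + x - p = (h + z.1, z.2).
  by rewrite [LHS]surjective_pairing /e1 /z /= /GRing.scale/= mulr1 mulr0 add0r addrA.
under eq_fun do rewrite e /regK/= /sqr_length/= /GRing.scale/=.
have D0 := regK_den_gt0 z k0; rewrite /sqr_length in D0.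
pose g (h : R) : R := (h + z.1) ^+ 2 + z.2 ^+ 2 + k.
have dg : is_derive (0 : R) (1 : R) g (2 * z.1).
  by rewrite /g; apply: is_derive_eq; rewrite /GRing.scale/= !add0r !addr0; ring.
have g0 : g 0 != 0 by rewrite /g add0r gt_eqF.
apply: (is_derive_eq (is_derive_invM g0 (is_derive_cst z.2 (0 : R) (1 : R)) dg)).
by rewrite /g /dregK -/z /sqr_length /cst add0r; ring.
Qed.

Lemma is_derive_regK2 (k : R) p x : 0 < k ->
  is_derive x (e2 : R * R) (fun x => pr false (regK k (x - p))) (dregK k (x - p)).
Proof.
move=> k0; apply/is_derive_line.
pose z := x - p.
have e (h : R) : h *: (e2 : R * R) + x - p = (z.1, h + z.2).
  by rewrite [LHS]surjective_pairing /e2 /z /= /GRing.scale/= mulr1 mulr0 add0r addrA.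
under eq_fun do rewrite e /regK/= /sqr_length/= /GRing.scale/=.
have D0 := regK_den_gt0 z k0; rewrite /sqr_length in D0.
pose g (h : R) : R := z.1 ^+ 2 + (h + z.2) ^+ 2 + k.
have dg : is_derive (0 : R) (1 : R) g (2 * z.2).
  by rewrite /g; apply: is_derive_eq; rewrite /GRing.scale/= !add0r !addr0; ring.
have g0 : g 0 != 0 by rewrite /g add0r gt_eqF.
apply: (is_derive_eq (is_derive_invM g0 (is_derive_cst (- z.1) (0 : R) (1 : R)) dg)).
by rewrite /g /dregK -/z /sqr_length /cst add0r; ring.
Qed.

Variables (a b c d : R).
Hypotheses (ab : a < b) (c0 : 0 < c) (cd : c < d).
Local Notation B := (box a b c d).

Variables (Psi P1 P2 : R * R -> R).
Hypotheses (dPsi1 : forall x, H x -> is_derive x (e1 : R * R) Psi (P1 x))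
           (dPsi2 : forall x, H x -> is_derive x (e2 : R * R) Psi (P2 x)).
Hypotheses (cPsi : {in H, continuous Psi}) (cP1 : {in H, continuous P1})
           (cP2 : {in H, continuous P2}).
Hypothesis Psi1 : forall u, 0 < u -> Psi (a, u) = 0 /\ Psi (b, u) = 0.
Hypothesis Psi2 : forall s, Psi (s, c) = 0 /\ Psi (s, d) = 0.

Lemma continuous_regK_shift (k : R) i p x : 0 < k ->
  {for x, continuous (fun x => pr i (regK k (x - p)))}.
Proof.
move=> k0; apply: (@continuous_comp _ _ _ (fun x => x - p) (fun z => pr i (regK k z))).
  exact: continuous_shift.
exact: continuous_regK.
Qed.

(** Each component of the kernel times [Psi] vanishes on the sides that matter, so its derivative
    has integral 0; in the sum of the two the derivatives of the kernel cancel. *)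
Lemma regK_weak_divergence (k : R) p : 0 < k ->
  (\int[mu]_(x in B) (pr true (regK k (x - p)) * P1 x + pr false (regK k (x - p)) * P2 x)%:E = 0)%E.
Proof.
move=> k0.
pose K i x := pr i (regK k (x - p)).
pose J x := dregK k (x - p).
have cJ x : {for x, continuous J}.
  apply: (@continuous_comp _ _ _ (fun x => x - p) (dregK k)); first exact: continuous_shift.
  exact: continuous_dregK.
have cQ1 : {in H, continuous (fun x => K true x * P1 x + Psi x * - J x)}.
  move=> x Hx; apply: cvgD; apply: cvgM; [exact: continuous_regK_shift|exact: cP1|exact: cPsi|].
  by apply: cvgN; exact: cJ.
have cQ2 : {in H, continuous (fun x => K false x * P2 x + Psi x * J x)}.
  by move=> x Hx; apply: cvgD; apply: cvgM; [exact: continuous_regK_shift|exact: cP2|exact: cPsi|exact: cJ].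
have I1 := box_integral_derive1 ab c0 cd (P := fun x => K true x * Psi x) cQ1.
have I2 := box_integral_derive2 ab c0 cd (P := fun x => K false x * Psi x) cQ2.
have {}I1 : (\int[mu]_(x in B) (K true x * P1 x + Psi x * - J x)%:E = 0)%E.
  apply: I1 => [x Hx|u u0]; last by rewrite (Psi1 u0).1 (Psi1 u0).2 !mulr0.
  by apply: (is_derive_eq (is_deriveM (is_derive_regK1 p x k0) (dPsi1 Hx))); rewrite /GRing.scale.
have {}I2 : (\int[mu]_(x in B) (K false x * P2 x + Psi x * J x)%:E = 0)%E.
  apply: I2 => [x Hx|s]; last by rewrite (Psi2 s).1 (Psi2 s).2 !mulr0.
  by apply: (is_derive_eq (is_deriveM (is_derive_regK2 p x k0) (dPsi2 Hx))); rewrite /GRing.scale.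
rewrite -[RHS]adde0 -[X in (X + _)%E]I1 -[X in (_ + X)%E]I2.
rewrite -integralD; [|exact: measurable_box|exact: box_integrable|exact: box_integrable].
apply: eq_integral => x _; rewrite -EFinD; congr (_%:E).
by rewrite /K; ring.
Qed.

Lemma regK_le (k : R) i z : 0 < k -> `|pr i (regK k z)| <= (len z)^-1.
Proof.
move=> k0; have [->|z0] := eqVneq z 0.
  have -> : pr i (regK k (0 : R * R)) = 0.
    by case: i; rewrite /regK /= /GRing.scale/= ?oppr0 mulr0.
  by rewrite normr0 invr_ge0 len_ge0.
apply: (le_trans (pr_le_len _ _)); rewrite /regK lenZ len_perp.
have l0 := len_gt0 z0; have D0 := regK_den_gt0 z k0.
rewrite ger0_norm ?invr_ge0 ?(ltW D0)// mulrC ler_pdivrMr// ler_pdivlMl//.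
by rewrite -expr2 sqr_len lerDl ltW.
Qed.

Lemma cvg_regK i z : pr i (regK n.+1%:R^-1 z) @[n --> \oo] --> pr i (K z).
Proof.
have [->|z0] := eqVneq z 0.
  have -> : pr i (K (0 : R * R)) = 0.
    by case: i; rewrite /K /= /GRing.scale/= ?oppr0 mulr0.
  apply: cvg_near_cst; apply: nearW => n.
  by case: i; rewrite /regK /= /GRing.scale/= ?oppr0 mulr0.
have s0 : sqr_length z != 0 by rewrite -sqr_len expf_neq0// gt_eqF// len_gt0.
have h : (sqr_length z + n.+1%:R^-1)^-1 @[n --> \oo] --> (sqr_length z)^-1.
  apply: cvgV => //; rewrite -[X in _ --> X]addr0; apply: cvgD; first exact: cvg_cst.
  exact: cvg_harmonic.
by case: i; apply: cvgM => //; exact: cvg_cst.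
Qed.

Lemma box_invlen_bound p : exists M : R, ibound (fun x => \1_B x * (len (x - p))^-1) M.
Proof.
have [r r0 Br] : exists2 r : R, 0 <= r & B `<=` [set x | len (x - p) < r].
  exists (`|a - p.1| + `|b - p.1| + `|c - p.2| + `|d - p.2| + 1).
    by rewrite !addr_ge0.
  move=> x [+ +]; rewrite /= !in_itv/= => /andP[x1 x1'] /andP[x2 x2'].
  apply: (le_lt_trans (len_le_sum _)) => /=.
  have h1 : `|x.1 - p.1| <= `|a - p.1| + `|b - p.1| by apply: ler_norm_between; rewrite lerD2r.
  have h2 : `|x.2 - p.2| <= `|c - p.2| + `|d - p.2| by apply: ler_norm_between; rewrite lerD2r.
  by apply: (le_lt_trans (lerD h1 h2)); rewrite addrA ltrDl.
exists (4 * pi * r).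
have mB := measurable_box a b c d.
apply: (ibound_dom _ _ (ibound_near p r0)) => [|x].
  apply: measurable_funM; first exact: measurable_indic.
  by apply: measurable_invr_comp; exact: measurable_len_sub.
rewrite mulr_ge0 ?invr_ge0 ?len_ge0 ?indicE//=.
apply: ler_wpM2r; first by rewrite invr_ge0 len_ge0.
have [xB|_] := boolP (x \in B); last exact: ler0n.
by rewrite mem_set//; exact/Br/set_mem.
Qed.

Lemma measurable_in_box (Q : R * R -> R) : {in H, continuous Q} -> measurable_fun (B : set T2) (Q : T2 -> R).
Proof.
move=> cQ; apply: (@measurable_funS _ _ _ _ (H : set T2)) => //.
- exact: measurable_half_plane.
- exact: box_half_plane.
- by apply: continuous_measurable2 => //; exact: half_plane_open.
Qed.

Let M1 : exists2 M : R, 0 <= M & forall x, B x -> `|P1 x| <= M := box_bounded ab c0 cd cP1.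
Let M2 : exists2 M : R, 0 <= M & forall x, B x -> `|P2 x| <= M := box_bounded ab c0 cd cP2.

Lemma measurable_shift p : measurable_fun setT (fun x : T2 => ((x : R * R) - p) : T2).
Proof.
by apply/measurable_fun_pairP; split; apply: measurable_funB.
Qed.

(** Dominated convergence as the regularization tends to 0; the majorant is a multiple of
    [(len (x - p))^-1], integrable over the box wherever the pole [p] lies. *)
Lemma K_weak_divergence p :
  mu.-integrable (B : set T2) (fun x => (pr true (K (x - p)) * P1 x + pr false (K (x - p)) * P2 x)%:E) /\
  (\int[mu]_(x in B) (pr true (K (x - p)) * P1 x + pr false (K (x - p)) * P2 x)%:E = 0)%E.
Proof.
have [m1 m10 P1m] := M1; have [m2 m20 P2m] := M2.
have mB := measurable_box a b c d.
have [C hC] := box_invlen_bound p.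
have ml : measurable_fun (B : set T2) (fun x : T2 => (len ((x : R * R) - p))^-1).
  by apply: measurable_funTS; apply: measurable_invr_comp; exact: measurable_len_sub.
have hl z : B z -> z <> p -> z <> p -> `|(len (z - p))^-1| <= \1_B z * (len (z - p))^-1.
  by move=> Bz _ _; rewrite ind1// mul1r ger0_norm// invr_ge0 len_ge0.
have [il _] := ibound_Rintegral mB ml hC hl.
have mK i : measurable_fun (B : set T2) (fun x : T2 => pr i (K ((x : R * R) - p))).
  by apply: measurable_funTS; apply: (@measurable_K _ _ _ (fun x : T2 => ((x : R * R) - p) : T2)); exact: measurable_shift.
have mP1 := measurable_in_box cP1; have mP2 := measurable_in_box cP2.
have mR (n : nat) i : measurable_fun (B : set T2) (fun x : T2 => pr i (regK n.+1%:R^-1 ((x : R * R) - p))).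
  by apply: measurable_in_box => x Hx; apply: continuous_regK_shift; rewrite invr_gt0.
have [] := @dominated_convergence _ _ _ mu (B : set T2) mB
  (fun n x => (pr true (regK n.+1%:R^-1 (x - p)) * P1 x + pr false (regK n.+1%:R^-1 (x - p)) * P2 x)%:E)
  (fun x => (pr true (K (x - p)) * P1 x + pr false (K (x - p)) * P2 x)%:E)
  (fun x => ((m1 + m2) * (len (x - p))^-1)%:E).
- move=> n; apply/measurable_EFinP.
  by apply: measurable_funD; apply: measurable_funM => //; exact: mR.
- apply/measurable_EFinP.
  by apply: measurable_funD; apply: measurable_funM => //; exact: mK.
- apply: aeW => x Bx; apply: cvg_EFin; first exact: nearW.
  by apply: cvgD; apply: cvgMl; exact: cvg_regK.
- by under eq_fun do rewrite EFinM; exact: integrableZl.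
- apply: aeW => x n Bx; rewrite abse_EFin lee_fin mulrDl.
  have k0 : 0 < n.+1%:R^-1 :> R by rewrite invr_gt0.
  have h i (P M : R) : `|P| <= M ->
      `|pr i (regK n.+1%:R^-1 (x - p)) * P| <= M * (len (x - p))^-1.
    by move=> PM; rewrite normrM mulrC ler_pM// regK_le.
  by apply: (le_trans (ler_normD _ _)); apply: lerD; apply: h; [exact: P1m|exact: P2m].
move=> int _ cvg; split => //.
rewrite (_ : [sequence _]_n = cst 0%E) in cvg; last first.
  by apply/funext => n /=; apply: regK_weak_divergence; rewrite invr_gt0.
by apply/esym; apply: (cvg_unique _ (cvg_cst 0%E) cvg).
Qed.

Variables (q N m : R) (f : R * R -> R).
Hypotheses (q12 : 1 <= q < 2) (N0 : 0 < N) (m0 : 0 <= m).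
Hypothesis mf : measurable_fun (H : set T2) (f : T2 -> R).
Hypothesis fm : forall z, H z -> `|f z| <= m.
Hypothesis fN : (\int[mu]_(z in H) (`|f z| `^ q)%:E <= (N `^ q)%:E)%E.

Let G x y : R := pr true (BS_kernel x y) * P1 x + pr false (BS_kernel x y) * P2 x.

Let Gx0 y : (\int[mu]_(x in B) (G x y * (\1_H y * f y))%:E = 0)%E.
Proof.
have [i1 z1] := K_weak_divergence y.
have [i2 z2] := K_weak_divergence (reflect_bdry y).
under eq_integral do rewrite EFinM.
have GE x : (G x y)%:E = ((pr true (K (x - y)) * P1 x + pr false (K (x - y)) * P2 x)%:E -
  (pr true (K (x - reflect_bdry y)) * P1 x + pr false (K (x - reflect_bdry y)) * P2 x)%:E)%E.
  by rewrite /G BS_kernelE !prB -EFinB; congr (_%:E); ring.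
under eq_integral do rewrite GE.
rewrite integralZr//; [|exact: measurable_box|apply: integrableB => //; exact: measurable_box].
rewrite integralB//; [|exact: measurable_box].
by rewrite z1 z2 subee// mul0e.
Qed.

Let Gy x : B x -> (\int[mu]_y (G x y * (\1_H y * f y))%:E =
  (velI f true x * P1 x + velI f false x * P2 x)%:E)%E.
Proof.
move=> Bx; have Hx := box_half_plane c0 Bx.
have [i1 _] := velI_bound q12 N0 m0 mf fm fN true Hx.
have [i2 _] := velI_bound q12 N0 m0 mf fm fN false Hx.
have mH := measurable_half_plane : measurable (H : set T2).
transitivity (\int[mu]_(y in H) ((P1 x)%:E * (pr true (BS_kernel x y) * f y)%:E +
    (P2 x)%:E * (pr false (BS_kernel x y) * f y)%:E))%E.
  rewrite [RHS]integral_mkcond; apply: eq_integral => y _.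
  rewrite patchE indicE; case: ifPn => _; last by rewrite mul0r mulr0.
  by rewrite mul1r /G -!EFinM -EFinD; congr (_%:E); ring.
rewrite integralD//; [|exact: integrableZl|exact: integrableZl].
rewrite !integralZl// /velI /Rintegral EFinD !EFinM.
rewrite !fineK; [|exact: integrable_fin_num|exact: integrable_fin_num].
by rewrite ![(_ * (P1 x)%:E)%E]muleC ![(_ * (P2 x)%:E)%E]muleC.
Qed.

(** All derivatives fall on the test function [Psi]. Once the integrals are exchanged, the inner one
    is, for each source [y], the weak divergence of the kernels with poles [y] and its mirror image,
    hence zero. *)
Lemma velocity_weak_divergence :
  mu.-integrable (B : set T2) (fun x => (velI f true x * P1 x + velI f false x * P2 x)%:E) /\
  (\int[mu]_(x in B) (velI f true x * P1 x + velI f false x * P2 x)%:E = 0)%E.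
Proof.
have [m1 m10 P1m] := M1; have [m2 m20 P2m] := M2.
have mB := measurable_box a b c d.
have mH := measurable_half_plane : measurable (H : set T2).
pose g (z : (R * R) * (R * R)) : R := \1_B z.1 * (G z.1 z.2 * (\1_H z.2 * f z.2)).
have mfst : measurable_fun setT (fst : T2 * T2 -> T2) by exact: measurable_fst.
have msnd : measurable_fun setT (snd : T2 * T2 -> T2) by exact: measurable_snd.
have mHf : measurable_fun setT (fun y : T2 => \1_H y * f y).
  rewrite (_ : (fun y => _) = f \_ H); first exact: (measurable_restrictT _ mH).1 mf.
  by apply/funext => y; rewrite patchE indicE; case: ifPn => _; rewrite ?mul1r ?mul0r.
have mBP (Q : R * R -> R) : {in H, continuous Q} -> measurable_fun setT (fun x : T2 => \1_B x * Q x).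
  move=> cQ; rewrite (_ : (fun y => _) = Q \_ B).
    exact: (measurable_restrictT _ mB).1 (measurable_in_box cQ).
  by apply/funext => y; rewrite patchE indicE; case: ifPn => _; rewrite ?mul1r ?mul0r.
have mg : measurable_fun setT (g : T2 * T2 -> R).
  have -> : g = (fun z : (R * R) * (R * R) => (pr true (BS_kernel z.1 z.2) * (\1_B z.1 * P1 z.1) +
     pr false (BS_kernel z.1 z.2) * (\1_B z.1 * P2 z.1)) * (\1_H z.2 * f z.2)).
    by apply/funext => z; rewrite /g /G; ring.
  apply: measurable_funM; last by apply: (measurableT_comp mHf).
  apply: measurable_funD; apply: measurable_funM.
  - exact: (@measurable_BS _ _ _ (fst : T2 * T2 -> T2) snd true).
  - exact: (measurableT_comp (mBP _ cP1)).
  - exact: (@measurable_BS _ _ _ (fst : T2 * T2 -> T2) snd false).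
  - exact: (measurableT_comp (mBP _ cP2)).
pose V := 2 * (m * (4 * pi) + N * far_const q).
have V0 : 0 <= V.
  have := far_const_ge1 q12; have := @pi_ge0 R => p0 c1.
  by rewrite mulr_ge0// addr_ge0// ?mulr_ge0// ?(ltW N0)// (le_trans ler01).
have mV0 : 0 <= m1 * V + m2 * V by rewrite addr_ge0// mulr_ge0.
(* Absolute convergence: a bound of the velocity integral uniform in [x], times the finite measure
   of the box. *)
have gfin : (\int[mu]_x \int[mu]_y `|(g (x, y))%:E| < +oo)%E.
  apply: (@le_lt_trans _ _ (\int[mu]_x ((m1 * V + m2 * V)%:E * (\1_B x)%:E))%E); last first.
    rewrite ge0_integralZl//; first last.
      by apply/measurable_EFinP; exact: measurable_indic.
    rewrite integral_indic// setIT.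
    have := box_measure_fin ab cd; rewrite -ge0_fin_numE// => Bfin.
    by rewrite -(fineK Bfin) -EFinM ltry.
  apply: ge0_le_integral => //.
  - by move=> x _; apply: integral_ge0.
  - exact: leb2_measurable_integral.
  - by apply: measurable_funeM; apply/measurable_EFinP; exact: measurable_indic.
  move=> x _; have [Bx|nBx] := pselect (B x); last first.
    rewrite integral0_eq; first by rewrite ind0// mule0.
    by move=> y _; rewrite /g/= ind0// mul0r normr0.
  have Hx := box_half_plane c0 Bx.
  have v1 := velI_abs_bound q12 N0 m0 mf fm fN true Hx.
  have v2 := velI_abs_bound q12 N0 m0 mf fm fN false Hx.
  have mBS i : measurable_fun (H : set T2) (fun y : T2 => `|pr i (BS_kernel x y) * f y|%:E).
    apply/measurable_EFinP; apply: measurableT_comp => //; apply: measurable_funM => //.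
    exact: mBS.
  rewrite ind1// mule1.
  apply: (@le_trans _ _ (\int[mu]_(y in H) (m1%:E * `|pr true (BS_kernel x y) * f y|%:E +
     m2%:E * `|pr false (BS_kernel x y) * f y|%:E))%E).
    rewrite [leRHS]integral_mkcond; apply: ge0_le_integral => //.
    - by apply: measurableT_comp => //; apply/measurable_EFinP; exact: (measurableT_comp mg).

    - apply: (measurable_restrictT _ mH).1.
      by apply: emeasurable_funD; apply: measurable_funeM; exact: mBS.
    move=> y _; rewrite patchE /g/= ind1// mul1r indicE; case: ifPn => _; last first.
      by rewrite mul0r mulr0 normr0.
    rewrite mul1r -!EFinM -EFinD lee_fin /G mulrDl (le_trans (ler_normD _ _))//.
    apply: lerD; rewrite mulrAC normrM mulrC; apply: ler_wpM2r => //; [exact: P1m|exact: P2m].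
  rewrite ge0_integralD//; first last.
  - exact: measurable_funeM.
  - by move=> y _; rewrite mule_ge0// lee_fin.
  - exact: measurable_funeM.
  - by move=> y _; rewrite mule_ge0// lee_fin.
  rewrite !ge0_integralZl//.
  by rewrite EFinD !EFinM; apply: leeD; apply: lee_wpmul2l; rewrite ?lee_fin.
have [iF F] := leb2_fubini mg gfin.
have FE (x : R * R) : (\int[mu]_y (g (x, y))%:E =
    (\1_B x * (velI f true x * P1 x + velI f false x * P2 x))%:E)%E.
  have [Bx|nBx] := pselect (B x).
    rewrite (ind1 Bx) mul1r -(Gy Bx); apply: eq_integral => y _.
    by rewrite /g/= (ind1 Bx) mul1r.
  rewrite (ind0 nBx) mul0r; apply/integral0_eq => y _.
  by rewrite /g/= (ind0 nBx) mul0r.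
split.
  apply/(integrable_mkcond _ mB); rewrite restrict_EFin_indic.
  by move: iF; under eq_fun do rewrite FE.
rewrite [RHS](_ : 0%E = \int[mu]_y \int[mu]_x (g (x, y))%:E)%E; last first.
  apply/esym/integral0_eq => y _; rewrite -[RHS](Gx0 y) [RHS]integral_mkcond.
  by apply: eq_integral => x _; rewrite restrict_EFin_indic.
rewrite -F integral_mkcond; apply: eq_integral => x _.
by rewrite restrict_EFin_indic FE.
Qed.

End RegularKernel.

(** * Decay of the L^q norm *)

Section Cutoff.
Context {R : realType}.
Local Notation H := (@half_plane R).
Implicit Types (x y z v : R * R).

Lemma sqr_pos_part_taylor (r h : R) :
  `|Num.max 0 (r + h) ^+ 2 - Num.max 0 r ^+ 2 - 2 * Num.max 0 r * h| <= h ^+ 2.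
Proof.
rewrite ler_norml !expr2; apply/andP; split; rewrite !maxEle;
  case: (leP 0 (r + h)) => h1; case: (leP 0 r) => h2; nra.
Qed.

Lemma is_derive_sqr_pos_part (r : R) :
  is_derive r (1 : R) (fun s => Num.max 0 s ^+ 2) (2 * Num.max 0 r).
Proof.
pose f (s : R) : R := Num.max 0 s ^+ 2.
suff cv : h^-1 *: (f (h *: (1 : R) + r) - f r) @[h --> 0^'] --> (2 * Num.max 0 r : R).
  by apply: DeriveDef; [apply/cvg_ex; exists (2 * Num.max 0 r)|exact: cvg_lim].
apply/cvgrPdist_le => /= eps eps0; near=> h.
have h0 : h != 0 by near: h; exact: nbhs_dnbhs_neq.
have hn : 0 < `|h| by rewrite normr_gt0.
have he : `|h| <= eps by apply: ltW; near: h; exact: dnbhs0_lt.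
apply: le_trans he; rewrite /GRing.scale/= mulr1 /f (addrC h).
rewrite [_ - _](_ : _ = - (h^-1 * (Num.max 0 (r + h) ^+ 2 - Num.max 0 r ^+ 2 - 2 * Num.max 0 r * h))).
  rewrite normrN normrM normfV ler_pdivrMl// -expr2 real_normK ?num_real//.
  exact: sqr_pos_part_taylor.
by field.
Unshelve. all: by end_near. Qed.

(** The logarithm makes the derivative along the velocity of order [eta], uniformly in space,
    because the barrier itself grows at a rate proportional to its value ([dcutoff_bound]). Squaring
    the positive part gives class C^1. *)
Definition cutoff (eta : R) x : R := Num.max 0 (1 - eta * ln (barrier x)) ^+ 2.

Definition dcutoff (eta : R) v x : R :=
  - (2 * eta * Num.max 0 (1 - eta * ln (barrier x)) * (barrier x)^-1) *
  (2 * x.1 * v.1 + 2 * x.2 * v.2 - v.2 / x.2).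

Lemma is_derive_cutoff (eta : R) v x : H x ->
  is_derive x v (cutoff eta) (dcutoff eta v x).
Proof.
move=> Hx; have G1 := barrier_ge1 Hx; have G0 : 0 < barrier x by exact: lt_le_trans G1.
apply/is_derive_line.
have /is_derive_line dG := is_derive_barrier v Hx.
set DG := (X in is_derive _ _ _ X) in dG.
pose g (h : R) : R := barrier (h *: v + x).
have g0 : g 0 = barrier x by rewrite /g scale0r add0r.
have dl : is_derive (g 0) (1 : R) (@ln R) (g 0)^-1 by rewrite g0; exact: is_derive1_ln.
have dlg := @is_derive1_comp _ _ g _ _ _ dl dG.
have da : is_derive (0 : R) (1 : R) (fun h => 1 - eta * ln (g h)) (- (eta * ((g 0)^-1 * DG))).
  have h := is_deriveB (is_derive_cst (1 : R) (0 : R) (1 : R)) (is_deriveZ eta dlg).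
  by apply: (is_derive_eq h); rewrite sub0r.
have := @is_derive1_comp _ _ (fun h => 1 - eta * ln (g h)) _ _ _ (is_derive_sqr_pos_part _) da.
move=> h; apply: (is_derive_eq h).
by rewrite g0 /dcutoff -/DG; ring.
Qed.

Lemma continuous_cutoff_arg (eta : R) x : H x ->
  {for x, continuous (fun x => Num.max 0 (1 - eta * ln (barrier x)))}.
Proof.
move=> Hx; have G1 := barrier_ge1 Hx; have G0 : 0 < barrier x by exact: lt_le_trans G1.
apply: (@continuous_comp _ _ _ (fun x => 1 - eta * ln (barrier x)) (fun s => Num.max 0 s)).
  apply: cvgB; first exact: cvg_cst.
  apply: cvgM; first exact: cvg_cst.
  by apply: (continuous_comp (continuous_barrier Hx)); exact: continuous_ln.
apply: (@continuous_max _ _ (cst 0) id); [exact: cvg_cst|exact: cvg_id].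
Qed.

Lemma continuous_cutoff (eta : R) : {in H, continuous (cutoff eta)}.
Proof.
by move=> x /set_mem Hx; rewrite /cutoff; under eq_fun do rewrite expr2;
  apply: cvgM; exact: continuous_cutoff_arg.
Qed.

Lemma continuous_dcutoff (eta : R) v : {in H, continuous (dcutoff eta v)}.
Proof.
move=> x /set_mem Hx; have G1 := barrier_ge1 Hx.
have x0 : 0 < x.2 by [].
apply: cvgM.
  apply: cvgN; apply: cvgM.
    by apply: cvgM; [exact: cvg_cst|exact: continuous_cutoff_arg].
  apply: cvgV; last exact: continuous_barrier.
  by rewrite gt_eqF// (lt_le_trans ltr01).
apply: cvgB; last first.
  apply: cvgM; first exact: cvg_cst.
  by apply: cvgV; [rewrite gt_eqF|exact: continuous_snd1].
apply: cvgD; (apply: cvgM; last exact: cvg_cst); (apply: cvgM; first exact: cvg_cst).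
  exact: continuous_fst1.
exact: continuous_snd1.
Qed.

Lemma cutoff_ge0 (eta : R) x : 0 <= cutoff eta x.
Proof. exact: sqr_ge0. Qed.

Lemma cutoff_arg_le1 (eta : R) x : 0 <= eta -> H x ->
  0 <= Num.max 0 (1 - eta * ln (barrier x)) <= 1.
Proof.
move=> e0 Hx; rewrite le_max lexx/= ge_max ler01/= gerBl.
by rewrite mulr_ge0// ln_ge0// barrier_ge1.
Qed.

Lemma cutoff_le1 (eta : R) x : 0 <= eta -> H x -> cutoff eta x <= 1.
Proof. by move=> e0 Hx; have /andP[h1 h2] := cutoff_arg_le1 e0 Hx; rewrite /cutoff expr_le1. Qed.

(** Beyond [expR eta^-1] the product [eta * ln (barrier x)] is at least 1; the lower bound 2 is the
    one required by [barrier_bounds]. *)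
Definition cutoff_radius (eta : R) : R := Num.max 2 (expR eta^-1).

Lemma cutoff_eq0 (eta : R) v x : 0 < eta -> H x -> cutoff_radius eta < barrier x ->
  cutoff eta x = 0 /\ dcutoff eta v x = 0.
Proof.
move=> e0 Hx; rewrite /cutoff_radius gt_max => /andP[_ lt].
have z : Num.max 0 (1 - eta * ln (barrier x)) = 0.
  apply/max_idPl; rewrite subr_le0 -ler_pdivrMl// mulr1.
  rewrite -ler_expR lnK ?ltW// posrE; exact: (lt_trans (expR_gt0 _) lt).
by rewrite /cutoff /dcutoff z expr0n/= !mulr0 mul0r oppr0 mul0r.
Qed.

Lemma dcutoff_bound (eta kappa : R) x (u : R * R) : 0 <= eta -> H x ->
  `|u.1 * (2 * x.1) + u.2 * (2 * x.2 - x.2^-1)| <= kappa * barrier x ->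
  `|u.1 * dcutoff eta e1 x + u.2 * dcutoff eta e2 x| <= 2 * eta * kappa.
Proof.
move=> e0 Hx uk; have G1 := barrier_ge1 Hx; have G0 : 0 < barrier x by exact: lt_le_trans G1.
have /andP[m0 m1] := cutoff_arg_le1 e0 Hx.
have -> : u.1 * dcutoff eta e1 x + u.2 * dcutoff eta e2 x =
   - ((2 * eta) * (Num.max 0 (1 - eta * ln (barrier x)) *
   ((barrier x)^-1 * (u.1 * (2 * x.1) + u.2 * (2 * x.2 - x.2^-1))))).
  by rewrite /dcutoff /e1 /e2 /= !mulr1 !mulr0 mul0r; ring.
rewrite normrN normrM ger0_norm ?mulr_ge0//; apply: ler_wpM2l; first by rewrite mulr_ge0.
rewrite normrM ger0_norm// (le_trans (ler_piMl _ m1))//.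
have Gi : 0 < (barrier x)^-1 by rewrite invr_gt0.
by rewrite normrM (gtr0_norm Gi) ler_pdivrMl// (mulrC (barrier x)).
Qed.

End Cutoff.

(** * A C^1 regularization of the power of exponent q *)

Section RegularPower.
Context {R : realType}.

(* A function of class C^1 approximating [`|s| `^ q] from below. *)
Definition regpow (q k s : R) : R := s ^+ 2 * expR ((q / 2 - 1) * ln (s ^+ 2 + k)).

Definition dregpow (q k s : R) : R :=
  2 * s * expR ((q / 2 - 1) * ln (s ^+ 2 + k)) * (1 + (q / 2 - 1) * (s ^+ 2 * (s ^+ 2 + k)^-1)).

Lemma regpow_den_gt0 (k s : R) : 0 < k -> 0 < s ^+ 2 + k.
Proof. by move=> k0; rewrite ltr_wpDl// sqr_ge0. Qed.

Lemma is_derive_regpow (q k s : R) : 0 < k -> is_derive s (1 : R) (regpow q k) (dregpow q k s).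
Proof.
move=> k0; have D0 := regpow_den_gt0 s k0.
pose g (s : R) : R := s ^+ 2 + k.
have dg : is_derive s (1 : R) g (2 * s).
  by rewrite /g; apply: is_derive_eq; rewrite /GRing.scale/= addr0; ring.
have dl : is_derive (g s) (1 : R) (@ln R) (g s)^-1 by exact: is_derive1_ln.
have dlg := @is_derive1_comp _ _ g _ _ _ dl dg.
have dz := is_deriveZ (q / 2 - 1) dlg.
have de := @is_derive1_comp _ _ _ _ _ _ (is_derive_expR _) dz.
have ds : is_derive s (1 : R) (fun s : R => s ^+ 2) (2 * s).
  by apply: is_derive_eq; rewrite /GRing.scale/=; ring.
apply: (is_derive_eq (is_deriveM ds de)).
by rewrite /dregpow /g /GRing.scale/=; ring.
Qed.

Lemma continuous_regpow (q k s : R) : 0 < k -> {for s, continuous (regpow q k)}.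
Proof.
move=> k0; apply: differentiable_continuous; apply/derivable1_diffP.
exact: (@ex_derive _ _ _ _ _ _ _ (is_derive_regpow q s k0)).
Qed.

Lemma continuous_dregpow (q k s : R) : 0 < k -> {for s, continuous (dregpow q k)}.
Proof.
move=> k0; have D0 := regpow_den_gt0 s k0.
have cs : {for s, continuous (fun s : R => s ^+ 2)}.
  exact: exprn_continuous.
have cD : {for s, continuous (fun s : R => s ^+ 2 + k)} by apply: cvgD; [exact: cs|exact: cvg_cst].
have ce : {for s, continuous (fun s : R => expR ((q / 2 - 1) * ln (s ^+ 2 + k)))}.
  apply: (@continuous_comp _ _ _ (fun s : R => (q / 2 - 1) * ln (s ^+ 2 + k)) expR); last exact: continuous_expR.
  apply: cvgM; first exact: cvg_cst.
  by apply: (continuous_comp cD); exact: continuous_ln.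
apply: cvgM.
  by apply: cvgM; [apply: cvgM; [exact: cvg_cst|exact: cvg_id]|exact: ce].
apply: cvgD; first exact: cvg_cst.
apply: cvgM; first exact: cvg_cst.
by apply: cvgM; [exact: cs|apply: cvgV => //; rewrite gt_eqF].
Qed.

Lemma regpow_ge0 (q k s : R) : 0 <= regpow q k s.
Proof. by rewrite mulr_ge0 ?sqr_ge0 ?expR_ge0. Qed.

Lemma powR_sqr_exp (q s : R) : s != 0 ->
  `|s| `^ q = s ^+ 2 * expR ((q / 2 - 1) * ln (s ^+ 2)).
Proof.
move=> s0; have n0 : 0 < `|s| by rewrite normr_gt0.
have -> : s ^+ 2 = expR (2 * ln `|s|).
  by rewrite -[s ^+ 2]real_normK ?num_real// expRM_natl lnK.
rewrite expRK -expRD /powR gt_eqF//; congr expR.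
by field.
Qed.

Lemma regpow_le (q k s : R) : 1 <= q < 2 -> 0 < k -> regpow q k s <= `|s| `^ q.
Proof.
move=> /andP[q1 q2] k0; have [->|s0] := eqVneq s 0.
  by rewrite /regpow expr0n mul0r powR_ge0.
have ss : 0 < s ^+ 2 by rewrite exprn_even_gt0.
rewrite powR_sqr_exp// /regpow ler_wpM2l ?sqr_ge0// ler_expR.
rewrite ler_wnM2l//; last by rewrite ler_ln ?posrE ?lerDl ?(ltW k0)// regpow_den_gt0.
by rewrite subr_le0 ler_pdivrMr// mul1r ltW.
Qed.

Lemma cvg_regpow (q s : R) : 1 <= q -> regpow q n.+1%:R^-1 s @[n --> \oo] --> `|s| `^ q.
Proof.
move=> q1; have [->|s0] := eqVneq s 0.
  rewrite normr0 powR0; last by rewrite gt_eqF// (lt_le_trans ltr01).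
  by apply: cvg_near_cst; apply: nearW => n; rewrite /regpow expr0n mul0r.
have ss : 0 < s ^+ 2 by rewrite exprn_even_gt0.
rewrite powR_sqr_exp//; apply: cvgM; first exact: cvg_cst.
have c : s ^+ 2 + n.+1%:R^-1 @[n --> \oo] --> s ^+ 2.
  by rewrite -[X in _ --> X]addr0; apply: cvgD; [exact: cvg_cst|exact: cvg_harmonic].
have cl : ln (s ^+ 2 + n.+1%:R^-1) @[n --> \oo] --> ln (s ^+ 2).
  by apply: (continuous_cvg _ _ c); exact: continuous_ln.
apply: (@continuous_cvg _ _ _ _ _ _ expR); first exact: continuous_expR.
by apply: cvgM => //; exact: cvg_cst.
Qed.

End RegularPower.

(** * Growth of the localized and regularized L^q energy *)

Section Energy.
Context {R : realType}.
Local Notation H := (@half_plane R).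
Local Notation mu := (@leb2 R).
Local Notation T2 := (measurableTypeR R * measurableTypeR R)%type.
Implicit Types (x y z v : R * R).

Variables (q : R) (w0 : R * R -> R) (w : R -> R * R -> R).
Hypotheses (q12 : 1 <= q < 2) (sol : euler_solution q w0 w).
Variables (eta k : R).
Hypotheses (eta0 : 0 < eta) (k0 : 0 < k).

(** The margin 1 beyond the cutoff radius makes the cutoff vanish on the sides of the box [B]. *)
Let g := cutoff_radius eta + 1.
Let c := expR (- g).

Let g3 : 3 <= g.
Proof. by rewrite /g (_ : 3 = 2 + 1) ?lerD2r ?le_max ?lexx//; ring. Qed.
Let ab : - g < g. Proof. by move: g3; lra. Qed.
Let c0 : 0 < c. Proof. exact: expR_gt0. Qed.
Let cd : c < g.
Proof.
apply: (@lt_le_trans _ _ 1); last by move: g3; lra.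
by rewrite /c -[ltRHS]expR0 ltr_expR; move: g3; lra.
Qed.

Local Notation B := (box (- g) g c g).

Lemma cutoff_outside v x : H x -> ~ [/\ - g < x.1, x.1 < g, c < x.2 & x.2 < g] ->
  cutoff eta x = 0 /\ dcutoff eta v x = 0.
Proof.
move=> Hx out; apply: cutoff_eq0 => //; rewrite ltNge; apply/negP => Gx; apply: out.
have r2 : 2 <= cutoff_radius eta by rewrite le_max lexx.
have [/andP[h1 h2] h3 h4] := barrier_bounds Hx r2 Gx.
split; rewrite /g.
- by apply: lt_le_trans h1; rewrite ltrN2 ltrDl.
- by rewrite (le_lt_trans h2)// ltrDl.
- by apply: lt_le_trans h4; rewrite ltr_expR ltrN2 ltrDl.
- by rewrite (le_lt_trans h3)// ltrDl.
Qed.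

Let W (tx : R * (R * R)) := w tx.1 tx.2.
Let Wt (tx : R * (R * R)) := 'D_((1, 0) : R * (R * R)) W tx.
Let Wx v (tx : R * (R * R)) := 'D_((0, v) : R * (R * R)) W tx.

Let D := [set tx : R * (R * R) | 0 < tx.1 /\ H tx.2].

Definition energy (t : R) : R := \int[mu]_(x in B) (regpow q k (w t x) * cutoff eta x).

Let X (t : R) x := dregpow q k (w t x) * Wt (t, x) * cutoff eta x.

Let cWt (t : R) : 0 < t -> {in H, continuous (fun x => Wt (t, x))}.
Proof.
move=> t0 x /set_mem Hx; apply: (continuous_slice (t := t) (x := x)).
exact: (class_C1_continuous (v := (1, 0) : R * (R * R)) (euler_C1 sol) (conj t0 Hx : D (t, x))).
Qed.

Let cWx v (t : R) : 0 < t -> {in H, continuous (fun x => Wx v (t, x))}.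
Proof.
move=> t0 x /set_mem Hx; apply: (continuous_slice (t := t) (x := x)).
exact: (class_C1_continuous (v := (0, v) : R * (R * R)) (euler_C1 sol) (conj t0 Hx : D (t, x))).
Qed.

Let cRw (t : R) : 0 <= t -> {in H, continuous (fun x => regpow q k (w t x))}.
Proof.
move=> t0 x Hx; apply: (@continuous_comp _ _ _ (w t) (regpow q k)).
  exact: (solution_continuous sol t0 Hx).
exact: continuous_regpow.
Qed.

Let cdRw (t : R) : 0 <= t -> {in H, continuous (fun x => dregpow q k (w t x))}.
Proof.
move=> t0 x Hx; apply: (@continuous_comp _ _ _ (w t) (dregpow q k)).
  exact: (solution_continuous sol t0 Hx).
exact: continuous_dregpow.
Qed.

Let cX (t : R) : 0 < t -> {in H, continuous (X t)}.
Proof.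
move=> t0 x Hx; apply: cvgM; last exact: continuous_cutoff.
by apply: cvgM; [apply: cdRw => //; exact: ltW|exact: cWt].
Qed.

Let cE (t : R) : 0 <= t -> {in H, continuous (fun x => regpow q k (w t x) * cutoff eta x)}.
Proof. by move=> t0 x Hx; apply: cvgM; [exact: cRw|exact: continuous_cutoff]. Qed.

Let dE (t : R) x : 0 < t -> H x ->
  is_derive t (1 : R) (fun s => regpow q k (w s x) * cutoff eta x) (X t x).
Proof.
move=> t0 Hx.
have h := @is_derive1_comp _ _ (fun s => w s x) _ _ _ (is_derive_regpow q (w t x) k0) (solution_time sol t0 Hx).
have h2 := is_deriveM h (is_derive_cst (cutoff eta x) t (1 : R)).
apply: (is_derive_eq h2).
by rewrite /X /GRing.scale/= /cst mulr0 add0r /Wt; ring.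
Qed.

Let mpow (A : set T2) (t : R) : 0 <= t -> measurable A -> A `<=` H ->
  measurable_fun A (fun x => (`|w t x| `^ q)%:E).
Proof.
move=> t0 mA AH; apply/measurable_EFinP; apply: (measurableT_comp (measurable_powR _)).
apply: measurableT_comp => //; apply: (@measurable_funS _ _ _ _ (H : set T2)) => //.
  exact: measurable_half_plane.
exact: (solution_measurable sol t0).
Qed.

(** Differentiation under the integral, on a time interval bounded away from 0, where the solution
    is only assumed continuous. The dominating constant is a maximum over a compact set of
    space-time. *)
Lemma is_derive_energy (t : R) : 0 < t ->
  is_derive t (1 : R) energy (\int[mu]_(x in B) X t x).
Proof.
move=> t0.
have tI : (`](t / 2), (t + 1)[ : set R)%classic t.
  by rewrite /= in_itv/= ltrDl ltr01 andbT ltr_pdivrMr// ltr_pMr// ltr1n.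
have tpos s : (`](t / 2), (t + 1)[ : set R)%classic s -> 0 < s.
  by rewrite /= in_itv/= => /andP[h _]; apply: lt_trans h; rewrite divr_gt0.
pose K : set (R * (R * R)) := `[(t / 2), (t + 1)]%classic `*` B.
have cK : compact K by apply: compact_setX; [exact: segment_compact|exact: compact_box].
have KD (z : R * (R * R)) : K z -> D z.
  move=> [+ Bz]; rewrite /= in_itv/= => /andP[h _]; split; last exact: (box_half_plane c0 Bz).
  by apply: lt_le_trans h; rewrite divr_gt0.
pose F (z : R * (R * R)) := `|dregpow q k (W z) * Wt z * cutoff eta z.2|.
have cF : {within K, continuous F}.
  apply: continuous_in_subspaceT => z /set_mem /KD Dz.
  apply: (@continuous_comp _ _ _ (fun z : R * (R * R) => dregpow q k (W z) * Wt z * cutoff eta z.2)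
    (fun s : R => `|s|)); last exact: norm_continuous.
  apply: cvgM; last first.
    apply: (@continuous_comp _ _ _ (fun z : R * (R * R) => z.2) (cutoff eta)).
      exact: continuous_snd1.
    by apply: continuous_cutoff; apply/mem_set; exact: Dz.2.
  apply: cvgM; last exact: (class_C1_continuous (v := (1, 0) : R * (R * R)) (euler_C1 sol) Dz).
  apply: (@continuous_comp _ _ _ W (dregpow q k)); last exact: continuous_dregpow.
  exact: (euler_C1 sol).1.
have K0 : K !=set0.
  exists (t, (0, 1)); split => /=.
    by apply: subset_itv_oo_cc; exact: tI.
  have g1 : 1 <= g by apply: le_trans g3; rewrite ler1n.
  have g0 : 0 <= g := le_trans ler01 g1.
  by split; rewrite /= in_itv/= ?oppr_le0 ?g0 ?g1 ?andbT// /c -[leRHS]expR0 ler_expR oppr_le0.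
have [zm _ zM] := compact_EVT_max K0 cK cF.
have XE s x : 0 < s -> H x ->
    ((fun s => regpow q k (w s x) * cutoff eta x)^`())%classic s = X s x.
  by move=> s0 Hx; rewrite derive1E; exact: (@derive_val _ _ _ _ _ _ _ (dE s0 Hx)).
have mB := measurable_box (- g) g c g.
have Bfin := box_measure_fin ab cd.
have intf s : (`](t / 2), (t + 1)[ : set R)%classic s ->
    mu.-integrable (B : set T2) (EFin \o (fun x => regpow q k (w s x) * cutoff eta x)).
  by move=> /tpos s0; apply: (box_integrable ab c0 cd); apply: cE; exact: ltW.
have derf s x : (`](t / 2), (t + 1)[ : set R)%classic s -> B x ->
    derivable (fun s => regpow q k (w s x) * cutoff eta x) s 1.
  move=> /tpos s0 /(box_half_plane c0) Hx; exact: (@ex_derive _ _ _ _ _ _ _ (dE s0 Hx)).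
have G_ub s x : (`](t / 2), (t + 1)[ : set R)%classic s -> B x ->
    `|((fun s => regpow q k (w s x) * cutoff eta x)^`())%classic s| <= F zm.
  move=> sI Bx; rewrite XE; [|exact: tpos|exact: (box_half_plane c0 Bx)].
  apply: (zM (s, x)); apply/mem_set; split => //=.
  by apply: subset_itv_oo_cc; exact: sI.
have intG : mu.-integrable (B : set T2) (EFin \o (fun=> F zm)).
  by apply: (box_integrable ab c0 cd) => x _; exact: cvg_cst.
have G0 (x : T2) : 0 <= F zm by rewrite normr_ge0.
have dd := @derivable_under_integral _ _ _ mu (fun s x => regpow q k (w s x) * cutoff eta x)
   (B : set T2) mB t _ _ tI intf derf (fun=> F zm) G0 intG G_ub.
have de := @differentiation_under_integral _ _ _ mu (fun s x => regpow q k (w s x) * cutoff eta x)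
   (B : set T2) mB t _ _ tI intf derf (fun=> F zm) G0 intG G_ub.
apply: DeriveDef; first exact: dd.
move: de; rewrite derive1E => ->.
apply: eq_Rintegral => x /set_mem Bx.
exact: XE t0 (box_half_plane c0 Bx).
Qed.

Let isd (t : R) v x : 0 < t -> H x -> is_derive x v (fun x => regpow q k (w t x) * cutoff eta x)
  (dregpow q k (w t x) * Wx v (t, x) * cutoff eta x + regpow q k (w t x) * dcutoff eta v x).
Proof.
move=> t0 Hx.
have h1 : is_derive x v (fun x => regpow q k (w t x)) (dregpow q k (w t x) * Wx v (t, x)).
  apply/is_derive_line; have /is_derive_line h := solution_space sol v t0 Hx.
  pose f (h : R) := w t (h *: v + x).
  have f0 : w t x = f 0 by rewrite /f scale0r add0r.
  have hr := is_derive_regpow q (f 0) k0.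
  by rewrite f0; exact: (@is_derive1_comp _ _ f _ _ _ hr h).
apply: (is_derive_eq (is_deriveM h1 (is_derive_cutoff eta v Hx))).
by rewrite /GRing.scale/=; ring.
Qed.

(** By the equation, [X] is minus the transport of the test function [regpow * cutoff], whose
    integral is a weak divergence and vanishes, plus the term [Z] in which the derivative falls on
    the cutoff; the latter is of order [eta]. *)
Lemma energy_derivative_bound (t M kappa : R) : 0 < t -> 0 < M ->
  (forall x, H x -> `|w t x| <= M) ->
  (\int[mu]_(z in H) (`|w t z| `^ q)%:E <= (M `^ q)%:E)%E ->
  (forall x, H x -> `|(velocity (w t) x).1 * (2 * x.1) +
     (velocity (w t) x).2 * (2 * x.2 - x.2^-1)| <= kappa * barrier x) ->
  `|\int[mu]_(x in B) X t x| <= 2 * eta * kappa * M `^ q.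
Proof.
move=> t0 M0 wM wq wk.
pose P v x := dregpow q k (w t x) * Wx v (t, x) * cutoff eta x + regpow q k (w t x) * dcutoff eta v x.
have t0' := ltW t0.
have cP v : {in H, continuous (P v)}.
  move=> x Hx; apply: cvgD; apply: cvgM.
  - by apply: cvgM; [exact: cdRw|exact: cWx].
  - exact: continuous_cutoff.
  - exact: cRw.
  - exact: continuous_dcutoff.
have mB := measurable_box (- g) g c g.
have z1 u : 0 < u -> regpow q k (w t (- g, u)) * cutoff eta (- g, u) = 0 /\
                     regpow q k (w t (g, u)) * cutoff eta (g, u) = 0.
  move=> u0; split; rewrite (cutoff_outside 0 (x := (_, u)) _ _).1 ?mulr0//=;
    by case; rewrite ltxx.
have z2 s : regpow q k (w t (s, c)) * cutoff eta (s, c) = 0 /\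
            regpow q k (w t (s, g)) * cutoff eta (s, g) = 0.
  have g0 : 0 < g := lt_trans c0 cd.
  split; rewrite (cutoff_outside 0 (x := (s, _)) _ _).1 ?mulr0//=;
    by case; rewrite ltxx.
have [iY Y0] := velocity_weak_divergence ab c0 cd (fun x Hx => isd e1 t0 Hx) (fun x Hx => isd e2 t0 Hx)
  (cE t0') (cP e1) (cP e2) z1 z2 q12 M0 (ltW M0) (solution_measurable sol t0') wM wq.
pose Y x := velI (w t) true x * P e1 x + velI (w t) false x * P e2 x.
pose Z x := regpow q k (w t x) * ((velocity (w t) x).1 * dcutoff eta e1 x +
   (velocity (w t) x).2 * dcutoff eta e2 x).
have XE x : H x -> X t x = Z x - (2 * pi)^-1 * Y x.
  move=> Hx.
  have [Dt [D1 [D2 [h1 h2 h3 h4]]]] := solution_wd sol t0 Hx.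
  have e_t : Wt (t, x) = Dt.
    by rewrite -(@derive_val _ _ _ _ _ _ _ h1) (@derive_val _ _ _ _ _ _ _ (solution_time sol t0 Hx)).
  have e_1 : Wx e1 (t, x) = D1.
    by rewrite -(@derive_val _ _ _ _ _ _ _ h2) (@derive_val _ _ _ _ _ _ _ (solution_space sol e1 t0 Hx)).
  have e_2 : Wx e2 (t, x) = D2.
    by rewrite -(@derive_val _ _ _ _ _ _ _ h3) (@derive_val _ _ _ _ _ _ _ (solution_space sol e2 t0 Hx)).
  have {}h4 : Dt = - ((velocity (w t) x).1 * D1 + (velocity (w t) x).2 * D2).
    by apply/eqP; rewrite -addr_eq0 h4.
  by rewrite /X /Z /Y /P e_t e_1 e_2 h4 velocityE /=; ring.
have iX : mu.-integrable (B : set T2) (EFin \o X t) by apply: (box_integrable ab c0 cd); exact: cX.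
have iY' : mu.-integrable (B : set T2) (fun x => ((2 * pi)^-1)%:E * (Y x)%:E)%E.
  exact: integrableZl.
have iZ : mu.-integrable (B : set T2) (fun x => (Z x)%:E).
  apply: (@eq_integrable _ _ _ mu (B : set T2) mB _ _ _ (integrableD mB iX iY')) => x /set_mem Bx /=.
  by rewrite -EFinM -EFinD XE ?subrK//; exact: (box_half_plane c0 Bx).
have IX : (\int[mu]_(x in B) (X t x)%:E = \int[mu]_(x in B) (Z x)%:E)%E.
  transitivity (\int[mu]_(x in B) ((Z x)%:E - ((2 * pi)^-1)%:E * (Y x)%:E))%E.
    apply: eq_integral => x /set_mem Bx.
    by rewrite XE ?EFinB ?EFinM//; exact: (box_half_plane c0 Bx).
  by rewrite integralB// integralZl// Y0 mule0 sube0.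
have iR : mu.-integrable (B : set T2) (EFin \o (fun x => regpow q k (w t x))).
  by apply: (box_integrable ab c0 cd); exact: cRw.
have k0' : 0 <= 2 * eta * kappa.
  have x1 : H ((0, 1) : R * R) by rewrite /half_plane/=.
  have := le_trans (normr_ge0 _) (wk _ x1).
  rewrite pmulr_lge0 ?(lt_le_trans ltr01 (barrier_ge1 _))// => kp.
  by rewrite !mulr_ge0// ltW.
have bZ : (`|\int[mu]_(x in B) (Z x)%:E| <= (2 * eta * kappa * M `^ q)%:E)%E.
  apply: (le_trans (le_abse_integral _ _ _)) => //; first by case/integrableP: iZ.
  apply: (@le_trans _ _ (\int[mu]_(x in B) ((2 * eta * kappa)%:E * (regpow q k (w t x))%:E))%E).
    apply: ge0_le_integral => //.
    - by apply: measurableT_comp => //; case/integrableP: iZ.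
    - by apply: measurable_funeM; case/integrableP: iR.
    move=> x Bx; have Hx := box_half_plane c0 Bx.
    rewrite -EFinM abse_EFin lee_fin /Z normrM (ger0_norm (regpow_ge0 _ _ _)) mulrC.
    apply: ler_wpM2r; first exact: regpow_ge0.
    exact: dcutoff_bound (ltW eta0) Hx (wk _ Hx).
  rewrite ge0_integralZl//; last 2 first.
  - by case/integrableP: iR.
  - by move=> x _; rewrite lee_fin regpow_ge0.
  rewrite [leRHS]EFinM; apply: lee_wpmul2l; first by rewrite lee_fin.
  apply: le_trans wq.
  apply: (@le_trans _ _ (\int[mu]_(x in B) (`|w t x| `^ q)%:E)%E).
    apply: ge0_le_integral => //.
    - by move=> x _; rewrite lee_fin regpow_ge0.
    - by case/integrableP: iR.
    - by apply: mpow => //; exact: box_half_plane.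
    - by move=> x _; rewrite lee_fin; exact: regpow_le.
  apply: ge0_subset_integral => //.
  - exact: measurable_half_plane.
  - by apply: mpow => //; exact: measurable_half_plane.
  - exact: box_half_plane.
rewrite -lee_fin -abse_EFin /Rintegral fineK; first by rewrite IX.
exact: integrable_fin_num.
Qed.

Lemma energyE (t : R) : 0 <= t ->
  (energy t)%:E = (\int[mu]_(x in H) (regpow q k (w t x) * cutoff eta x)%:E)%E.
Proof.
move=> t0; have mB := measurable_box (- g) g c g.
rewrite /energy /Rintegral fineK; last first.
  apply: integrable_fin_num => //; by apply: (box_integrable ab c0 cd); exact: cE.
rewrite integral_mkcond [RHS]integral_mkcond; apply: eq_integral => x _.
rewrite !patchE; case: ifPn => xB.
  by have Hx := box_half_plane c0 (set_mem xB); rewrite (mem_set Hx).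
case: ifPn => // /set_mem Hx; rewrite (cutoff_outside 0 Hx _).1 ?mulr0// => -[h1 h2 h3 h4].
by move/negP: xB; apply; apply/mem_set; split; rewrite /= in_itv/= !ltW.
Qed.

Lemma energy_le (t : R) : 0 <= t ->
  ((energy t)%:E <= \int[mu]_(x in H) (`|w t x| `^ q)%:E)%E.
Proof.
move=> t0; rewrite energyE//.
have mH := measurable_half_plane : measurable (H : set T2).
have mw := solution_measurable sol t0.
apply: ge0_le_integral => //.
- by move=> x _; rewrite lee_fin mulr_ge0 ?regpow_ge0 ?cutoff_ge0.
- apply/measurable_EFinP; apply: continuous_measurable2; first exact: half_plane_open.
  exact: cE.
- exact: mpow.
move=> x Hx; rewrite lee_fin (le_trans _ (regpow_le (w t x) q12 k0))//.
by rewrite ler_piMr ?regpow_ge0// cutoff_le1// ltW.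
Qed.

Lemma cvg_solution0 (s : nat -> R) x : (forall n, 0 <= s n) -> s n @[n --> \oo] --> 0 ->
  H x -> w (s n) x @[n --> \oo] --> w 0 x.
Proof.
move=> s0 cs Hx.
have cw := cvg_solution (euler_cont sol) (z := (0, x)) (lexx 0) Hx.
apply: (@cvg_comp _ _ _ (fun n => (s n, x)) (fun tx : R * (R * R) => w tx.1 tx.2) _ _ _ _ cw).
move=> P; rewrite /within/= => hP.
have hP' : nbhs ((0, x) : R * (R * R)) (fun z : R * (R * R) => 0 <= z.1 /\ H z.2 -> P z) := hP.
have cp : ((s n, x) : R * (R * R)) @[n --> \oo] --> ((0, x) : R * (R * R)).
  exact: (cvg_pair cs (cvg_cst x)).
have K : \forall n \near \oo, 0 <= s n /\ H x -> P (s n, x) := cp _ hP'.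
by apply: filterS K => n; apply.
Qed.

(** The energy is differentiated at positive times only; its value at 0 is reached along the times
    [t / (n + 2)], all smaller than [t]. *)
Lemma cvg_energy0 (t M : R) : 0 < t ->
  (forall s x, 0 <= s <= t -> H x -> `|w s x| <= M) ->
  energy (t * n.+2%:R^-1) @[n --> \oo] --> energy 0.
Proof.
move=> t0 wM; have mB := measurable_box (- g) g c g.
pose s (n : nat) : R := t * n.+2%:R^-1.
have s0 n : 0 < s n by rewrite mulr_gt0// invr_gt0.
have st n : 0 <= s n <= t.
  by rewrite (ltW (s0 n))/= ler_piMr ?(ltW t0)// invf_le1// ler1n.
have cs : s n @[n --> \oo] --> 0.
  rewrite -(mulr0 t); apply: cvgM; first exact: cvg_cst.
  by have := @cvg_harmonic R; rewrite -cvg_shiftS.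
have M0 : 0 <= M.
  have x1 : H ((0, 1) : R * R) by rewrite /half_plane/=.
  have t0' : 0 <= (0 : R) <= t by rewrite lexx ltW.
  exact: le_trans (normr_ge0 _) (wM 0 _ t0' x1).
have q0 : 0 <= q by case/andP: q12 => + _; apply: le_trans.
apply: fine_cvg; rewrite fineK; last first.
  by apply: integrable_fin_num => //; apply: (box_integrable ab c0 cd); exact: cE.
have [] := @dominated_convergence _ _ _ mu (B : set T2) mB
  (fun n x => (regpow q k (w (s n) x) * cutoff eta x)%:E)
  (fun x => (regpow q k (w 0 x) * cutoff eta x)%:E) (fun=> (M `^ q)%:E).
- move=> n; have := box_integrable ab c0 cd (cE (ltW (s0 n))); by case/integrableP.
- have := box_integrable ab c0 cd (cE (lexx 0)); by case/integrableP.
- apply: aeW => x Bx; have Hx := box_half_plane c0 Bx.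
  apply: cvg_EFin; first exact: nearW.
  apply: cvgM; last exact: cvg_cst.
  apply: (@continuous_cvg _ _ _ _ _ _ (regpow q k)); first exact: continuous_regpow.
  by apply: cvg_solution0 => // n; exact: ltW.
- by apply: (@box_integrable _ _ _ _ _ ab c0 cd (fun=> M `^ q)) => x _; exact: cvg_cst.
- apply: aeW => x n Bx; have Hx := box_half_plane c0 Bx.
  have e0 := mulr_ge0 (regpow_ge0 q k (w (s n) x)) (cutoff_ge0 eta x).
  rewrite abse_EFin lee_fin (ger0_norm e0).
  apply: (@le_trans _ _ (regpow q k (w (s n) x))).
    by rewrite ler_piMr ?regpow_ge0// cutoff_le1// ltW.
  rewrite (le_trans (regpow_le _ q12 k0))// ge0_ler_powR ?nnegrE//.
  exact: wM.
by move=> _ _; exact.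
Qed.

Lemma energy_growth (t M kappa : R) : 0 < t -> 0 < M ->
  (forall s x, 0 <= s <= t -> H x -> `|w s x| <= M) ->
  (forall s, 0 <= s <= t -> (\int[mu]_(z in H) (`|w s z| `^ q)%:E <= (M `^ q)%:E)%E) ->
  (forall s x, 0 <= s <= t -> H x -> `|(velocity (w s) x).1 * (2 * x.1) +
     (velocity (w s) x).2 * (2 * x.2 - x.2^-1)| <= kappa * barrier x) ->
  energy t <= energy 0 + 2 * eta * kappa * M `^ q * t.
Proof.
move=> t0 M0 wM wq wk; set A := 2 * eta * kappa * M `^ q.
have A0 : 0 <= A.
  by apply: le_trans (energy_derivative_bound t0 M0 (fun x => wM t x _) (wq t _) (fun x => wk t x _));
    rewrite ?normr_ge0// ltW//=.
rewrite -lerBlDr.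
have ce := cvg_energy0 t0 wM.
rewrite -(cvg_lim _ ce)//; apply: limr_ge; first by apply/cvg_ex; exists (energy 0).
apply: nearW => n; set s := t * n.+2%:R^-1.
have s0 : 0 < s by rewrite mulr_gt0// invr_gt0.
have st : s < t by rewrite gtr_pMr// invf_lt1// ltr1n.
have dd r : r \in `]s, t[ -> is_derive r (1 : R) energy (\int[mu]_(x in B) X r x).
  by rewrite in_itv/= => /andP[sr _]; apply: is_derive_energy; exact: lt_trans sr.
have cc : {within `[s, t], continuous energy}.
  apply: derivable_within_continuous => r; rewrite in_itv/= => /andP[sr _].
  exact: (@ex_derive _ _ _ _ _ _ _ (is_derive_energy (lt_le_trans s0 sr))).
have [r rst e] := MVT st dd cc.
move: rst; rewrite in_itv/= => /andP[sr rt].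
have r0 : 0 < r := lt_trans s0 sr.
have rt' : 0 <= r <= t by rewrite !ltW.
have b := energy_derivative_bound r0 M0 (fun x => wM r x rt') (wq r rt') (fun x => wk r x rt').
have : energy t - energy s <= A * t.
  rewrite e; apply: (@le_trans _ _ (A * (t - s))).
    by rewrite ler_wpM2r ?subr_ge0 ?(ltW st)// (le_trans (ler_norm _)).
  by rewrite ler_wpM2l// gerBl ltW.
by rewrite lerBlDr addrC -lerBlDr.
Qed.

End Energy.

Section LqDecay.
Context {R : realType}.
Local Notation H := (@half_plane R).
Local Notation mu := (@leb2 R).
Local Notation T2 := (measurableTypeR R * measurableTypeR R)%type.

(** The cutoff parameter [eta] and the regularization [k] tend to 0 together. The constants [M] and
    [kappa] depend on neither of them, so the error term disappears in the limit; Fatou's lemma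
    handles the energy at time [t]. *)
Lemma solution_Lq (q : R) (w0 : R * R -> R) (w : R -> R * R -> R) (t : R) :
  1 <= q < 2 -> euler_solution q w0 w -> 0 <= t ->
  (\int[mu]_(x in H) (`|w t x| `^ q)%:E <= \int[mu]_(x in H) (`|w0 x| `^ q)%:E)%E.
Proof.
move=> q12 sol t0.
have w0E : (\int[mu]_(x in H) (`|w0 x| `^ q)%:E = \int[mu]_(x in H) (`|w 0 x| `^ q)%:E)%E.
  by apply: eq_integral => x /set_mem Hx; rewrite (euler_init sol Hx).
rewrite w0E.
have [->//|tn0] := eqVneq t 0.
have {tn0}tp : 0 < t by rewrite lt_neqAle eq_sym tn0.
have mH := measurable_half_plane : measurable (H : set T2).
have [M M0 hM] := solution_bounds q12 sol t.
have [kappa k0 hk] := solution_kappa q12 sol t.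
pose e (n : nat) : R := n.+1%:R^-1.
have e0 n : 0 < e n by rewrite invr_gt0.
have e_cvg : e n @[n --> \oo] --> 0 by exact: cvg_harmonic.
pose F n x := (regpow q (e n) (w t x) * cutoff (e n) x)%:E.
set I0 := (X in (_ <= X)%E).
have FI n : (\int[mu]_(x in H) F n x <= I0 + (2 * e n * kappa * M `^ q * t)%:E)%E.
  rewrite /F -(energyE sol (e0 n) (e0 n) t0).
  apply: (@le_trans _ _ (energy q w (e n) (e n) 0 + 2 * e n * kappa * M `^ q * t)%:E).
    rewrite lee_fin; apply: (energy_growth q12 sol) => //.
    - by move=> s x st Hx; have [+ _] := hM s st; exact.
    - by move=> s st; have [] := hM s st.
  rewrite [leLHS]EFinD; apply: leeD2r; exact: (energy_le q12 sol (e0 n) (e0 n) (lexx 0)).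
have mF n : measurable_fun (H : set T2) (F n).
  apply/measurable_EFinP; apply: continuous_measurable2; first exact: half_plane_open.
  move=> x Hx; apply: cvgM; last exact: continuous_cutoff.
  apply: (@continuous_comp _ _ _ (w t) (regpow q (e n))).
    exact: (solution_continuous sol t0 Hx).
  exact: continuous_regpow.
have F0 n x : H x -> (0 <= F n x)%E.
  by move=> _; rewrite lee_fin mulr_ge0 ?regpow_ge0 ?cutoff_ge0.
have FL x : H x -> F n x @[n --> \oo] --> (`|w t x| `^ q)%:E.
  move=> Hx; apply: cvg_EFin; first exact: nearW.
  rewrite -[X in _ --> X]mulr1; apply: cvgM; first by apply: cvg_regpow; case/andP: q12.
  rewrite (_ : 1 = Num.max 0 (1 - 0 * ln (barrier x)) ^+ 2 :> R); last first.
    by rewrite mul0r subr0 (max_idPr _) ?expr1n.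
  apply: (@continuous_cvg _ _ _ _ _ _ (fun s : R => Num.max 0 s ^+ 2)).
    apply: differentiable_continuous; apply/derivable1_diffP.
    exact: (@ex_derive _ _ _ _ _ _ _ (is_derive_sqr_pos_part _)).
  apply: cvgB; first exact: cvg_cst.
  by apply: cvgM => //; exact: cvg_cst.
have Fl : (\int[mu]_(x in H) (`|w t x| `^ q)%:E = \int[mu]_(x in H) limn_einf (F^~ x))%E.
  apply: eq_integral => x /set_mem Hx; rewrite is_cvg_limn_einfE; last first.
    by apply/cvg_ex; eexists; exact: FL.
  by apply/esym/cvg_lim => //; exact: FL.
have t00 : 0 <= (0 : R) <= t by rewrite lexx ltW.
have I0fin : I0 \is a fin_num.
  rewrite ge0_fin_numE; last by apply: integral_ge0 => x _; rewrite lee_fin powR_ge0.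
  by apply: le_lt_trans (hM 0 t00).2 _; exact: ltry.
have cR : (I0 + (2 * e n * kappa * M `^ q * t)%:E)%E @[n --> \oo] --> I0.
  rewrite -(fineK I0fin); under eq_fun do rewrite -EFinD.
  apply: cvg_EFin; first exact: nearW.
  rewrite -[X in _ --> X]addr0; apply: cvgD; first exact: cvg_cst.
  rewrite (_ : 0 = 2 * 0 * kappa * M `^ q * t :> R); last by rewrite mulr0 !mul0r.
  do 3 (apply: cvgM; last exact: cvg_cst).
  by apply: cvgM => //; exact: cvg_cst.
rewrite Fl; apply: (le_trans (fatou _ mH mF F0)).
rewrite limn_einf_lim -(cvg_lim _ cR)//; apply: lee_lim; [exact: is_cvg_einfs|by apply/cvg_ex; exists I0|].
apply: nearW => n; apply: le_trans (FI n).
by apply: ereal_inf_lbound; exists n => //=.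
Qed.

End LqDecay.

(** * Propagation of the modulus of continuity *)

Lemma vel_const_gt0 (R : realType) (q : R) : 1 <= q < 2 -> 0 < vel_const q.
Proof.
move=> q12; have f1 := far_const_ge1 q12; have p0 := @pi_gt0 R.
by rewrite /vel_const; move: f1 p0; lra.
Qed.

Lemma sqr_sdist (R : realType) (e : R) (x y : R * R) : sdist e x y ^+ 2 = len (x - y) ^+ 2 + e ^+ 2.
Proof. by rewrite sqr_sqrtr// addr_ge0// sqr_ge0. Qed.

Lemma le_sdist (R : realType) (e : R) (x y : R * R) : 0 < e -> e <= sdist e x y.
Proof.
move=> e0; rewrite -(@ler_pXn2r _ 2) ?nnegrE ?(ltW e0) ?(ltW (sdist_gt0 _ _ e0))//.
by rewrite sqr_sdist lerDr sqr_ge0.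
Qed.

Lemma sdist_le (R : realType) (e : R) (x y : R * R) : 0 < e -> sdist e x y <= len (x - y) + e.
Proof.
move=> e0; have l0 := len_ge0 (x - y).
rewrite -(@ler_pXn2r _ 2) ?nnegrE ?addr_ge0 ?(ltW e0) ?(ltW (sdist_gt0 _ _ e0))//.
by rewrite sqr_sdist sqrrD lerD2r lerDl mulrn_wge0// mulr_ge0// ltW.
Qed.

Section Modulus.
Context {R : realType}.
Local Notation H := (@half_plane R).
Local Notation mu := (@leb2 R).
Implicit Types (x y z : R * R).

Variables (q : R) (w0 : R * R -> R) (w : R -> R * R -> R).
Hypotheses (q12 : 1 <= q < 2) (sol : euler_solution q w0 w).
Variables (m N G0 : R).
Hypotheses (m0 : 0 < m) (N0 : 0 < N) (G00 : 0 <= G0).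
Hypothesis w0m : forall x, H x -> `|w0 x| <= m.
Hypothesis w0N : (\int[mu]_(x in H) (`|w0 x| `^ q)%:E <= (N `^ q)%:E)%E.
Hypothesis w0L : forall x y, H x -> H y -> `|w0 x - w0 y| <= G0 * len (x - y).

Let c1 := vel_const q * (m + N).

Let c1_gt0 : 0 < c1.
Proof. by apply: mulr_gt0; [exact: vel_const_gt0|exact: addr_gt0]. Qed.

Definition speed_modulus (l : R) : R := c1 * (1 + ln (3 + l / m)).

Lemma velocity_modulus (t e l : R) x y : 0 <= t -> 0 < e -> 0 <= l -> H x -> H y ->
  (forall z, H z -> `|w t z - w t x| <= l * sdist e z x) ->
  len (velocity (w t) x - velocity (w t) y) <= speed_modulus l * sdist e x y.
Proof.
move=> t0 e0 l0 Hx Hy mod.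
have wm z : H z -> `|w t z| <= m by move=> Hz; exact: (solution_sup q12 sol w0m t0 Hz).
have wN := le_trans (solution_Lq q12 sol t0) w0N.
have b i := velI_lip q12 N0 (ltW m0) (solution_measurable sol t0) wm wN i m0 e0 l0 Hx Hy mod.
have bE i : `|velI (w t) i x - velI (w t) i y| <= speed_modulus l * sdist e x y by exact: b.
have p0 := @pi_gt0 R.
(* The length is bounded by the sum of the two components; since [1 / pi <= 1] this leaves the
   constant unchanged. *)
have pE : (2 * pi : R)^-1 + (2 * pi)^-1 <= 1.
  have h : (2 * pi : R)^-1 <= 2^-1.
    rewrite lef_pV2 ?posrE ?mulr_gt0// ler_peMr//.
    by apply: le_trans (@pi_ge2 R); rewrite ler1n.
  by move: h; lra.
have pi0 : 0 <= (2 * pi : R)^-1 by rewrite invr_ge0 mulr_ge0// ltW.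
rewrite !velocityE (le_trans (len_le_sum _))//=.
rewrite -!mulrBr !normrM (ger0_norm pi0).
apply: (le_trans (lerD (ler_wpM2l pi0 (bE true)) (ler_wpM2l pi0 (bE false)))).
by rewrite -mulrDl ler_piMl// (le_trans (normr_ge0 _) (bE true)).
Qed.

Lemma modulus_step (e l b t0 t1 : R) : 0 <= t0 -> t0 <= t1 -> 0 < e -> 0 <= l ->
  (forall t x y, t0 < t <= t1 -> H x -> H y ->
     len (velocity (w t) x - velocity (w t) y) <= b * sdist e x y) ->
  (forall x y, H x -> H y -> `|w t0 x - w t0 y| <= l * sdist e x y) ->
  forall t x y, t0 <= t <= t1 -> H x -> H y ->
    `|w t x - w t y| <= l * expR (b * (t - t0)) * sdist e x y.
Proof.
move=> t00 t01 e0 l0 ub wl.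
have [kappa k0 hk] := solution_kappa q12 sol t1.
have cmp t x y : t0 <= t <= t1 -> H x -> H y -> w t x - w t y <= l * expR (b * (t - t0)) * sdist e x y.
  move=> tt Hx Hy.
  have := @comparison R w (fun t => velocity (w t)) (euler_cont sol) (solution_wd sol)
    1 1 0 l b kappa m e t0 t1 t00 e0 l0 k0 _ _ _ _ t x y tt Hx Hy.
  rewrite !mul1r subr0; apply.
  - move=> s z /andP[s0 _] Hz; apply: (solution_sup q12 sol w0m _ Hz); exact: le_trans s0.
  - move=> s z /andP[s0 s1] Hz; apply: hk => //.
    by rewrite s1 andbT ltW// (le_lt_trans t00).
  - by move=> s z z' st Hz Hz'; rewrite ler_wpM2l// ub.
  - by move=> z z' Hz Hz'; rewrite !mul1r subr0 (le_trans (ler_norm _))// wl.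
move=> t x y tt Hx Hy; rewrite ler_norml cmp// andbT lerNl opprB.
by rewrite sdistC cmp.
Qed.

(** The solution of [A' = 2 * c1 * A] with initial value [1 + ln (3 + G0 / m)]; [lipmod] is the
    modulus for which [A] is the logarithmic quantity ([logmodE]). *)
Definition logmod (t : R) : R := (1 + ln (3 + G0 / m)) * expR (2 * c1 * t).
Definition lipmod (t : R) : R := m * (expR (logmod t - 1) - 3).

Let ln3 (s : R) : 0 <= s -> 0 <= ln (3 + s).
Proof. by move=> s0; rewrite ln_ge0//; move: s0; lra. Qed.

Let G0m : 0 <= G0 / m. Proof. by rewrite divr_ge0// ltW. Qed.

Lemma logmod0_le (t : R) : 0 <= t -> 1 + ln (3 + G0 / m) <= logmod t.
Proof.
move=> t0; rewrite /logmod ler_peMr ?addr_ge0 ?ln3//.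
rewrite -[leLHS]expR0 ler_expR; apply: mulr_ge0 => //.
by apply: mulr_ge0 => //; exact: ltW c1_gt0.
Qed.

Lemma lipmod_ge (t : R) : 0 <= t -> G0 <= lipmod t.
Proof.
move=> t0; rewrite /lipmod -ler_pdivrMl// mulrC lerBrDl.
have p : 0 < 3 + G0 / m by rewrite ltr_pwDl.
by rewrite -[leLHS]lnK ?posrE// ler_expR lerBrDl logmod0_le.
Qed.

Lemma lipmod_ge0 (t : R) : 0 <= t -> 0 <= lipmod t.
Proof. by move=> t0; rewrite (le_trans G00)// lipmod_ge. Qed.

Lemma lipmod0 : lipmod 0 = G0.
Proof.
rewrite /lipmod /logmod mulr0 expR0 mulr1 addrAC subrr add0r lnK; last first.
  by rewrite posrE ltr_pwDl.
by field; rewrite gt_eqF.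
Qed.

Lemma logmodE (t : R) : 1 + ln (3 + lipmod t / m) = logmod t.
Proof.
have -> : 3 + lipmod t / m = expR (logmod t - 1).
  by rewrite /lipmod; field; rewrite gt_eqF.
by rewrite expRK; ring.
Qed.

(** Freezing the rate at the beginning of a step gives less than the exponential, by
    [1 + z <= expR z]. Hence steps of any length compose without loss, which keeps the final bound
    independent of [e]. *)
Lemma lipmod_grow (s t : R) : 0 <= s -> s <= t ->
  lipmod s * expR (2 * c1 * logmod s * (t - s)) <= lipmod t.
Proof.
move=> s0 st; rewrite /lipmod -mulrA ler_wpM2l ?(ltW m0)//.
set d := 2 * c1 * logmod s * (t - s).
have a0 : 0 <= logmod s by apply: le_trans (logmod0_le s0); rewrite addr_ge0// ln3.
have k0 : 0 <= 2 * c1 by apply: mulr_ge0 => //; exact: ltW.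
have ts : 0 <= t - s by rewrite subr_ge0.
have d0 : 0 <= d by apply: mulr_ge0 => //; exact: mulr_ge0.
have h : logmod s + d <= logmod t.
  have -> : logmod t = logmod s * expR (2 * c1 * (t - s)).
    have tE : 2 * c1 * t = 2 * c1 * s + 2 * c1 * (t - s) by ring.
    by rewrite /logmod tE expRD mulrA.
  rewrite /d (_ : logmod s + _ = logmod s * (1 + 2 * c1 * (t - s))); last by ring.
  by rewrite ler_wpM2l// expR_ge1Dx.
have e1 : 1 <= expR d by rewrite -[leLHS]expR0 ler_expR.
rewrite mulrBl -expRD; apply: lerB; last by rewrite ler_peMr.
by rewrite ler_expR addrAC lerD2r.
Qed.

(** A modulus larger by the factor [expR 1] adds at most 1 to the logarithm; as [1 + ln (3 + l / m)]
    is at least 1, this is the origin of the factor 2 in [logmod]. *)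
Lemma speed_modulus_expR1 (l : R) : 0 <= l ->
  speed_modulus (l * expR 1) <= 2 * c1 * (1 + ln (3 + l / m)).
Proof.
move=> l0; have lm : 0 <= l / m by rewrite divr_ge0// ltW.
have -> : 2 * c1 * (1 + ln (3 + l / m)) = c1 * (2 * (1 + ln (3 + l / m))) by ring.
apply: ler_wpM2l; first exact: ltW c1_gt0.
have e1 : 1 <= expR 1 :> R by rewrite -[leLHS]expR0 ler_expR.
have h : ln (3 + l * expR 1 / m) <= 1 + ln (3 + l / m).
  have p : 0 < 3 + l / m by rewrite ltr_pwDl.
  have p' : 0 < 3 + l * expR 1 / m.
    by rewrite ltr_pwDl// divr_ge0 ?mulr_ge0 ?expR_ge0 ?(ltW m0).
  have -> : 1 + ln (3 + l / m) = ln (expR 1 * (3 + l / m)).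
    by rewrite lnM ?posrE ?expR_gt0// expRK.
  rewrite ler_ln ?posrE ?mulr_gt0 ?expR_gt0//.
  by rewrite mulrDr mulrAC (mulrC (l / m)) lerD2r ler_peMl.
by have := ln3 lm; move: h; lra.
Qed.

Lemma speed_modulus_ge0 (l : R) : 0 <= l -> 0 < speed_modulus l.
Proof.
move=> l0; apply: mulr_gt0; first exact: c1_gt0.
by apply: ltr_pwDl => //; apply: ln3; rewrite divr_ge0// ltW.
Qed.

Lemma solution_modulus (e t : R) x y : 0 < e -> 0 <= t -> H x -> H y ->
  `|w t x - w t y| <= lipmod t * sdist e x y.
Proof.
move=> e0 t0 Hx Hy.
(* This rate is valid at all times, so the step [h] never shrinks and finitely many steps reach
   [t]. *)
pose b := speed_modulus (2 * m / e).
have S0 : 0 <= 2 * m / e by rewrite divr_ge0 ?mulr_ge0// ltW.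
have b0 : 0 < b by exact: speed_modulus_ge0.
pose h := b^-1; have h0 : 0 < h by rewrite invr_gt0.
have rough s z z' : 0 <= s -> H z -> H z' ->
    len (velocity (w s) z - velocity (w s) z') <= b * sdist e z z'.
  move=> s0 Hz Hz'; apply: velocity_modulus => // z2 Hz2.
  have m1 := solution_sup q12 sol w0m s0 Hz; have m2 := solution_sup q12 sol w0m s0 Hz2.
  apply: (@le_trans _ _ (2 * m / e * e)).
    rewrite divfK ?gt_eqF// (le_trans (ler_normB _ _))// mulr_natl mulr2n lerD//.
  by rewrite ler_wpM2l// le_sdist.
have [k tk] : exists k : nat, t <= k%:R * h.
  exists (Num.truncn (t / h)).+1.
  by rewrite -ler_pdivrMr// ltW// truncnS_gt// divr_ge0// ltW.
elim: k t x y t0 Hx Hy tk => [|k IH] t x y t0 Hx Hy tk.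
  have -> : t = 0 by apply/eqP; rewrite eq_le t0 andbT (le_trans tk)// mul0r.
  rewrite !(euler_init sol)// lipmod0 (le_trans (w0L Hx Hy))//.
  by rewrite ler_wpM2l// len_le_sdist.
have [tk'|kt] := leP t (k%:R * h); first exact: IH.
pose s : R := k%:R * h.
have s0 : 0 <= s by rewrite mulr_ge0// ltW.
have st : s <= t by exact: ltW.
have l0 := lipmod_ge0 s0.
have mods z z' : H z -> H z' -> `|w s z - w s z'| <= lipmod s * sdist e z z'.
  by move=> Hz Hz'; exact: (IH s z z' s0 Hz Hz' (lexx _)).
(* At rate [b] a step of length [b^-1] multiplies the modulus by at most [expR 1]. *)
have modr r z z' : s <= r <= t -> H z -> H z' ->
    `|w r z - w r z'| <= lipmod s * expR 1 * sdist e z z'.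
  move=> /andP[sr rt] Hz Hz'.
  have ub r' u u' : s < r' <= t -> H u -> H u' -> len (velocity (w r') u - velocity (w r') u') <= b * sdist e u u'.
    by move=> /andP[r1 _] Hu Hu'; apply: rough => //; rewrite ltW// (le_lt_trans s0).
  have := modulus_step s0 st e0 l0 ub mods (t := r) (x := z) (y := z').
  rewrite sr rt => /(_ isT Hz Hz') /le_trans; apply.
  rewrite ler_wpM2r ?(ltW (sdist_gt0 _ _ e0))// ler_wpM2l// ler_expR.
  rewrite -ler_pdivlMl// mulr1 -/h lerBlDl (le_trans rt)// (le_trans tk)//.
  by rewrite -natr1 mulrDl mul1r.
(* The crude modulus serves only to bound the speed; the step is then redone from [lipmod s] at the
   rate [b'], which no longer depends on [e]. *)
pose b' := speed_modulus (lipmod s * expR 1).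
have ub r u u' : s < r <= t -> H u -> H u' -> len (velocity (w r) u - velocity (w r) u') <= b' * sdist e u u'.
  move=> /andP[r1 r2] Hu Hu'; apply: velocity_modulus => //.
  - by rewrite ltW// (le_lt_trans s0).
  - by rewrite mulr_ge0// expR_ge0.
  - by move=> z Hz; apply: modr => //; rewrite (ltW r1).
have := modulus_step s0 st e0 l0 ub mods (t := t) (x := x) (y := y).
rewrite st lexx => /(_ isT Hx Hy) /le_trans; apply.
rewrite ler_wpM2r ?(ltW (sdist_gt0 _ _ e0))//.
apply: le_trans (lipmod_grow s0 st); rewrite ler_wpM2l// ler_expR.
by rewrite ler_wpM2r ?subr_ge0// -logmodE speed_modulus_expR1.
Qed.

Lemma solution_lipschitz (t : R) x y : 0 <= t -> H x -> H y ->
  `|w t x - w t y| <= lipmod t * len (x - y).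
Proof.
move=> t0 Hx Hy; have l0 := lipmod_ge0 t0.
apply/ler_addgt0Pr => d d0.
pose e := d / (lipmod t + 1).
have e0 : 0 < e by rewrite divr_gt0// ltr_wpDl.
apply: (le_trans (solution_modulus e0 t0 Hx Hy)).
apply: (@le_trans _ _ (lipmod t * (len (x - y) + e))).
  by rewrite ler_wpM2l// sdist_le.
rewrite mulrDr lerD2l /e mulrCA ler_piMr ?(ltW d0)// ler_pdivrMr ?ltr_wpDl//.
by rewrite mul1r lerDl.
Qed.

End Modulus.

(** * Extended real norms and the final estimate *)

Section Final.
Context {R : realType}.
Local Notation H := (@half_plane R).

Lemma normLp_eq p (f g : R * R -> R) : (forall x, H x -> f x = g x) -> normLp p f = normLp p g.
Proof.
move=> fg; rewrite /normLp; congr (Lnorm _ _ _); apply/funext => x /=.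
by rewrite !patchE; case: ifPn => // /set_mem /fg ->.
Qed.

Lemma grad_length_eq (f g : R * R -> R) x : (forall x, H x -> f x = g x) -> H x ->
  grad_length f x = grad_length g x.
Proof.
move=> fg Hx.
have e v : 'D_v f x = 'D_v g x.
  apply: near_eq_derive.
  have : \forall y \near x, H y by apply: open_nbhs_nbhs; split => //; exact: half_plane_open.
  by apply: filterS => y; exact: fg.
by rewrite /grad_length /partial1 /partial2 !e.
Qed.

Lemma continuous_grad_length (f : R * R -> R) x : class_C 1 H f -> H x ->
  {for x, continuous (grad_length f)}.
Proof.
move=> fC Hx.
apply: (@continuous_comp _ _ _ (fun x => partial1 f x ^+ 2 + partial2 f x ^+ 2) Num.sqrt);
  last exact: sqrt_continuous.
apply: cvgD.
  apply: (@continuous_comp _ _ _ (partial1 f) (fun s : R => s ^+ 2)); last exact: exprn_continuous.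
  exact: class_C1_continuous fC Hx.
apply: (@continuous_comp _ _ _ (partial2 f) (fun s : R => s ^+ 2)); last exact: exprn_continuous.
exact: class_C1_continuous fC Hx.
Qed.

End Final.

Lemma lne_ratioE (R : realType) (m g : R) : 0 < m -> 0 <= g ->
  (1 + lne (3%:E + g%:E / m%:E))%E = (1 + ln (3 + g / m))%:E.
Proof.
move=> m0 g0; have p : 0 < 3 + g / m by rewrite ltr_pwDl// divr_ge0// ltW.
by rewrite inver gt_eqF// -EFinM -EFinD lne_EFin.
Qed.

Theorem proposition5p3 (R : realType) (q : R) (hq : 1 <= q < 2) :
  exists C : R, 0 < C /\
    forall (w0 : R * R -> R) (w : R -> R * R -> R),
      smooth_on half_plane w0 -> euler_solution q w0 w ->
      forall t : R, 0 <= t ->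
      (1 + lne (3%:E + normLp +oo (grad_length (w t)) / normLp +oo w0)
       <= (1 + lne (3%:E + normLp +oo (grad_length w0) / normLp +oo w0))
          * expeR (C%:E * (normLp +oo w0 + normLp q%:E w0) * t%:E))%E.
Proof.
have vc := vel_const_gt0 hq.
(* 4 = 2 * 2: one factor 2 is that of [logmod], the other comes from [m + N = 2 * m + n], with
   [N = m + n] below. *)
exists (4 * vel_const q); split; first by rewrite mulr_gt0.
move=> w0 w w0S sol t t0.
have w0C : class_C 1 half_plane w0 by exact: w0S.
have w0E x : half_plane x -> w 0 x = w0 x by exact: (euler_init sol).
have cw0 x : half_plane x -> {for x, continuous w0} by exact: w0C.1.
have [M /(_ 0)] := euler_bounded sol 0.
rewrite lexx => /(_ isT) [].
rewrite (normLp_eq +oo w0E) (normLp_eq q%:E w0E) => Mo Mq.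
have mfin : normLp +oo w0 \is a fin_num.
  by rewrite ge0_fin_numE ?normLp_ge0// (le_lt_trans Mo)// ltry.
have nfin : normLp q%:E w0 \is a fin_num.
  by rewrite ge0_fin_numE ?normLp_ge0// (le_lt_trans Mq)// ltry.
pose m := fine (normLp +oo w0); pose n := fine (normLp q%:E w0).
have mE : normLp +oo w0 = m%:E by rewrite fineK.
have nE : normLp q%:E w0 = n%:E by rewrite fineK.
have m0 : 0 <= m by rewrite -lee_fin -mE normLp_ge0.
have n0 : 0 <= n by rewrite -lee_fin -nE normLp_ge0.
have w0m x : half_plane x -> `|w0 x| <= m.
  by move=> Hx; rewrite -lee_fin -mE; apply: le_normLp_oo => //; exact: cw0.
have g0 (f : R * R -> R) : (0 <= normLp +oo (grad_length f))%E by exact: normLp_ge0.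
rewrite mE nE -EFinD -!EFinM [expeR _]/=.
set E := expR _.
have E1 : 1 <= E.
  rewrite /E -[leLHS]expR0 ler_expR; apply: mulr_ge0 => //.
  by apply: mulr_ge0; [apply: mulr_ge0 => //; exact: ltW|exact: addr_ge0].
have l3 (x : \bar R) : (0 <= x -> 0 <= lne (3%:E + x))%E.
  move=> x0; rewrite lne_ge0; apply: (@le_trans _ _ 3%:E); first by rewrite lee_fin ler1n.
  by rewrite leeDl.
(* Differentiability of the solution is available at positive times; at time 0 the gradients agree
   because [w 0] and [w0] agree on the open half plane. *)
have [tz|tn0] := eqVneq t 0.
  have gE : normLp +oo (grad_length (w 0)) = normLp +oo (grad_length w0).
    by apply: normLp_eq => x Hx; exact: grad_length_eq w0E Hx.
  have EE : E = 1 by rewrite /E tz mulr0 expR0.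
  by rewrite EE mule1 tz gE.
have tp : 0 < t by rewrite lt_neqAle eq_sym tn0.
have wC := solution_class_C1 sol tp.
(* For zero data the solution and both gradients vanish, so both quotients are 0 whatever the
   inverse of 0 is. *)
have [mz|mn0] := eqVneq m 0.
  have wz x : half_plane x -> w t x = 0.
    move=> Hx; apply/eqP; rewrite -normr_le0 -mz; exact: (solution_sup hq sol w0m t0 Hx).
  have -> : normLp +oo (grad_length (w t)) = 0%E.
    apply/eqP; rewrite eq_le g0 andbT; apply: normLp_oo_le => // x Hx.
    rewrite ger0_norm ?sqrtr_ge0//; apply: (gradient_of_lipschitz (lexx 0) wC _ Hx) => // y z Hy Hz.
    by rewrite !wz// subrr normr0 mul0r.
  have -> : normLp +oo (grad_length w0) = 0%E.
    apply/eqP; rewrite eq_le g0 andbT; apply: normLp_oo_le => // x Hx.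
    rewrite ger0_norm ?sqrtr_ge0//; apply: (gradient_of_lipschitz (lexx 0) w0C _ Hx) => // y z Hy Hz.
    have w00 p : half_plane p -> w0 p = 0.
      by move=> Hp; apply/eqP; rewrite -normr_le0 -mz; exact: w0m.
    by rewrite !w00// subrr normr0 mul0r.
  rewrite mul0e adde0 lne_EFin// -EFinD -EFinM lee_fin ler_peMr//.
  by rewrite addr_ge0// ln_ge0// ler1n.
have {mn0}mp : 0 < m by rewrite lt_neqAle eq_sym mn0.
(* If the initial gradient is unbounded the right-hand side is infinite. *)
have [Gfin|] := boolP (normLp +oo (grad_length w0) \is a fin_num); last first.
  rewrite ge0_fin_numE// -leNgt leye_eq => /eqP ->.
  rewrite inver gt_eqF// gt0_mulye ?lte_fin ?invr_gt0//= gt0_mulye ?leey// lte_fin.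
  exact: lt_le_trans E1.
pose G0 := fine (normLp +oo (grad_length w0)).
have GE : normLp +oo (grad_length w0) = G0%:E by rewrite fineK.
have G00 : 0 <= G0 by rewrite -lee_fin -GE.
have w0L x y : half_plane x -> half_plane y -> `|w0 x - w0 y| <= G0 * len (x - y).
  move=> Hx Hy; apply: (lipschitz_of_gradient w0C) => // z Hz.
  rewrite -lee_fin -GE -[grad_length _ _]ger0_norm ?sqrtr_ge0//.
  by apply: le_normLp_oo => //; exact: continuous_grad_length.
(* The normalization in [ibound_far] needs a positive bound of the L^q norm; adding [m] provides it
   and costs only a constant in the exponent. *)
pose N := m + n.
have Np : 0 < N by rewrite ltr_wpDr.
have q0 : 0 < q by case/andP: hq => + _; exact: lt_le_trans.
have w0N : (\int[leb2]_(x in half_plane) (`|w0 x| `^ q)%:E <= (N `^ q)%:E)%E.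
  by apply/integral_pow_normLp => //; [exact: ltW|rewrite nE lee_fin /N lerDr].
pose L := lipmod q m N G0 t.
have L0 : 0 <= L by exact: lipmod_ge0.
have gw : (normLp +oo (grad_length (w t)) <= L%:E)%E.
  apply: normLp_oo_le => // x Hx; rewrite ger0_norm ?sqrtr_ge0//.
  apply: (gradient_of_lipschitz L0 wC) => // y z Hy Hz.
  exact: (solution_lipschitz hq sol mp Np G00 w0m w0N w0L t0 Hy Hz).
have gfin : normLp +oo (grad_length (w t)) \is a fin_num.
  by rewrite ge0_fin_numE// (le_lt_trans gw)// ltry.
set g := normLp +oo (grad_length (w t)) in gw gfin *.
have gE : g = (fine g)%:E by rewrite fineK.
have g0' : 0 <= fine g by rewrite -lee_fin -gE; exact: g0.
have gL : fine g <= L by rewrite -lee_fin -gE.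
have p3 (s : R) : 0 <= s -> 0 < 3 + s / m by move=> s0; rewrite ltr_pwDl// divr_ge0.
have EE : E = expR (4 * vel_const q * (m + n) * t) by [].
clearbody E G0.
rewrite gE GE !lne_ratioE// -EFinM lee_fin.
apply: (@le_trans _ _ (1 + ln (3 + L / m))).
  by rewrite lerD2l ler_ln ?posrE ?p3// lerD2l ler_wpM2r// invr_ge0.
rewrite logmodE// /logmod; apply: ler_wpM2l.
  by rewrite addr_ge0// ln_ge0//; have := divr_ge0 G00 m0; lra.
rewrite EE ler_expR /N ler_wpM2r//.
have := mulr_ge0 (ltW vc) n0; have := mulr_ge0 (ltW vc) m0.
by lra.
Qed.
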